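(* Suppose that the delay differential algebraic system $$E\dot{\mathbf x}(t)=\sum_{k=0}^m A_k\mathbf x(t-\tau_k)+B\mathbf v(t),\qquad \mathbf z(t)=C\mathbf x(t)$$ has a finite strong $H^2$-norm, i.e. $\|G\|^{\mathrm s}_{H^2}<\infty$, and that the basis polynomial $\varphi_N$ satisfies $|\varphi_N(-\tau_k)|\le|\varphi_N(0)|$ for $k=1,\dots,m$. Then the delay-free system $$\mathcal E_{11}\dot{\mathbf x}_{N,1}(t)=\tilde A\,\mathbf x_{N,1}(t)+\tilde B\,\mathbf v(t),\qquad \mathbf z_N(t)=\tilde C\,\mathbf x_{N,1}(t)+\tilde D\,\mathbf v(t),$$ obtained from the Lanczos tau discretization by eliminating the algebraic part, does not have feedthrough, i.e. $\tilde D=\mathbf 0$.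
   Context: **System.** $E,A_0,\dots,A_m\in\mathbb C^{n\times n}$, $B\in\mathbb C^{n\times p}$, $C\in\mathbb C^{q\times n}$; $E$ may be singular; $0=\tau_0<\tau_1<\dots<\tau_m<\infty$. Standing assumption (differentiation index at most one, semi-explicit system): if the columns of $\hat V$ form a basis of $\ker E$ and the columns of $\hat U^*$ form a basis of $\ker E^*$, then $\hat U A_0\hat V$ is nonsingular. The transfer function is $G(s)=C\big(sE-\sum_{k=0}^m A_ke^{-\tau_ks}\big)^{-1}B$; write $G(s;\boldsymbol\theta)$ for the transfer function with delays $\boldsymbol\tau=(\tau_1,\dots,\tau_m)$ replaced by $\boldsymbol\theta=(\theta_1,\dots,\theta_m)\in\mathbb R_+^m$. **Norms.** For a transfer function $H$, $\|H\|_{H^2}=\sup_{0<\alpha<\infty}\big(\frac1{2\pi}\int_{-\infty}^\infty\|H(\alpha+i\omega)\|_F^2\,d\omega\big)^{1/2}$, with $\|\cdot\|_F$ the Frobenius norm; the $H^2$-norm is infinite for systems that are not exponentially stable. With $B_\delta(\boldsymbol\tau)=\{\boldsymbol\theta\in\mathbb R_+^m:\|\boldsymbol\theta-\boldsymbol\tau\|<\delta\}$, the strong $H^2$-norm is $\|G\|^{\mathrm s}_{H^2}=\lim_{\delta\to0^+}\sup\{\|G(\cdot;\boldsymbol\theta)\|_{H^2}:\boldsymbol\theta\in B_\delta(\boldsymbol\tau)\}$. **Discretization.** Let $N\ge1$ and let $\{\varphi_j\}_{j=0}^N$ be a degree-graded sequence of orthogonal polynomials ($\deg\varphi_j=j$)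 on $[-\tau_m,0]$ for an inner product $\langle\cdot,\cdot\rangle$ given by a positive measure with infinite support in $[-\tau_m,0]$. $\mathbb P_N^n$ is the space of polynomials of degree at most $N$ from $[-\tau_m,0]$ to $\mathbb C^n$. Define $\varepsilon_\theta\xi=\xi(\theta)$, $\mathcal D\xi=\xi'$, and the truncation $\mathcal T_{N-1}:\mathbb P_N^n\to\mathbb P_{N-1}^n$, componentwise $(\mathcal T_{N-1}\xi)_j=(\xi)_j-\langle(\xi)_j,\varphi_N\rangle\varphi_N/\|\varphi_N\|^2$. Let $[\,\cdot\,]$ denote the matrix of an operator or functional in fixed bases of $\mathbb P_N^n\cong\mathbb C^{n(N+1)}$ and $\mathbb P_{N-1}^n\cong\mathbb C^{nN}$. Put $$\mathcal E_N=\begin{pmatrix}E[\varepsilon_0]\\ [\mathcal T_{N-1}]\end{pmatrix},\quad \mathcal A_N=\begin{pmatrix}\sum_{k=0}^mA_k[\varepsilon_{-\tau_k}]\\ [\mathcal D]\end{pmatrix},\quad \mathcal B_N=\begin{pmatrix}B\\ \mathbf 0\end{pmatrix},\quad \mathcal C_N=C[\varepsilon_0].$$ **Elimination.** Let $V$ and $U^*$ have orthogonal (nonzero) columns forming bases of $\ker\mathcal E_N$ and $\ker\mathcal E_N^*$ respectively; let the columns of $V^\perp$ be a basis of the orthogonal complement of the column span of $V$, and the rows of $U^\perp$ a basis of the orthogonal complement of the row span of $U$. Set $\mathcal E_{11}=U^\perp\mathcal E_NV^\perp$, $\mathcal A_{11}=U^\perp\mathcal A_NV^\perp$, $\mathcal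 A_{12}=U^\perp\mathcal A_NV$, $\mathcal A_{21}=U\mathcal A_NV^\perp$, $\mathcal A_{22}=U\mathcal A_NV$, $\mathcal B_1=U^\perp\mathcal B_N$, $\mathcal B_2=U\mathcal B_N$, $\mathcal C_1=\mathcal C_NV^\perp$, $\mathcal C_2=\mathcal C_NV$. Under the hypotheses of the claim $\mathcal A_{22}$ is invertible, and $\tilde A=\mathcal A_{11}-\mathcal A_{12}\mathcal A_{22}^{-1}\mathcal A_{21}$, $\tilde B=\mathcal B_1-\mathcal A_{12}\mathcal A_{22}^{-1}\mathcal B_2$, $\tilde C=\mathcal C_1-\mathcal C_2\mathcal A_{22}^{-1}\mathcal A_{21}$, $\tilde D=-\mathcal C_2\mathcal A_{22}^{-1}\mathcal B_2$. *)

(* Defs.v *)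
From HB Require Import structures.
From mathcomp Require Import all_boot all_order all_algebra.
From mathcomp Require Import all_classical all_reals all_analysis.
From mathcomp Require Import sesquilinear spectral qpoly complex.

Set Implicit Arguments.
Unset Strict Implicit.
Unset Printing Implicit Defensive.

Import Order.TTheory GRing.Theory Num.Theory.
Import numFieldNormedType.Exports.

Local Open Scope classical_set_scope.
Local Open Scope ring_scope.
Local Open Scope complex_scope.
Local Open Scope sesquilinear_scope.

Section Linear_algebra.
Variable R : realType.
Local Notation C := R[i].

Definition frob p q (M : 'M[C]_(p, q)) : R :=
  Num.sqrt (\sum_i \sum_j ComplexField.Normc.normc (M i j) ^+ 2).

(* MathComp's row spaces and kernels act on row vectors, whence the
   transpositions: the columns of W form a basis of {x | M *m x = 0}. *)
Definition ker_basis p q r (M : 'M[C]_(p, q)) (W : 'M[C]_(q, r)) : Prop :=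
  row_free W^T /\ (W^T == kermx M^T)%MS.

(* The rows of W form a basis of the orthogonal complement, for the Hermitian
   inner product, of the row space of U. *)
Definition orth_row_basis p q r (U : 'M[C]_(p, q)) (W : 'M[C]_(r, q)) : Prop :=
  row_free W /\ (W == orthomx (@Num.conj C) 1%:M U)%MS.

End Linear_algebra.

Section Delay_system.
Variables (R : realType) (n p q m : nat).
Local Notation C := R[i].

Definition cexp (z : C) : C :=
  (expR (complex.Re z))%:C * (cos (complex.Im z) +i* sin (complex.Im z)).

(* The vector theta = (theta_1, ..., theta_m) preceded by theta_0 = 0. *)
Definition delay (theta : 'rV[R]_m) (k : 'I_m.+1) : R :=
  if unlift ord0 k is Some j then theta 0 j else 0.

Definition max_delay (theta : 'rV[R]_m) : R :=
  \big[Num.max/0]_(k < m.+1) delay theta k.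

Variables (E : 'M[C]_n) (A : 'I_m.+1 -> 'M[C]_n).
Variables (B : 'M[C]_(n, p)) (Cm : 'M[C]_(q, n)).

(* Columns of Vh: basis of ker E; columns of Uh^*: basis of ker E^*. *)
Definition semi_explicit_index1 : Prop :=
  forall (r : nat) (Vh : 'M[C]_(n, r)) (Uh : 'M[C]_(r, n)),
    ker_basis E Vh -> ker_basis (E ^t*) (Uh ^t*) ->
    Uh *m A ord0 *m Vh \in unitmx.

Definition transfer (theta : 'rV[R]_m) (s : C) : 'M[C]_(q, p) :=
  Cm *m invmx (s *: E - \sum_k cexp (- (s * (delay theta k)%:C)) *: A k) *m B.

(* Continuous solutions on [- max_delay, +oo[ of the unforced system, for which
   only E x has to be differentiable; the algebraic equations at t = 0, i.e.
   consistency of the initial function, follow by continuity.  Continuity and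
   differentiability are expressed on real and imaginary parts. *)
Definition is_solution (theta : 'rV[R]_m) (x : R -> 'cV[C]_n) : Prop :=
  (forall i,
     {within `[- max_delay theta, +oo[,
        continuous (fun t => complex.Re (x t i 0) : R)} /\
     {within `[- max_delay theta, +oo[,
        continuous (fun t => complex.Im (x t i 0) : R)}) /\
  (forall t : R, 0 < t -> forall i,
     let rhs := (\sum_k A k *m x (t - delay theta k)) i 0 in
     is_derive t 1 (fun u => complex.Re ((E *m x u) i 0) : R)
       (complex.Re rhs) /\
     is_derive t 1 (fun u => complex.Im ((E *m x u) i 0) : R)
       (complex.Im rhs)).

Definition exponentially_stable (theta : 'rV[R]_m) : Prop :=
  exists K gamma : R, 0 < gamma /\
    forall x, is_solution theta x -> forall t : R, 0 <= t ->
      frob (x t) <= K * expR (- gamma * t) *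
        sup [set frob (x s) | s in `[- max_delay theta, 0]].

(* Infinite by convention when the system is not exponentially stable. *)
Definition H2_norm (theta : 'rV[R]_m) : \bar R :=
  if `[< exponentially_stable theta >] then
    ereal_sup [set sqrte (((2 * pi)^-1)%:E *
       \int[lebesgue_measure]_w (frob (transfer theta (a +i* w)) ^+ 2)%:E)%E
      | a in `]0, +oo[%classic]
  else +oo%E.

Definition delay_ball (tau : 'rV[R]_m) (delta : R) : set 'rV[R]_m :=
  [set theta | (forall j, 0 <= theta 0 j) /\
     Num.sqrt (\sum_j (theta 0 j - tau 0 j) ^+ 2) < delta].

Definition strong_H2_norm (tau : 'rV[R]_m) : \bar R :=
  lim ((fun delta : R => ereal_sup [set H2_norm theta
          | theta in delay_ball tau delta]) @ 0^'+).

End Delay_system.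

Section Orthogonal_polynomials.
Variable R : realType.
Local Notation C := R[i].
Variable mu : {finite_measure set (measurableTypeR R) -> \bar R}.

Definition msupport : set R :=
  [set x | forall e : R, 0 < e -> (0 < mu `](x - e)%R, (x + e)%R[%classic)%E].

(* Complex coefficients are allowed; the second argument is conjugated. *)
Definition inner (h : R) (f g : {poly C}) : C :=
  let fg (t : R) : C := f.[t%:C] * Num.conj (g.[t%:C]) in
  (\int[mu]_(t in `[- h, 0]) complex.Re (fg t)) +i*
  (\int[mu]_(t in `[- h, 0]) complex.Im (fg t)).

Definition orthogonal_sequence (h : R) N (phi : 'I_N.+1 -> {poly C}) : Prop :=
  (forall j, size (phi j) = j.+1) /\
  (forall j k, j != k -> inner h (phi j) (phi k) = 0).

End Orthogonal_polynomials.

(* polyvec n d.+1 is the space of C^n-valued polynomials of degree at most d;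
   on an interval of positive length these are the polynomial functions. *)
Notation polyvec R n d := {ffun 'I_n -> {poly_d (complex (Real.sort R))}}.

Section Lanczos_tau.
Variables (R : realType) (n p q m N : nat).
Local Notation C := R[i].

Definition point_eval (theta : R) (xi : polyvec R n N.+1) : 'cV[C]_n :=
  \col_i (xi i : {poly C}).[theta%:C].

(* In the next two operators npolyp only changes the type: the polynomials it
   is applied to have size at most N, for trunc by orthogonality of phi_N to
   the polynomials of degree less than N. *)
Definition diff_op (xi : polyvec R n N.+1) : polyvec R n N :=
  [ffun j => npolyp N ((xi j : {poly C})^`())].

Definition trunc (mu : {finite_measure set (measurableTypeR R) -> \bar R})
    (h : R) (phiN : {poly C}) (xi : polyvec R n N.+1) : polyvec R n N :=
  [ffun j => npolyp N ((xi j : {poly C}) -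
     (inner mu h (xi j : {poly C}) phiN / inner mu h phiN phiN) *: phiN)].

(* The matrices below act on column vectors of coordinates. *)
Variables (X : (n * N.+1).-tuple (polyvec R n N.+1)).
Variables (Y : (n * N).-tuple (polyvec R n N)).

Definition eval_mx (theta : R) : 'M[C]_(n, n * N.+1) :=
  \matrix_(i, j) point_eval theta (tnth X j) i 0.

Definition op_mx (f : polyvec R n N.+1 -> polyvec R n N) :
    'M[C]_(n * N, n * N.+1) :=
  \matrix_(i, j) coord Y i (f (tnth X j)).

Variables (E : 'M[C]_n) (A : 'I_m.+1 -> 'M[C]_n).
Variables (B : 'M[C]_(n, p)) (Cm : 'M[C]_(q, n)) (tau : 'rV[R]_m).
Variables (mu : {finite_measure set (measurableTypeR R) -> \bar R}).
Variables (phiN : {poly C}).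

Definition tau_E : 'M[C]_(n + n * N, n * N.+1) :=
  col_mx (E *m eval_mx 0) (op_mx (trunc mu (delay tau ord_max) phiN)).

Definition tau_A : 'M[C]_(n + n * N, n * N.+1) :=
  col_mx (\sum_k A k *m eval_mx (- delay tau k)) (op_mx diff_op).

Definition tau_B : 'M[C]_(n + n * N, p) := col_mx B 0.

Definition tau_C : 'M[C]_(q, n * N.+1) := Cm *m eval_mx 0.

End Lanczos_tau.

Section Elimination.
Variables (R : realType).
Local Notation C := R[i].

(* sysE x' = sysA x + sysB v,  z = sysC x + sysD v *)
Record delay_free_system (d p q : nat) := DelayFreeSystem {
  sysE : 'M[C]_d;
  sysA : 'M[C]_d;
  sysB : 'M[C]_(d, p);
  sysC : 'M[C]_(q, d);
  sysD : 'M[C]_(q, p)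
}.

Variables (k l p q r d : nat).
Variables (EN AN : 'M[C]_(k, l)) (BN : 'M[C]_(k, p)) (CN : 'M[C]_(q, l)).
Variables (V : 'M[C]_(l, r)) (U : 'M[C]_(r, k)).
Variables (Vp : 'M[C]_(l, d)) (Up : 'M[C]_(d, k)).

Definition elimination_matrices : Prop :=
  [/\ ker_basis EN V /\ is_diag_mx (V ^t* *m V),
      ker_basis (EN ^t*) (U ^t*) /\ is_diag_mx (U *m U ^t*),
      orth_row_basis V^T Vp^T &
      orth_row_basis U Up].

Definition algebraic_block : 'M[C]_r := U *m AN *m V.

Definition eliminate : delay_free_system d p q :=
  let E11 := Up *m EN *m Vp in
  let A11 := Up *m AN *m Vp in
  let A12 := Up *m AN *m V in
  let A21 := U *m AN *m Vp in
  let A22inv := invmx algebraic_block in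
  let B1 := Up *m BN in
  let B2 := U *m BN in
  let C1 := CN *m Vp in
  let C2 := CN *m V in
  DelayFreeSystem E11
    (A11 - A12 *m A22inv *m A21)
    (B1 - A12 *m A22inv *m B2)
    (C1 - C2 *m A22inv *m A21)
    (- (C2 *m A22inv *m B2)).

Definition no_feedthrough (S : delay_free_system d p q) : Prop := sysD S = 0.

End Elimination.

(* Main.v *)
Require Import Defs.
From HB Require Import structures.
From mathcomp Require Import all_boot all_order all_algebra.
From mathcomp Require Import all_classical all_reals all_analysis.
From mathcomp Require Import measurable_realfun.
From mathcomp Require Import sesquilinear spectral qpoly complex.
From mathcomp Require Import ring lra.

(** Write the delays' exponentials as independent variables: with A(z) = A_0 +
sum_j z_j A_j, the characteristic matrix at s is s E - A(z), where z_j =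
exp (- s theta_j).  Both claims reduce to two facts about every z in the
closed unit polydisc:
- if E x = 0 and A(z) x lies in the range of E, then x = 0;
- if E x = 0 and A(z) x + B v lies in the range of E, then C x = 0
([algebraic_part_injective] and [algebraic_part_output]).

Indeed, the kernel of the leading matrix of the discretization consists of
the polynomials phi_N v with E v = 0: truncation kills exactly the multiples
of phi_N, and phi_N (0) <> 0 because otherwise phi_N = t psi with psi
orthogonal to phi_N, and the integral of t |psi|^2 could not vanish
([phiN_at0]).  On such a polynomial the delayed evaluations act as
phi_N (0) A(z) with z_j = phi_N (- tau_j) / phi_N (0), and the assumption on
phi_N says precisely that this z lies in the closed unit polydisc.  As the
rows of U annihilate exactly the range of the leading matrix, a null vector
of the algebraic block is an x as in the first fact, and a column of the
feedthrough matrix is C x for an x as in the second fact.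

To handle both facts, bring E to the form diag(I, 0) and divide the
differential equations by s.  The resulting [pencil] extends continuously to
1/s = 0, where its determinant, [limit_det], vanishes at z iff the first fact
fails.  A finite strong H2-norm makes all delays in a box around tau
exponentially stable, with finite energy of the transfer function.

First fact.  limit_det is nonzero at 0 (index one).  If it vanished in the
polydisc, then, moving the tori |z_j| = exp (- t tau_j) from 0 outwards and
using the minimum modulus principle, it would vanish at a point z0 of one of
these tori with t >= 0 ([nonvanishing]).  The phases of z0 are those of
exp (- s theta_j) for suitable theta close to tau and s with large imaginary
part, so by a Hurwitz argument ([hurwitz]) the characteristic matrix is
singular close to s.  If t > 0 this is a root in the right half-plane.
If t = 0 one must get arbitrarily close to the imaginary axis for a fixed
theta, as the decay rate depends on theta; almost periods
([almost_period]) provide infinitely many candidates s.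

Second fact.  By Cramer's rule the value at z of the limit of the transfer
function at infinite frequency has the numerator [transfer_numerator].  If
it did not vanish at the point exp (- theta_j), the transfer function would,
on the line Re s = 1, stay away from zero near infinitely many almost
periods, so its energy would be infinite ([transfer_numerator_zero]).  These
points form a product of infinite sets, so the numerator, a polynomial in
each z_j, vanishes identically. *)

Set Implicit Arguments.
Unset Strict Implicit.
Unset Printing Implicit Defensive.

Import Order.TTheory GRing.Theory Num.Theory.
Import numFieldNormedType.Exports.

Local Open Scope classical_set_scope.
Local Open Scope ring_scope.
Local Open Scope complex_scope.

Local Notation nc := ComplexField.Normc.normc.

(** * Modulus and exponential of complex numbers *)

Section Modulus.
Variable R : realType.
Implicit Types (z w : R[i]) (x y : R).

Lemma ncE z : nc z = Num.sqrt (complex.Re z ^+ 2 + complex.Im z ^+ 2).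
Proof. by case: z. Qed.

Lemma normCE z : `|z| = (nc z)%:C.
Proof. by rewrite normc_def ncE. Qed.

Lemma ncM z w : nc (z * w) = nc z * nc w.
Proof. exact: ComplexField.Normc.normcM. Qed.

Lemma nc_ge0 z : 0 <= nc z.
Proof. by rewrite ncE sqrtr_ge0. Qed.

Lemma ncN z : nc (- z) = nc z.
Proof. by case: z => a b; rewrite !ncE /= !sqrrN. Qed.

Lemma nc_eq0 z : (nc z == 0) = (z == 0).
Proof.
apply/eqP/eqP => [/ComplexField.Normc.eq0_normc//|->].
exact: ComplexField.Normc.normc0.
Qed.

Lemma nc_gt0 z : (0 < nc z) = (z != 0).
Proof. by rewrite lt_neqAle eq_sym nc_eq0 nc_ge0 andbT. Qed.

Lemma ncD z w : nc (z + w) <= nc z + nc w.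
Proof. by have := ler_normD z w; rewrite !normCE -rmorphD/= lecR. Qed.

Lemma ncB z w : nc (z - w) <= nc z + nc w.
Proof. by rewrite -(ncN w) ncD. Qed.

Lemma nc_subC z w : nc (z - w) = nc (w - z).
Proof. by rewrite -ncN opprB. Qed.

Lemma nc0 : nc (0 : R[i]) = 0.
Proof. exact: ComplexField.Normc.normc0. Qed.

Lemma nc1 : nc (1 : R[i]) = 1.
Proof. exact: ComplexField.Normc.normc1. Qed.

Lemma ncV z : nc z^-1 = (nc z)^-1.
Proof. exact: ComplexField.Normc.normcV. Qed.

Lemma ncX z k : nc (z ^+ k) = nc z ^+ k.
Proof. by elim: k => [|k IH]; rewrite ?expr0 ?nc1// !exprS ncM IH. Qed.

Lemma nc_real x : nc x%:C = `|x|.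
Proof. by rewrite ncE /= expr0n addr0 sqrtr_sqr. Qed.

Lemma ncRe z : `|complex.Re z| <= nc z.
Proof. by rewrite ncE -sqrtr_sqr ler_wsqrtr// lerDl sqr_ge0. Qed.

Lemma ncIm z : `|complex.Im z| <= nc z.
Proof. by rewrite ncE -sqrtr_sqr ler_wsqrtr// lerDr sqr_ge0. Qed.

Lemma nc_le_ReIm z : nc z <= `|complex.Re z| + `|complex.Im z|.
Proof.
case: z => a b; rewrite [complex.Re _]/= [complex.Im _]/=.
have -> : (a +i* b)%C = a%:C + 'i%C * b%:C by apply/eqP; rewrite eq_complex/=; apply/andP; split; apply/eqP; ring.
apply: le_trans (ncD _ _) _; rewrite ncM !nc_real.
by rewrite (_ : nc 'i%C = 1) ?mul1r// ncE /= expr0n expr1n add0r sqrtr1.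
Qed.

Lemma nc_sum (I : Type) (r : seq I) (P : pred I) (F : I -> R[i]) :
  nc (\sum_(i <- r | P i) F i) <= \sum_(i <- r | P i) nc (F i).
Proof.
elim/big_rec2: _ => [|i y z _ h]; first by rewrite nc0.
by apply: le_trans (ncD _ _) _; rewrite lerD2l.
Qed.

Lemma nc_prod (I : Type) (r : seq I) (P : pred I) (F : I -> R[i]) :
  nc (\prod_(i <- r | P i) F i) = \prod_(i <- r | P i) nc (F i).
Proof. by elim/big_rec2: _ => [|i y z _ <-]; rewrite ?nc1 ?ncM. Qed.

Lemma nc_dist z w : `|nc z - nc w| <= nc (z - w).
Proof.
have h1 := ncD (z - w) w; rewrite subrK in h1.
have h2 := ncD (w - z) z; rewrite subrK (nc_subC w) in h2.
by rewrite ler_norml; apply/andP; split; lra.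
Qed.

Lemma cReD z w : complex.Re (z + w) = complex.Re z + complex.Re w.
Proof. by case: z; case: w. Qed.
Lemma cImD z w : complex.Im (z + w) = complex.Im z + complex.Im w.
Proof. by case: z; case: w. Qed.
Lemma cReM z w : complex.Re (z * w) =
  complex.Re z * complex.Re w - complex.Im z * complex.Im w.
Proof. by case: z; case: w. Qed.
Lemma cImM z w : complex.Im (z * w) =
  complex.Re z * complex.Im w + complex.Im z * complex.Re w.
Proof. by case: z; case: w => c d a b /=; rewrite addrC mulrC [in RHS]addrC; ring. Qed.
Lemma cReN z : complex.Re (- z) = - complex.Re z.
Proof. by case: z. Qed.
Lemma cImN z : complex.Im (- z) = - complex.Im z.
Proof. by case: z. Qed.
Lemma cReMr x z : complex.Re (z * x%:C) = complex.Re z * x.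
Proof. by rewrite cReM /= mulr0 subr0. Qed.
Lemma cImMr x z : complex.Im (z * x%:C) = complex.Im z * x.
Proof. by rewrite cImM /= mulr0 add0r. Qed.
Lemma cRe_sum (I : Type) (r : seq I) (P : pred I) (F : I -> R[i]) :
  complex.Re (\sum_(i <- r | P i) F i) = \sum_(i <- r | P i) complex.Re (F i).
Proof. by elim/big_rec2: _ => [//|i y z _ <-]; rewrite cReD. Qed.
Lemma cIm_sum (I : Type) (r : seq I) (P : pred I) (F : I -> R[i]) :
  complex.Im (\sum_(i <- r | P i) F i) = \sum_(i <- r | P i) complex.Im (F i).
Proof. by elim/big_rec2: _ => [//|i y z _ <-]; rewrite cImD. Qed.

Lemma complex_eqP z w :
  complex.Re z = complex.Re w -> complex.Im z = complex.Im w -> z = w.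
Proof. by case: z; case: w => c d a b /= -> ->. Qed.

End Modulus.

Section Exponential.
Variable R : realType.
Implicit Types (z w : R[i]) (x y t : R).

Lemma Re_cexp z : complex.Re (cexp z) = expR (complex.Re z) * cos (complex.Im z).
Proof. by rewrite /cexp cReM /= mul0r subr0. Qed.

Lemma Im_cexp z : complex.Im (cexp z) = expR (complex.Re z) * sin (complex.Im z).
Proof. by rewrite /cexp cImM /= mul0r addr0. Qed.

Lemma cexpD z w : cexp (z + w) = cexp z * cexp w.
Proof.
apply: complex_eqP.
  by rewrite Re_cexp cReM !Re_cexp !Im_cexp cReD cImD expRD cosD; ring.
by rewrite Im_cexp cImM !Re_cexp !Im_cexp cReD cImD expRD sinD; ring.
Qed.

Lemma cexp0 : cexp (0 : R[i]) = 1.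
Proof.
by apply: complex_eqP; rewrite ?Re_cexp ?Im_cexp /= expR0 ?cos0 ?sin0 ?mulr1 ?mulr0.
Qed.

Lemma nc_cexp z : nc (cexp z) = expR (complex.Re z).
Proof.
rewrite ncE Re_cexp Im_cexp !exprMn -mulrDr cos2Dsin2 mulr1 sqrtr_sqr.
by rewrite ger0_norm// expR_ge0.
Qed.

Lemma cexp_neq0 z : cexp z != 0.
Proof. by rewrite -nc_gt0 nc_cexp expR_gt0. Qed.

(** Differentiability of a path is required of its real and imaginary parts,
    which is the form in which solutions of the delay system are defined. *)
Definition is_cderive (F : R -> R[i]) (F' : R -> R[i]) : Prop :=
  forall t : R, is_derive t 1 (fun u => complex.Re (F u) : R) (complex.Re (F' t)) /\
     is_derive t 1 (fun u => complex.Im (F u) : R) (complex.Im (F' t)).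

Lemma is_deriveZ_var (c : R) (f : R -> R) (t df : R) :
  is_derive t 1 f df -> is_derive t 1 (fun u => c * f u) (c * df).
Proof. by move=> h; exact: (is_deriveZ c h). Qed.

Lemma is_cderive_cexp z :
  is_cderive (fun t => cexp (z * t%:C)) (fun t => z * cexp (z * t%:C)).
Proof.
move=> t; case: z => a b.
have e (c : R) : is_derive t 1 (fun u : R => c * u) c.
  by have := is_deriveZ_var c (is_derive_id t 1); rewrite mulr1.
have E : is_derive t 1 (fun u => expR (a * u)) (expR (a * t) * a).
  have := @is_derive1_comp _ expR (fun u => a * u) t _ _ (is_derive_expR _) (e a).
  by [].
have C : is_derive t 1 (fun u => cos (b * u)) (- sin (b * t) * b).
  exact: (@is_derive1_comp _ cos (fun u => b * u) t _ _ (is_derive_cos _) (e b)).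
have S : is_derive t 1 (fun u => sin (b * u)) (cos (b * t) * b).
  exact: (@is_derive1_comp _ sin (fun u => b * u) t _ _ (is_derive_sin _) (e b)).
split.
- rewrite (_ : (fun u => _) = (fun u => expR (a * u)) * (fun u => cos (b * u))).
    apply: is_derive_eq (is_deriveM E C) _.
    by rewrite cReM Re_cexp Im_cexp cReMr cImMr /= /GRing.scale /=; ring.
  by apply/funext => u; rewrite Re_cexp cReMr cImMr.
- rewrite (_ : (fun u => _) = (fun u => expR (a * u)) * (fun u => sin (b * u))).
    apply: is_derive_eq (is_deriveM E S) _.
    by rewrite cImM Re_cexp Im_cexp cReMr cImMr /= /GRing.scale /=; ring.
  by apply/funext => u; rewrite Im_cexp cReMr cImMr.
Qed.

End Exponential.

(** * Taylor expansion of the complex exponential *)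

Section Taylor.
Variable R : realType.
Implicit Types (z w : R[i]) (x y t : R).

Lemma is_derive_continuous (f : R -> R) (t d : R) :
  is_derive t 1 f d -> {for t, continuous f}.
Proof.
move=> h; apply: differentiable_continuous; apply/derivable1_diffP.
exact: (@ex_derive _ _ _ _ _ _ _ h).
Qed.

(** Integrating a bound on the derivative: compare F with c t^(k+1) / (k+1)!
    by the mean value theorem. *)
Lemma derive_bound (F f : R -> R) (c : R) k :
  (forall t, is_derive t 1 F (f t)) -> F 0 = 0 ->
  (forall t, 0 <= t <= 1 -> `|f t| <= c * (t ^+ k / k`!%:R)) ->
  forall t, 0 <= t <= 1 -> `|F t| <= c * (t ^+ k.+1 / k.+1`!%:R).
Proof.
have main (G g : R -> R) : (forall t, is_derive t 1 G (g t)) -> G 0 = 0 ->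
  (forall t, 0 <= t <= 1 -> g t <= c * (t ^+ k / k`!%:R)) ->
  forall t, 0 <= t <= 1 -> G t <= c * (t ^+ k.+1 / k.+1`!%:R).
  move=> dG G0 gc t /andP[t0 t1].
  pose p (u : R) : R := (c / k.+1`!%:R) * (u ^+ k.+1) - G u.
  have dp (u : R) : is_derive u 1 p (c * (u ^+ k / k`!%:R) - g u).
    apply: is_deriveB => /=.
    have -> : (fun u : R => c / k.+1`!%:R * u ^+ k.+1) =
      (fun u : R => c / k.+1`!%:R * (id ^+ k.+1) u).
      by apply/funext => v; rewrite exprfctE.
    apply: is_derive_eq (is_deriveZ_var _ (is_deriveX k.+1 (is_derive_id u 1))) _.
    rewrite /GRing.scale /= factS natrM.
    by field; rewrite pnatr_eq0 -lt0n fact_gt0 /= addrC natr1 pnatr_eq0.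
  have [v] := MVT_segment t0 (fun x _ => dp x)
    (continuous_subspaceT (fun x => is_derive_continuous (dp x))).
  rewrite in_itv /= => /andP[v0 vt] e.
  have : 0 <= p t - p 0.
    rewrite e mulr_ge0 ?subr_ge0//; apply: gc.
    by rewrite v0 (le_trans vt).
  rewrite /p G0 expr0n /= mulr0 subr0 subr0 subr_ge0.
  by rewrite mulrAC mulrA.
move=> dF F0 fc t ht; rewrite ler_norml; apply/andP; split; last first.
  by apply: main ht => // u hu; apply: le_trans (ler_norm _) (fc u hu).
rewrite lerNl; apply: (main (fun u => - F u) (fun u => - f u)) ht.
- by rewrite /= F0 oppr0.
- by move=> u hu; apply: le_trans (fc u hu); rewrite -normrN; exact: ler_norm.
Qed.

Lemma is_cderiveB F F' G G' : is_cderive F F' -> is_cderive G G' ->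
  @is_cderive R (fun t => F t - G t) (fun t => F' t - G' t).
Proof.
move=> hF hG t; have [a b] := hF t; have [c d] := hG t; split; cbv beta.
- rewrite cReD cReN; have := is_deriveB a c.
  by congr (is_derive _ _ _ _); apply/funext => u; rewrite cReD cReN.
- rewrite cImD cImN; have := is_deriveB b d.
  by congr (is_derive _ _ _ _); apply/funext => u; rewrite cImD cImN.
Qed.

Lemma is_cderive_sum k (F F' : 'I_k -> R -> R[i]) :
  (forall i, is_cderive (F i) (F' i)) ->
  is_cderive (fun t => \sum_i F i t) (fun t => \sum_i F' i t).
Proof.
move=> h t; split.
- have := is_derive_sum (fun i => (h i t).1); rewrite -cRe_sum.
  by congr (is_derive _ _ _ _); apply/funext => u; rewrite fct_sumE cRe_sum.
- have := is_derive_sum (fun i => (h i t).2); rewrite -cIm_sum.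
  by congr (is_derive _ _ _ _); apply/funext => u; rewrite fct_sumE cIm_sum.
Qed.

Lemma is_cderive_mono (c : R[i]) k :
  is_cderive (fun t => c * (t ^+ k)%:C) (fun t => c * (k%:R * t ^+ k.-1)%:C).
Proof.
have d (t b : R) : is_derive t 1 (fun u : R => b * u ^+ k) (b * (k%:R * t ^+ k.-1)).
  have := is_deriveZ_var b (is_deriveX k (is_derive_id t 1)).
  rewrite /GRing.scale /= mulr1.
  by congr (is_derive _ _ _ _); apply/funext => v; rewrite exprfctE.
move=> t; split; cbv beta.
- rewrite cReMr; have := d t (complex.Re c).
  by congr (is_derive _ _ _ _); apply/funext => u; rewrite cReMr.
- rewrite cImMr; have := d t (complex.Im c).
  by congr (is_derive _ _ _ _); apply/funext => u; rewrite cImMr.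
Qed.

Definition exp_trunc k z : R[i] := \sum_(j < k) z ^+ j / j`!%:R.

Lemma exp_truncE k z t : exp_trunc k (z * t%:C) =
  \sum_(j < k) (z ^+ j / j`!%:R) * (t ^+ j)%:C.
Proof. by apply: eq_bigr => j _; rewrite exprMn -rmorphXn mulrAC. Qed.

Lemma natCE k : (k%:R : R[i]) = (k%:R : R)%:C.
Proof. by rewrite rmorph_nat. Qed.

Lemma is_cderive_exp_trunc k z :
  is_cderive (fun t => exp_trunc k.+1 (z * t%:C))
             (fun t => z * exp_trunc k (z * t%:C)).
Proof.
have h := is_cderive_sum (fun j : 'I_k.+1 => is_cderive_mono (z ^+ j / j`!%:R) j).
have e1 : (fun t => exp_trunc k.+1 (z * t%:C)) =
  (fun t => \sum_(j < k.+1) (z ^+ j / j`!%:R) * (t ^+ j)%:C).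
  by apply/funext => t; exact: exp_truncE.
have e2 : (fun t => z * exp_trunc k (z * t%:C)) =
  (fun t => \sum_(j < k.+1) (z ^+ j / j`!%:R) * (j%:R * t ^+ j.-1)%:C).
  apply/funext => t; rewrite exp_truncE big_ord_recl /= mul0r mulr0 add0r mulr_sumr.
  apply: eq_bigr => j _.
  rewrite /bump /= add1n /= rmorphM /= rmorph_nat exprS factS natrM.
  by field; rewrite pnatr_eq0 -lt0n fact_gt0 /= addrC natr1 pnatr_eq0.
by rewrite e1 e2.
Qed.

(** The remainder of order k+1 along t z vanishes at t = 0 and has derivative
    z times the remainder of order k. Real and imaginary parts are bounded
    separately, whence the factor 2. *)
Lemma cexp_taylor_path k z t : 0 <= t <= 1 ->
  nc (cexp (z * t%:C) - exp_trunc k (z * t%:C)) <=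
  expR (nc z) * (2 * nc z) ^+ k * (t ^+ k / k`!%:R).
Proof.
elim: k t => [|k IH] t ht.
  rewrite /exp_trunc big_ord0 subr0 !expr0 fact0 invr1 !mulr1 nc_cexp ler_expR.
  apply: le_trans (ler_norm _) _; apply: le_trans (ncRe _) _.
  case/andP: ht => t0 t1.
  by rewrite ncM nc_real ger0_norm// ler_piMr// nc_ge0.
have d := is_cderiveB (is_cderive_cexp z) (is_cderive_exp_trunc k z).
pose c : R := nc z * (expR (nc z) * (2 * nc z) ^+ k).
have b (u : R) : 0 <= u <= 1 ->
    nc (z * cexp (z * u%:C) - z * exp_trunc k (z * u%:C)) <= c * (u ^+ k / k`!%:R).
  by move=> hu; rewrite -mulrBr ncM /c -mulrA ler_wpM2l ?nc_ge0//; exact: IH.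
have z0 : cexp (z * 0%:C) - exp_trunc k.+1 (z * 0%:C) = 0.
  rewrite mulr0 cexp0 /exp_trunc big_ord_recl /= expr0 divr1 big1 ?addr0 ?subrr//.
  by move=> i _; rewrite expr0n /= mul0r.
have hr := derive_bound (fun u => (d u).1) (congr1 (@complex.Re R) z0)
  (fun u hu => le_trans (ncRe _) (b u hu)) ht.
have hi := derive_bound (fun u => (d u).2) (congr1 (@complex.Im R) z0)
  (fun u hu => le_trans (ncIm _) (b u hu)) ht.
apply: le_trans (nc_le_ReIm _) _; apply: le_trans (lerD hr hi) _.
by rewrite /c [(2 * nc z) ^+ k.+1]exprS -mulrDl; rewrite le_eqVlt; apply/orP; left; apply/eqP; congr (_ * _); ring.
Qed.

(** Used in two regimes: k fixed and z small, for the isolation of zeros; z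
    bounded and k large, for the approximation by polynomials. *)
Lemma cexp_taylor k z :
  nc (cexp z - exp_trunc k z) <= expR (nc z) * ((2 * nc z) ^+ k / k`!%:R).
Proof.
have := @cexp_taylor_path k z 1; rewrite mulr1 expr1n ler01 lexx => /(_ isT).
by rewrite mul1r mulrA.
Qed.

End Taylor.

(** * Uniform limits along a filter *)

Section Uniform_limits.
Variables (R : realType) (T Z : Type) (F : set_system T) (D : set Z).
Context {FF : Filter F}.
Implicit Types (f g : T -> Z -> R[i]) (l : Z -> R[i]).

(** Convergence along F, uniformly over D, to a bounded limit. With
    boundedness included, these limits are stable under sums, products and
    determinants, so that one notion serves for continuity (F a neighborhood
    filter), locally uniform approximation and perturbation of parameters. *)
Definition ulim f l : Prop :=
  (exists M : R, forall x, D x -> nc (l x) <= M) /\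
  forall e : R, 0 < e -> \forall t \near F, forall x, D x -> nc (f t x - l x) < e.

Lemma ulim_cst l : (exists M : R, forall x, D x -> nc (l x) <= M) ->
  ulim (fun _ => l) l.
Proof.
move=> lb; split=> // e e0.
by near=> t => x _; rewrite subrr nc0.
Unshelve. all: by end_near. Qed.

Lemma ulim_cst1 (c : R[i]) : ulim (fun _ _ => c) (fun _ => c).
Proof. by apply: ulim_cst; exists (nc c). Qed.

Lemma ulimD f g l k : ulim f l -> ulim g k ->
  ulim (fun t x => f t x + g t x) (fun x => l x + k x).
Proof.
move=> [[M hM] fl] [[N hN] gk]; split.
  by exists (M + N) => x Dx; apply: le_trans (ncD _ _) _; apply: lerD; auto.
move=> e e0; have e2 : 0 < e / 2 by lra.
near=> t => x Dx.
have h1 : nc (f t x - l x) < e / 2 by move: x Dx; near: t; exact: fl.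
have h2 : nc (g t x - k x) < e / 2 by move: x Dx {h1}; near: t; exact: gk.
rewrite opprD addrACA; apply: le_lt_trans (ncD _ _) _; lra.
Unshelve. all: by end_near. Qed.

Lemma ulimM f g l k : ulim f l -> ulim g k ->
  ulim (fun t x => f t x * g t x) (fun x => l x * k x).
Proof.
move=> [[M0 hM0] fl] [[N0 hN0] gk].
pose M := `|M0| + 1; pose N := `|N0| + 1.
have M1 : 0 < M by rewrite /M; have := normr_ge0 M0; lra.
have N1 : 0 < N by rewrite /N; have := normr_ge0 N0; lra.
have hM x : D x -> nc (l x) <= M.
  by move=> /hM0 h; apply: le_trans h _; rewrite /M; have := ler_norm M0; lra.
have hN x : D x -> nc (k x) <= N.
  by move=> /hN0 h; apply: le_trans h _; rewrite /N; have := ler_norm N0; lra.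
split.
  by exists (M * N) => x Dx; rewrite ncM ler_pM ?nc_ge0//; auto.
move=> e e0.
(* Chosen so that d d + d N + M d < e. *)
pose d := Num.min 1 (e / (2 * (M + N + 1))).
have d0 : 0 < d by rewrite lt_min ltr01 /= divr_gt0// mulr_gt0//; lra.
have d1 : d <= 1 by rewrite ge_min lexx.
have de : d * (M + N + 1) <= e / 2.
  have : d <= e / (2 * (M + N + 1)) by rewrite ge_min lexx orbT.
  rewrite ler_pdivlMr; lra.
near=> t => x Dx.
have h1 : nc (f t x - l x) < d by move: x Dx; near: t; exact: fl.
have h2 : nc (g t x - k x) < d by move: x Dx {h1}; near: t; exact: gk.
have -> : f t x * g t x - l x * k x = (f t x - l x) * (g t x - k x) +
  ((f t x - l x) * k x + l x * (g t x - k x)) by ring.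
apply: le_lt_trans (ncD _ _) _; apply: le_lt_trans (_ : _ <= d * d + (d * N + M * d)) _.
  apply: lerD; first by rewrite ncM ler_pM ?nc_ge0// ltW.
  apply: le_trans (ncD _ _) _; apply: lerD; rewrite ncM ler_pM ?nc_ge0 ?hM ?hN//.
  - exact: ltW.
  - exact: ltW.
have : d * d <= d by rewrite ler_piMr// ltW.
nra.
Unshelve. all: by end_near. Qed.

Lemma ulimN f l : ulim f l -> ulim (fun t x => - f t x) (fun x => - l x).
Proof.
move=> h; have c1 : exists M : R, forall x : Z, D x -> nc (-1 : R[i]) <= M.
  by exists 1 => x _; rewrite ncN nc1.
have := ulimM (ulim_cst c1) h; congr ulim.
  by apply/funext => t; apply/funext => x; rewrite mulN1r.
by apply/funext => x; rewrite mulN1r.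
Qed.

Lemma ulim_sum (I : Type) (r : seq I) (f : I -> T -> Z -> R[i])
    (l : I -> Z -> R[i]) :
  (forall i, ulim (f i) (l i)) ->
  ulim (fun t x => \sum_(i <- r) f i t x) (fun x => \sum_(i <- r) l i x).
Proof.
move=> h; elim: r => [|i r IH].
  have := ulim_cst1 0; congr ulim.
  - by apply/funext => t; apply/funext => x; rewrite big_nil.
  - by apply/funext => x; rewrite big_nil.
have := ulimD (h i) IH; congr ulim.
- by apply/funext => t; apply/funext => x; rewrite big_cons.
- by apply/funext => x; rewrite big_cons.
Qed.

Lemma ulim_prod (I : Type) (r : seq I) (f : I -> T -> Z -> R[i])
    (l : I -> Z -> R[i]) :
  (forall i, ulim (f i) (l i)) ->
  ulim (fun t x => \prod_(i <- r) f i t x) (fun x => \prod_(i <- r) l i x).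
Proof.
move=> h; elim: r => [|i r IH].
  have := ulim_cst1 1; congr ulim.
  - by apply/funext => t; apply/funext => x; rewrite big_nil.
  - by apply/funext => x; rewrite big_nil.
have := ulimM (h i) IH; congr ulim.
- by apply/funext => t; apply/funext => x; rewrite big_cons.
- by apply/funext => x; rewrite big_cons.
Qed.

Definition ulim_mx p q (f : T -> Z -> 'M[R[i]]_(p, q)) (l : Z -> 'M[R[i]]_(p, q)) :=
  forall i j, ulim (fun t x => f t x i j) (fun x => l x i j).

Lemma ulim_mx_cst p q (M : 'M[R[i]]_(p, q)) : ulim_mx (fun _ _ => M) (fun _ => M).
Proof. by move=> i j; exact: ulim_cst1. Qed.

Lemma ulim_mulmx p q r (f : T -> Z -> 'M[R[i]]_(p, q))
    (l : Z -> 'M[R[i]]_(p, q)) (g : T -> Z -> 'M[R[i]]_(q, r)) (k : Z -> 'M[R[i]]_(q, r)) :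
  ulim_mx f l -> ulim_mx g k ->
  ulim_mx (fun t x => f t x *m g t x) (fun x => l x *m k x).
Proof.
move=> hf hg i j.
have := ulim_sum (index_enum 'I_q) (fun a => ulimM (hf i a) (hg a j)).
congr ulim.
- by apply/funext => t; apply/funext => x; rewrite !mxE.
- by apply/funext => x; rewrite !mxE.
Qed.

Lemma ulim_addmx p q (f g : T -> Z -> 'M[R[i]]_(p, q))
    (l k : Z -> 'M[R[i]]_(p, q)) :
  ulim_mx f l -> ulim_mx g k ->
  ulim_mx (fun t x => f t x + g t x) (fun x => l x + k x).
Proof.
move=> hf hg i j; have := ulimD (hf i j) (hg i j); congr ulim.
- by apply/funext => t; apply/funext => x; rewrite !mxE.
- by apply/funext => x; rewrite !mxE.
Qed.

Lemma ulim_oppmx p q (f : T -> Z -> 'M[R[i]]_(p, q))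
    (l : Z -> 'M[R[i]]_(p, q)) :
  ulim_mx f l -> ulim_mx (fun t x => - f t x) (fun x => - l x).
Proof.
move=> hf i j; have := ulimN (hf i j); congr ulim.
- by apply/funext => t; apply/funext => x; rewrite !mxE.
- by apply/funext => x; rewrite !mxE.
Qed.

Lemma ulim_scalemx p q f l (g : T -> Z -> 'M[R[i]]_(p, q))
    (k : Z -> 'M[R[i]]_(p, q)) :
  ulim f l -> ulim_mx g k ->
  ulim_mx (fun t x => f t x *: g t x) (fun x => l x *: k x).
Proof.
move=> hf hg i j; have := ulimM hf (hg i j); congr ulim.
- by apply/funext => t; apply/funext => x; rewrite !mxE.
- by apply/funext => x; rewrite !mxE.
Qed.

Lemma ulim_summx p q (I : Type) (r : seq I) (f : I -> T -> Z -> 'M[R[i]]_(p, q))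
    (l : I -> Z -> 'M[R[i]]_(p, q)) :
  (forall i, ulim_mx (f i) (l i)) ->
  ulim_mx (fun t x => \sum_(i <- r) f i t x) (fun x => \sum_(i <- r) l i x).
Proof.
move=> h i j; have := ulim_sum r (fun a => h a i j); congr ulim.
- by apply/funext => t; apply/funext => x; rewrite summxE.
- by apply/funext => x; rewrite summxE.
Qed.

Lemma ulim_det n (f : T -> Z -> 'M[R[i]]_n) (l : Z -> 'M[R[i]]_n) : ulim_mx f l ->
  ulim (fun t x => \det (f t x)) (fun x => \det (l x)).
Proof.
move=> h; rewrite /determinant; apply: ulim_sum => s.
by apply: ulimM (ulim_cst1 _) _; apply: ulim_prod => i; exact: h.
Qed.

Lemma ulim_adj n (f : T -> Z -> 'M[R[i]]_n) (l : Z -> 'M[R[i]]_n) : ulim_mx f l ->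
  ulim_mx (fun t x => \adj (f t x)) (fun x => \adj (l x)).
Proof.
move=> h i j.
have hd : ulim (fun t x => \det (row' j (col' i (f t x))))
               (fun x => \det (row' j (col' i (l x)))).
  apply: ulim_det => a b; have := h (lift j a) (lift i b); congr ulim.
  - by apply/funext => t; apply/funext => x; rewrite !mxE.
  - by apply/funext => x; rewrite !mxE.
have := ulimM (ulim_cst1 ((-1) ^+ (j + i))) hd; congr ulim.
- by apply/funext => t; apply/funext => x; rewrite !mxE.
- by apply/funext => x; rewrite !mxE.
Qed.

(** exp (z + h) - exp z = exp z (exp h - 1), and the last factor is a Taylor
    remainder of order 1. *)
Lemma nc_cexpB (z h : R[i]) : nc h <= 1 ->
  nc (cexp (z + h) - cexp z) <= expR (nc z) * (2 * expR 1) * nc h.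
Proof.
move=> h1.
have H := cexp_taylor 1 h.
rewrite /exp_trunc big_ord1 expr0 divr1 expr1 divr1 in H.
have -> : cexp (z + h) - cexp z = cexp z * (cexp h - 1) by rewrite cexpD; ring.
rewrite ncM -mulrA ler_pM ?nc_ge0//.
  by rewrite nc_cexp ler_expR (le_trans (ler_norm _) (ncRe _)).
apply: le_trans H _.
rewrite [leRHS](_ : _ = expR 1 * (2 * nc h)); last by ring.
by rewrite ler_wpM2r ?mulr_ge0 ?nc_ge0// ler_expR.
Qed.

Lemma ulim_cexp f l : ulim f l -> ulim (fun t x => cexp (f t x)) (fun x => cexp (l x)).
Proof.
move=> [[M hM] fl]; split.
  exists (expR M) => x Dx; rewrite nc_cexp ler_expR.
  by rewrite (le_trans (ler_norm _) (le_trans (ncRe _) (hM _ Dx))).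
move=> e e0; pose K := expR M * (2 * expR 1).
have K0 : 0 < K by rewrite !mulr_gt0 ?expR_gt0.
have d0 : 0 < Num.min 1 (e / K) by rewrite lt_min ltr01 divr_gt0.
near=> t => x Dx.
have : nc (f t x - l x) < Num.min 1 (e / K) by move: x Dx; near: t; exact: fl.
rewrite lt_min => /andP[h1 h2].
have -> : f t x = l x + (f t x - l x) by ring.
set h := f t x - l x in h1 h2 *.
apply: le_lt_trans (nc_cexpB _ (ltW h1)) _.
apply: le_lt_trans (_ : _ <= K * nc h) _.
  rewrite ler_wpM2r ?nc_ge0// ler_wpM2r ?mulr_ge0 ?expR_ge0// ler_expR.
  exact: hM.
by rewrite mulrC -ltr_pdivlMr.
Unshelve. all: by end_near. Qed.

End Uniform_limits.

(** * Minimum modulus principle for polynomials *)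

Section Minima.
Variable R : realType.

Lemma ulim_coord k (v : 'rV[R]_k) (i : 'I_k) :
  ulim (nbhs v) [set: unit] (fun w _ => (w 0 i)%:C) (fun _ => (v 0 i)%:C).
Proof.
split; first by exists (nc (v 0 i)%:C).
move=> e e0; have /cvgrPdist_lt/(_ e e0) := @coord_continuous R 1 k 0 i v.
apply: (@filterS _ (nbhs v) (nbhs_filter v)) => w h x _.
by rewrite -rmorphB nc_real distrC.
Qed.

(** The extreme value theorem for parameters in a box. Tori, circles and discs
    are treated as images of boxes of moduli and angles. *)
Lemma box_min k (a b : 'I_k -> R) (f : 'rV[R]_k -> R[i]) :
  (forall i, a i <= b i) ->
  (forall v, ulim (nbhs v) [set: unit] (fun w _ => f w) (fun _ => f v)) ->
  exists c : 'rV[R]_k, (forall i, a i <= c 0 i <= b i) /\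
    forall v : 'rV[R]_k, (forall i, a i <= v 0 i <= b i) -> nc (f c) <= nc (f v).
Proof.
move=> ab fc.
pose A := [set v : 'rV[R]_k | forall i, `[a i, b i]%classic (v 0 i)].
have cA : compact A.
  apply: (@rV_compact R k (fun i => `[a i, b i]%classic)) => i.
  exact: segment_compact.
have A0 : A !=set0.
  by exists (\row_i a i) => i /=; rewrite mxE in_itv /= lexx ab.
have cf : {within A, continuous (fun v => nc (f v))}.
  apply: continuous_subspaceT => v.
  suff h : (fun v => nc (f v)) @ nbhs v --> nc (f v) by exact: h.
  apply/(@cvgrPdist_lt _ _ _ _ (nbhs_filter v)) => e e0.
  have [_ /(_ e e0)] := fc v; apply: (@filterS _ (nbhs v) (nbhs_filter v)) => w /(_ tt I) h.
  by rewrite distrC (le_lt_trans _ h)// nc_dist.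
have [c cA' hc] := compact_EVT_min A0 cA cf.
exists c; split.
  by move: cA'; rewrite inE => h i; have := h i; rewrite /= in_itv.
by move=> v hv; apply: hc; rewrite inE => i /=; rewrite in_itv /= hv.
Qed.

Lemma polar (z : R[i]) : exists2 phi : R, - pi <= phi <= pi &
  z = (nc z)%:C * cexp (0 +i* phi).
Proof.
have [->|z0] := eqVneq z 0.
  by exists 0; rewrite ?nc0 ?mul0r// oppr_le0 pi_ge0.
pose u := z * ((nc z)^-1)%:C.
have n0 : nc z != 0 by rewrite nc_eq0.
have zu : z = (nc z)%:C * u by rewrite /u mulrCA -rmorphM mulfV// mulr1.
have u1 : nc u = 1 by rewrite ncM nc_real ger0_norm ?invr_ge0 ?nc_ge0// mulfV.
clearbody u.
set a := complex.Re u; set b := complex.Im u.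
have ab : a ^+ 2 + b ^+ 2 = 1.
  have := congr1 (fun x => x ^+ 2) u1; rewrite expr1n ncE sqr_sqrtr//.
  by rewrite addr_ge0 ?sqr_ge0.
have b2 : b ^+ 2 = 1 - a ^+ 2 by rewrite -ab; ring.
have a1 : -1 <= a <= 1.
  by have := ncRe u; rewrite u1 ler_norml.
have ac := acosK a1.
have [b0|b0] := lerP 0 b.
  exists (acos a).
    rewrite acos_lepi// andbT (le_trans _ (acos_ge0 _))// oppr_le0 pi_ge0//.
  rewrite {1}zu; congr (_ * _); apply: complex_eqP.
    by rewrite Re_cexp /= expR0 mul1r ac.
  by rewrite Im_cexp /= expR0 mul1r sin_acos// -b2 sqrtr_sqr ger0_norm.
exists (- acos a).
  by rewrite lerN2 acos_lepi//= (le_trans _ (pi_ge0 _))// oppr_le0 acos_ge0.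
rewrite {1}zu; congr (_ * _); apply: complex_eqP.
  by rewrite Re_cexp /= expR0 mul1r cosN ac.
by rewrite Im_cexp /= expR0 mul1r sinN sin_acos// -b2 sqrtr_sqr ltr0_norm// opprK.
Qed.

Lemma nc_cis (phi : R) : nc (cexp (0 +i* phi)) = 1.
Proof. by rewrite nc_cexp expR0. Qed.

Lemma ulim_cis k (v : 'rV[R]_k) (i : 'I_k) :
  ulim (nbhs v) [set: unit] (fun w _ => cexp (0 +i* w 0 i)) (fun _ => cexp (0 +i* v 0 i)).
Proof.
have h : ulim (nbhs v) [set: unit] (fun w _ => (0 +i* 1) * (w 0 i)%:C)
   (fun _ => (0 +i* 1) * (v 0 i)%:C).
  by apply: ulimM; [exact: ulim_cst1|exact: ulim_coord].
have := ulim_cexp (FF := nbhs_filter v) h; congr (ulim _ _ _ _).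
  apply/funext => t; apply/funext => x; congr cexp.
  by apply: complex_eqP; rewrite ?cReMr ?cImMr /= ?mul0r ?mul1r.
apply/funext => x; congr cexp.
by apply: complex_eqP; rewrite ?cReMr ?cImMr /= ?mul0r ?mul1r.
Qed.

(** Continuity, tested on functions of real parameters because the extreme
    value theorem is applied to such parametrizations. *)
Definition ccont (f : R[i] -> R[i]) := forall (k : nat) (v : 'rV[R]_k) g,
  ulim (nbhs v) [set: unit] (fun w _ => g w) (fun _ => g v) ->
  ulim (nbhs v) [set: unit] (fun w _ => f (g w)) (fun _ => f (g v)).

Lemma disc_min (f : R[i] -> R[i]) (r : R) : ccont f -> 0 <= r ->
  exists2 c, nc c <= r & forall w, nc w <= r -> nc (f c) <= nc (f w).
Proof.
move=> cf r0.
pose g (v : 'rV[R]_2) : R[i] := (v 0 0)%:C * cexp (0 +i* v 0 1).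
pose a (i : 'I_2) : R := if i == 0 then 0 else - pi.
pose b (i : 'I_2) : R := if i == 0 then r else pi.
have ab i : a i <= b i.
  by rewrite /a /b; case: eqP => // _; have := pi_ge0 R; lra.
have [v|c [hc cmin]] := @box_min 2 a b (fun v => f (g v)) ab.
  by apply: cf; apply: ulimM; [exact: ulim_coord|exact: ulim_cis].
exists (g c).
  rewrite ncM nc_cis mulr1 nc_real.
  by have := hc 0; rewrite /a /b /= => /andP[h1 h2]; rewrite ger0_norm.
move=> w hw; have [phi hphi we] := polar w.
have -> : w = g (\row_i (if i == 0 then nc w else phi)) by rewrite /g !mxE.
apply: cmin => i; rewrite mxE /a /b; case: eqP => // _.
by rewrite nc_ge0 hw.
Qed.

Lemma circle_min (f : R[i] -> R[i]) (r : R) : ccont f -> 0 <= r ->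
  exists2 c, nc c = r & forall w, nc w = r -> nc (f c) <= nc (f w).
Proof.
move=> cf r0.
pose g (v : 'rV[R]_1) : R[i] := r%:C * cexp (0 +i* v 0 0).
have ab (i : 'I_1) : - pi <= (pi : R) by have := pi_ge0 R; lra.
have [v|c [hc cmin]] := @box_min 1 _ _ (fun v => f (g v)) ab.
  by apply: cf; apply: ulimM; [exact: ulim_cst1|exact: ulim_cis].
exists (g c); first by rewrite ncM nc_cis mulr1 nc_real ger0_norm.
move=> w hw; have [phi hphi we] := polar w.
have -> : w = g (\row_i phi) by rewrite /g !mxE -hw.
by apply: cmin => i; rewrite mxE.
Qed.

Lemma ccont_poly (P : {poly R[i]}) : ccont (horner P).
Proof.
move=> k v g hg.
have h : ulim (nbhs v) [set: unit] (fun w _ => \sum_(i < size P) P`_i * g w ^+ i)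
    (fun _ => \sum_(i < size P) P`_i * g v ^+ i).
  apply: ulim_sum => i; apply: ulimM; first exact: ulim_cst1.
  have := ulim_prod (FF := nbhs_filter v) (index_enum 'I_i) (fun _ => hg).
  congr (ulim _ _ _ _).
  - by apply/funext => t; apply/funext => x; rewrite prodr_const card_ord.
  - by apply/funext => x; rewrite prodr_const card_ord.
move: h; congr (ulim _ _ _ _).
- by apply/funext => t; apply/funext => x; rewrite horner_coef.
- by apply/funext => x; rewrite horner_coef.
Qed.

(** In the factorization Q = a prod (X - mu_i), if every root were at distance
    at least d from w then |Q(w)| would be at least |a| d^deg(Q). *)
Lemma root_near (Q : {poly R[i]}) (w : R[i]) (d : R) : 0 <= d -> Q != 0 ->
  nc Q.[w] < nc (lead_coef Q) * d ^+ (size Q).-1 ->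
  exists2 mu, root Q mu & nc (w - mu) < d.
Proof.
move=> d0 Q0.
have [s Qs] := closed_field_poly_normal Q.
have a0 : lead_coef Q != 0 by rewrite lead_coef_eq0.
have sz : (size Q).-1 = size s.
  by rewrite Qs size_scale// size_prod_XsubC.
have [/hasP[mu mus hmu] _|] := boolP (has (fun mu => nc (w - mu) < d) s).
  by exists mu => //; rewrite Qs rootZ// root_prod_XsubC.
rewrite -all_predC => /allP h; rewrite sz {1}Qs hornerZ horner_prod ncM nc_prod.
rewrite ltr_pM2l ?nc_gt0// ltNge => /negP[].
elim: s h {Qs sz} => [|mu s IH] h; first by rewrite big_nil expr0.
rewrite big_cons exprS; apply: ler_pM => //.
- exact: exprn_ge0.
- by rewrite hornerXsubC leNgt; apply: h; rewrite mem_head.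
- by apply: IH => x xs; apply: h; rewrite inE xs orbT.
Qed.

(** An interior minimum c of |P| is impossible for nonconstant P: the
    polynomial P - (1 - e) P(c) takes the small value e P(c) at c, hence has a
    root near c by [root_near], and there |P| = (1 - e) |P(c)|. *)
Lemma poly_min_modulus (P : {poly R[i]}) (r : R) : 0 <= r ->
  (forall w, nc w <= r -> P.[w] != 0) ->
  forall w0, nc w0 <= r -> exists2 w, nc w = r & nc P.[w] <= nc P.[w0].
Proof.
move=> r0 Pnz w0 hw0.
have [c cr cmin] := disc_min (ccont_poly P) r0.
have [sP|sP] := leqP (size P) 1.
  exists r%:C; first by rewrite nc_real ger0_norm.
  by rewrite (size1_polyC sP) !hornerC.
have [ce|cne] := eqVneq (nc c) r; first by exists c => //; apply: cmin.
have cl : nc c < r by rewrite lt_neqAle cne.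
exfalso.
have Pc0 : 0 < nc P.[c] by rewrite nc_gt0 Pnz.
have P0 : P != 0 by rewrite -size_poly_gt0 ltnW.
pose B := nc (lead_coef P) * (r - nc c) ^+ (size P).-1.
have B0 : 0 < B by rewrite mulr_gt0 ?exprn_gt0 ?subr_gt0// nc_gt0 lead_coef_eq0.
(* e is so small that the root of Q provided by root_near lies in the disc. *)
pose e := Num.min (1/2) (B / nc P.[c] / 2).
have e0 : 0 < e by rewrite lt_min !divr_gt0.
have e1 : e <= 1/2 by rewrite ge_min lexx.
have eB : e * nc P.[c] < B.
  have : e <= B / nc P.[c] / 2 by rewrite ge_min lexx orbT.
  by rewrite ler_pdivlMr// ler_pdivlMr// => h; have := mulr_gt0 e0 Pc0; move: h; clear; lra.
pose Q := P - (P.[c] * (1 - e)%:C)%:P.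
have sC : (size (- (P.[c] * (1 - e)%:C)%:P : {poly R[i]}) < size P)%N.
  by rewrite size_polyN (leq_ltn_trans (size_polyC_leq1 _)).
have sQ : size Q = size P by rewrite size_polyDl.
have lQ : lead_coef Q = lead_coef P by rewrite lead_coefDl.
have Q0 : Q != 0 by rewrite -size_poly_gt0 sQ ltnW.
have Qc : nc Q.[c] < nc (lead_coef Q) * (r - nc c) ^+ (size Q).-1.
  rewrite sQ lQ -/B /Q hornerD hornerN hornerC.
  rewrite (_ : _ - _ = P.[c] * e%:C); last by rewrite rmorphB /=; ring.
  by rewrite ncM nc_real ger0_norm ?ltW// mulrC.
have rc0 : 0 <= r - nc c by rewrite subr_ge0.
have [mu /rootP hmu dmu] := root_near rc0 Q0 Qc.
have mur : nc mu <= r.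
  by have := ncB c (c - mu); rewrite subKr; move: dmu; clear; lra.
have := cmin _ mur.
have -> : P.[mu] = P.[c] * (1 - e)%:C.
  by apply/eqP; rewrite -subr_eq0; move: hmu; rewrite /Q hornerD hornerN hornerC => ->.
rewrite ncM nc_real ger0_norm; last by move: e1; clear; lra.
by rewrite mulrBr mulr1; have := mulr_gt0 Pc0 e0; clear; lra.
Qed.

End Minima.

(** * Functions that are polynomial in each variable *)

Section Several_variables.
Variables (R : realType) (m : nat).
Implicit Types (z : 'I_m -> R[i]) (f : ('I_m -> R[i]) -> R[i]).

Definition set_coord z (j : 'I_m) (w : R[i]) : 'I_m -> R[i] :=
  fun k => if k == j then w else z k.

Lemma set_coord_id z j : set_coord z j (z j) = z.
Proof. by apply/funext => k; rewrite /set_coord; case: eqP => [->|]. Qed.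

Definition separately_poly f : Prop :=
  forall z j, exists P : {poly R[i]}, forall w, f (set_coord z j w) = P.[w].

(** Move the coordinates to their circles one after the other, applying the
    one-variable principle each time. *)
Lemma polydisc_min_modulus f (rho : 'I_m -> R) (c : R) :
  separately_poly f -> (forall k, 0 <= rho k) ->
  (forall z, (forall k, nc (z k) <= rho k) -> f z != 0) ->
  (forall z, (forall k, nc (z k) = rho k) -> c <= nc (f z)) ->
  forall z, (forall k, nc (z k) <= rho k) -> c <= nc (f z).
Proof.
move=> sf rho0 fnz fc z hz.
suff [z' [_ h1 h2]] : exists z', [/\ forall k, nc (z' k) <= rho k,
    forall k, k \in enum 'I_m -> nc (z' k) = rho k & nc (f z') <= nc (f z)].
  by apply: le_trans h2; apply: fc => k; apply: h1; rewrite mem_enum.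
elim: (enum 'I_m) => [|j s [z' [h1 h2 h3]]]; first by exists z.
have [P hP] := sf z' j.
have Pnz w : nc w <= rho j -> P.[w] != 0.
  move=> hw; rewrite -hP; apply: fnz => k; rewrite /set_coord.
  by case: eqP => [->|].
have [w hw Pw] := poly_min_modulus (rho0 j) Pnz (h1 j).
exists (set_coord z' j w); split.
- by move=> k; rewrite /set_coord; case: eqP => [->|]; rewrite ?hw.
- by move=> k; rewrite /set_coord inE; case: eqP => [-> _|_ /h2].
- by apply: le_trans h3; rewrite hP (le_trans Pw)// -hP set_coord_id.
Qed.

(** Free the coordinates one after the other: a polynomial that vanishes on an
    infinite set is zero. *)
Lemma vanish_on_product f (S : 'I_m -> set R[i]) :
  separately_poly f ->
  (forall k (P : {poly R[i]}), (forall w, S k w -> P.[w] = 0) -> P = 0) ->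
  (forall z, (forall k, S k (z k)) -> f z = 0) ->
  forall z, f z = 0.
Proof.
move=> sf Sinf f0 z.
have : forall k, k \notin enum 'I_m -> S k (z k) by move=> k; rewrite mem_enum.
elim: (enum 'I_m) z => [|j s IH] z hz; first by apply: f0 => k; apply: hz.
have [P hP] := sf z j.
rewrite -(set_coord_id z j) hP (Sinf j P) ?horner0// => w Sw.
rewrite -hP; apply: IH => k ks; rewrite /set_coord; case: eqP => [->//|/eqP kj].
by apply: hz; rewrite inE negb_or kj.
Qed.

End Several_variables.

Section Closure.
Variables (R : realType) (Z : Type) (P : (Z -> R[i]) -> R[i] -> Prop).
Hypothesis Pcst : forall c, P (fun _ => c) c.
Hypothesis Padd : forall f g a b, P f a -> P g b -> P (fun x => f x + g x) (a + b).
Hypothesis Pmul : forall f g a b, P f a -> P g b -> P (fun x => f x * g x) (a * b).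

Lemma closed_sum (I : Type) (r : seq I) (f : I -> Z -> R[i]) (a : I -> R[i]) :
  (forall i, P (f i) (a i)) -> P (fun x => \sum_(i <- r) f i x) (\sum_(i <- r) a i).
Proof.
move=> h; elim: r => [|i r IH].
  rewrite big_nil; have := Pcst 0; congr P.
  by apply/funext => x; rewrite big_nil.
rewrite big_cons; have := Padd (h i) IH; congr P.
by apply/funext => x; rewrite big_cons.
Qed.

Lemma closed_prod (I : Type) (r : seq I) (f : I -> Z -> R[i]) (a : I -> R[i]) :
  (forall i, P (f i) (a i)) -> P (fun x => \prod_(i <- r) f i x) (\prod_(i <- r) a i).
Proof.
move=> h; elim: r => [|i r IH].
  rewrite big_nil; have := Pcst 1; congr P.
  by apply/funext => x; rewrite big_nil.
rewrite big_cons; have := Pmul (h i) IH; congr P.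
by apply/funext => x; rewrite big_cons.
Qed.

(** P f a is thought of as: f belongs to some ring of functions, and a is the
    value of f under a ring morphism. *)
Lemma closed_det n (M : Z -> 'M[R[i]]_n) (M0 : 'M[R[i]]_n) :
  (forall i j, P (fun x => M x i j) (M0 i j)) -> P (fun x => \det (M x)) (\det M0).
Proof.
move=> h; rewrite /determinant; apply: closed_sum => s.
by apply: Pmul (Pcst _) _; apply: closed_prod => i; exact: h.
Qed.

End Closure.

(** * Zeros of uniform limits of polynomials *)

Section Polynomial_approximation.
Variables (R : realType) (r : R).
Hypothesis r0 : 0 <= r.
Implicit Types (h : R[i] -> R[i]).

(** A substitute for holomorphy on the disc of radius r: it holds for
    exponentials, is stable under ring operations, and lets the minimum
    modulus principle pass from polynomials to their limits. *)
Definition poly_approx h : Prop := exists P : nat -> {poly R[i]},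
  ulim \oo [set x | nc x <= r] (fun N x => (P N).[x]) h.

Lemma approx_cst (c : R[i]) : poly_approx (fun _ => c).
Proof.
exists (fun _ => c%:P); have := ulim_cst1 (FF := eventually_filter) [set x : R[i] | nc x <= r] c.
congr (ulim _ _ _ _).
by apply/funext => N; apply/funext => x; rewrite hornerC.
Qed.

Lemma approx_id : poly_approx id.
Proof.
exists (fun _ => 'X).
have h : exists M : R, forall x : R[i], [set x | nc x <= r] x -> nc x <= M.
  by exists r.
have := ulim_cst (FF := eventually_filter) h; congr (ulim _ _ _ _).
by apply/funext => N; apply/funext => x; rewrite hornerX.
Qed.

Lemma approxD f g : poly_approx f -> poly_approx g -> poly_approx (fun x => f x + g x).
Proof.
move=> [P hP] [Q hQ]; exists (fun N => P N + Q N).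
have := ulimD (FF := eventually_filter) hP hQ; congr (ulim _ _ _ _).
by apply/funext => N; apply/funext => x; rewrite hornerD.
Qed.

Lemma approxM f g : poly_approx f -> poly_approx g -> poly_approx (fun x => f x * g x).
Proof.
move=> [P hP] [Q hQ]; exists (fun N => P N * Q N).
have := ulimM (FF := eventually_filter) hP hQ; congr (ulim _ _ _ _).
by apply/funext => N; apply/funext => x; rewrite hornerM.
Qed.

Lemma approx_cexp (a : R[i]) : poly_approx (fun x => cexp (a * x)).
Proof.
exists (fun N => \sum_(j < N) (a ^+ j / j`!%:R) *: 'X^j).
have hN N x : (\sum_(j < N) (a ^+ j / j`!%:R) *: 'X^j).[x] = exp_trunc N (a * x).
  rewrite horner_sum /exp_trunc; apply: eq_bigr => j _.
  by rewrite hornerZ hornerXn exprMn mulrAC.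
pose b := nc a * r.
have b0 : 0 <= b by rewrite mulr_ge0 ?nc_ge0.
split.
  exists (expR b) => x hx; rewrite nc_cexp ler_expR.
  apply: le_trans (ler_norm _) _; apply: le_trans (ncRe _) _.
  by rewrite ncM ler_wpM2l ?nc_ge0.
(* The remainder of order k is at most K / 2^k, since (4 b)^k / k! <= exp
   (4 b). *)
move=> e e0; pose K := expR b * expR (4 * b).
have K0 : 0 < K by rewrite mulr_gt0 ?expR_gt0.
have [N0 hN0] : exists N0 : nat, forall N, (N0 <= N)%N -> K / 2 ^+ N < e.
  exists (Num.truncn (K / e)).+1 => N hNN.
  have h1 : K / e < N%:R.
    by apply: lt_le_trans (truncnS_gt _) _; rewrite ler_nat.
  have h2 : (N%:R : R) <= 2 ^+ N.
    by rewrite -natrX ler_nat ltnW// ltn_expl.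
  rewrite ltr_pdivrMr ?exprn_gt0//.
  rewrite ltr_pdivrMr// in h1.
  by apply: lt_le_trans h1 _; rewrite mulrC ler_pM2l.
exists N0.+1 => // N /= hNN x hx; rewrite hN nc_subC.
have N0N : (N0 <= N)%N by apply: ltnW.
apply: le_lt_trans (cexp_taylor _ _) _; apply: le_lt_trans (hN0 N N0N).
rewrite /K -mulrA; apply: ler_pM; rewrite ?expR_ge0//.
- by rewrite mulr_ge0 ?exprn_ge0 ?mulr_ge0 ?nc_ge0// invr_ge0.
- by rewrite ler_expR ncM ler_wpM2l ?nc_ge0.
rewrite ler_pdivlMr ?exprn_gt0//.
case: N hNN {N0N} => // N _.
apply: le_trans (_ : (4 * b) ^+ N.+1 / N.+1`!%:R <= _).
  rewrite mulrAC -exprMn ler_wpM2r ?invr_ge0//.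
  rewrite lerXn2r ?nnegrE ?mulr_ge0 ?nc_ge0//.
  have : nc (a * x) <= b by rewrite ncM ler_wpM2l ?nc_ge0.
  lra.
have b40 : 0 <= 4 * b by rewrite mulr_ge0.
by have := @expR_ge1Dxn R (4 * b) N b40; lra.
Qed.

Lemma approx_det n (M : R[i] -> 'M[R[i]]_n) :
  (forall i j, poly_approx (fun x => M x i j)) -> poly_approx (fun x => \det (M x)).
Proof.
move=> h; apply: (closed_det (P := fun f _ => poly_approx f) _ _ _ (M0 := 0)).
- exact: approx_cst.
- by move=> f g _ _; exact: approxD.
- by move=> f g _ _; exact: approxM.
- exact: h.
Qed.

(** Polynomial approximations are small at 0 compared with the circle, so by
    the minimum modulus principle they have a zero in the disc. Hence the
    minimum of |h| over the disc is 0. *)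
Lemma approx_zero h (c : R) : ccont h -> poly_approx h ->
  (forall w, nc w = r -> c <= nc (h w)) -> nc (h 0) < c ->
  exists2 x, nc x <= r & h x = 0.
Proof.
move=> ch [P [_ hP]] hc h0.
have [x0 x0r x0min] := disc_min ch r0.
have [|hx0] := eqVneq (h x0) 0; first by exists x0.
have mu0 : 0 < nc (h x0) by rewrite nc_gt0.
exfalso.
(* Closer than the minimum, an approximation has no zero in the disc;
   closer than half the gap between 0 and the circle, it must have one. *)
pose e := Num.min (nc (h x0)) ((c - nc (h 0)) / 2).
have e0 : 0 < e by rewrite lt_min mu0 divr_gt0// subr_gt0.
have [N _ /(_ N (leqnn N)) /= hN] := hP e e0.
have e1 : e <= nc (h x0) by rewrite ge_min lexx.
have e2 : e <= (c - nc (h 0)) / 2 by rewrite ge_min lexx orbT.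
have Pnz w : nc w <= r -> (P N).[w] != 0.
  move=> hw; apply/eqP => Pw; have := hN w hw.
  rewrite Pw sub0r ncN; have := x0min w hw; move: e1; clear; lra.
have n00 : nc (0 : R[i]) <= r by rewrite nc0.
have [w hw Pw] := poly_min_modulus r0 Pnz n00.
have hwr : nc w <= r by rewrite hw.
have h1 := hN w hwr; have h2 := hN 0 n00; have h3 := hc w hw.
have h4 := ncD (h w - (P N).[w]) (P N).[w]; rewrite subrK nc_subC in h4.
have h5 := ncD ((P N).[0] - h 0) (h 0); rewrite subrK in h5.
move: h1 h2 h3 h4 h5 e2 Pw; clear; lra.
Qed.

(** Hurwitz: a zero of g inside a circle on which |g| >= c persists in every
    function closer to g than c / 2. *)
Lemma approx_zero_near h g (c : R) : ccont h -> poly_approx h ->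
  (forall w, nc w = r -> c <= nc (g w)) -> g 0 = 0 ->
  (forall x, nc x <= r -> nc (h x - g x) < c / 2) ->
  exists2 x, nc x <= r & h x = 0.
Proof.
move=> ch ah hc g0 hg; apply: (approx_zero (c := c / 2)) => //.
  move=> w hw; have hw' : nc w <= r by rewrite hw.
  have := hg w hw'; have := hc w hw; have := ncD (g w - h w) (h w).
  by rewrite subrK nc_subC; clear; lra.
have n0 : nc (0 : R[i]) <= r by rewrite nc0.
by have := hg 0 n0; rewrite g0 subr0.
Qed.

End Polynomial_approximation.

(** * Zeros of exponential sums *)

Section Exponential_sums.
Variable R : realType.
Implicit Types (s : seq (R[i] * R)).

Definition expsum s (x : R[i]) : R[i] := \sum_(p <- s) p.1 * cexp (- (p.2%:C * x)).

(** The value of the sum at Re x = +oo when the exponents p.2 are nonnegative. *)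
Definition expsum_const s : R[i] := \sum_(p <- s | p.2 == 0) p.1.

(** The moments are the Taylor coefficients at 0, up to factorials. If the
    first k vanish, then at a zero x of the sum the k-th term of the expansion
    is of order |x|^(k+1). *)
Lemma expsum_moments s :
  (forall e : R, 0 < e -> exists x, [/\ 0 < nc x, nc x < e & expsum s x = 0]) ->
  forall k, \sum_(p <- s) p.1 * (- p.2%:C) ^+ k = 0.
Proof.
move=> hz k; elim/ltn_ind: k => k IH.
set S := \sum_(p <- s) _.
pose K : R := \sum_(p <- s) nc p.1 * (expR `|p.2| * (2 * `|p.2|) ^+ k.+1).
have K0 : 0 <= K.
  apply: sumr_ge0 => p _.
  by rewrite !mulr_ge0 ?nc_ge0 ?expR_ge0// exprn_ge0// mulr_ge0.
have main x : 0 < nc x -> nc x < 1 -> expsum s x = 0 -> nc S <= k`!%:R * K * nc x.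
  move=> x0 x1 ex.
  (* Only the k-th moment contributes to the truncated expansion. *)
  have e1 : \sum_(p <- s) p.1 * exp_trunc k.+1 (- (p.2%:C * x)) = S * (x ^+ k / k`!%:R).
    rewrite /exp_trunc; under eq_bigr do rewrite mulr_sumr.
    rewrite exchange_big /= big_ord_recr /= big1 ?add0r.
      rewrite mulr_suml; apply: eq_bigr => p _.
      by rewrite -mulNr exprMn !mulrA.
    move=> j _; transitivity ((\sum_(p <- s) p.1 * (- p.2%:C) ^+ j) * (x ^+ j / j`!%:R)).
      rewrite mulr_suml; apply: eq_bigr => p _.
      by rewrite -mulNr exprMn !mulrA.
    by rewrite IH ?mul0r.
  have e2 : nc (S * (x ^+ k / k`!%:R)) <= K * nc x ^+ k.+1.
    have -> : S * (x ^+ k / k`!%:R) =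
        \sum_(p <- s) p.1 * exp_trunc k.+1 (- (p.2%:C * x)) - expsum s x.
      by rewrite e1 ex subr0.
    rewrite nc_subC /expsum -sumrB.
    apply: le_trans (nc_sum _ _ _) _; rewrite /K mulr_suml; apply: ler_sum => p _.
    rewrite -mulrBr ncM -mulrA ler_wpM2l ?nc_ge0//.
    apply: le_trans (cexp_taylor _ _) _.
    have np : nc (- (p.2%:C * x)) = `|p.2| * nc x by rewrite ncN ncM nc_real.
    rewrite np -mulrA; apply: ler_pM; rewrite ?expR_ge0//.
    - by rewrite mulr_ge0 ?invr_ge0// exprn_ge0// !mulr_ge0// nc_ge0.
    - by rewrite ler_expR ler_piMr// ltW.
    rewrite mulrA exprMn ler_pdivrMr ?ltr0n ?fact_gt0//.
    by rewrite ler_peMr ?mulr_ge0 ?exprn_ge0 ?mulr_ge0 ?nc_ge0// ler1n fact_gt0.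
  have f0 : 0 < (k`!%:R : R) by rewrite ltr0n fact_gt0.
  have xk : 0 < nc x ^+ k by rewrite exprn_gt0.
  move: e2; rewrite ncM ncM ncV ncX natCE nc_real ger0_norm ?ler0n// exprSr !mulrA.
  rewrite ler_pdivrMr// => h.
  rewrite -(ler_pM2r xk); apply: le_trans h _.
  by rewrite le_eqVlt; apply/orP; left; apply/eqP; ring.
apply/eqP; rewrite -nc_eq0; apply/eqP/le_anti; rewrite nc_ge0 andbT.
apply/ler_addgt0Pl => e e0; rewrite addr0.
pose d := Num.min 1 (e / (k`!%:R * K + 1)).
have fK : 0 < k`!%:R * K + 1 by rewrite ltr_wpDl ?mulr_ge0.
have d0 : 0 < d by rewrite lt_min ltr01 divr_gt0.
have [x [x0 xd ex]] := hz d d0.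
have x1 : nc x < 1 by apply: lt_le_trans xd _; rewrite ge_min lexx.
have xe : nc x < e / (k`!%:R * K + 1) by apply: lt_le_trans xd _; rewrite ge_min lexx orbT.
apply: le_trans (main x x0 x1 ex) _.
rewrite ltr_pdivlMr// in xe; apply: le_trans (ltW xe).
by rewrite mulrC ler_wpM2l ?nc_ge0// lerDl.
Qed.

(** All Taylor coefficients at 0 vanish, so the coefficients are orthogonal to
    every polynomial in the exponents. A polynomial that vanishes at the
    nonzero exponents only isolates the terms with exponent 0. *)
Lemma expsum_isolated s :
  (forall e : R, 0 < e -> exists x, [/\ 0 < nc x, nc x < e & expsum s x = 0]) ->
  expsum_const s = 0.
Proof.
move=> /expsum_moments hm.
have hq (q : {poly R[i]}) : \sum_(p <- s) p.1 * q.[- p.2%:C] = 0.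
  under eq_bigr do rewrite horner_coef mulr_sumr.
  rewrite exchange_big /= big1// => j _.
  transitivity (q`_j * \sum_(p <- s) p.1 * (- p.2%:C) ^+ j); last by rewrite hm mulr0.
  by rewrite mulr_sumr; apply: eq_bigr => p _; rewrite mulrCA.
pose q : {poly R[i]} := \prod_(p <- s | p.2 != 0) ('X - (- p.2%:C)%:P).
have q0 : q.[0] != 0.
  rewrite horner_prod prodf_seq_neq0; apply/allP => p _ /=; apply/implyP => hp.
  by rewrite hornerXsubC sub0r opprK; apply: contra hp => /eqP[->].
have z1 : \sum_(p <- s | p.2 != 0) p.1 * q.[- p.2%:C] = 0.
  rewrite big_seq_cond big1// => p /andP[ps hp]; apply/eqP.
  rewrite mulf_eq0; apply/orP; right.
  rewrite horner_prod prodf_seq_eq0; apply/hasP; exists p => //=.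
  by rewrite hornerXsubC subrr eqxx andbT.
have z2 : \sum_(p <- s | p.2 == 0) p.1 * q.[- p.2%:C] = q.[0] * expsum_const s.
  rewrite mulr_sumr; apply: eq_bigr => p /eqP ->.
  by rewrite oppr0 mulrC.
have := hq q; rewrite (bigID (fun p => p.2 == 0)) /= z1 z2 addr0 => /eqP.
by rewrite mulf_eq0 (negbTE q0) => /eqP.
Qed.

(** Nonnegativity of the exponents makes the constant coefficient
    multiplicative, hence computable for a determinant. *)
Definition is_expsum (f : R[i] -> R[i]) (a : R[i]) : Prop :=
  exists s, [/\ forall p, p \in s -> 0 <= p.2, f = expsum s & a = expsum_const s].

Lemma is_expsum_mono (b : R[i]) (mu : R) : 0 <= mu ->
  is_expsum (fun x => b * cexp (- (mu%:C * x))) (if mu == 0 then b else 0).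
Proof.
move=> mu0; exists [:: (b, mu)]; split.
- by move=> p; rewrite inE => /eqP ->.
- by apply/funext => x; rewrite /expsum big_seq1.
- by rewrite /expsum_const big_cons big_nil /=; case: eqP => //; rewrite addr0.
Qed.

Lemma is_expsum_cst (b : R[i]) : is_expsum (fun _ => b) b.
Proof.
have := @is_expsum_mono b 0 (lexx _); rewrite eqxx; congr is_expsum.
by apply/funext => x; rewrite mul0r oppr0 cexp0 mulr1.
Qed.

Lemma is_expsumD f g a b : is_expsum f a -> is_expsum g b ->
  is_expsum (fun x => f x + g x) (a + b).
Proof.
move=> [s [hs -> ->]] [t [ht -> ->]]; exists (s ++ t); split.
- by move=> p; rewrite mem_cat => /orP[/hs|/ht].
- by apply/funext => x; rewrite /expsum big_cat.
- by rewrite /expsum_const big_cat.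
Qed.

Lemma is_expsumM f g a b : is_expsum f a -> is_expsum g b ->
  is_expsum (fun x => f x * g x) (a * b).
Proof.
move=> [s [hs -> ->]] [t [ht -> ->]].
exists [seq (p.1 * q.1, p.2 + q.2) | p <- s, q <- t]; split.
- by move=> u /allpairsP[[p q] /= [ps qt ->]] /=; apply: addr_ge0; [exact: hs|exact: ht].
- apply/funext => x; rewrite /expsum big_allpairs_dep /= mulr_suml.
  apply: eq_bigr => p _; rewrite mulr_sumr; apply: eq_bigr => q _ /=.
  by rewrite rmorphD /= mulrDl opprD cexpD mulrACA.
- have cE u : expsum_const u = \sum_(p <- u) (if p.2 == 0 then p.1 else 0).
    by rewrite /expsum_const big_mkcond.
  rewrite !cE big_allpairs_dep /= mulr_suml big_seq [RHS]big_seq.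
  apply: eq_bigr => p ps; rewrite mulr_sumr big_seq [RHS]big_seq.
  apply: eq_bigr => q qt /=; rewrite paddr_eq0; [|exact: hs|exact: ht].
  by case: (p.2 == 0); case: (q.2 == 0); rewrite /= ?mul0r ?mulr0.
Qed.

(** A circle free of zeros is needed as contour for the Hurwitz argument. *)
Lemma is_expsum_circle f a (r : R) : is_expsum f a -> a != 0 -> 0 < r ->
  exists r' : R, [/\ 0 < r', r' <= r & forall x, nc x = r' -> f x != 0].
Proof.
move=> [s [_ -> ->]] a0 r0; apply: contrapT => h.
move/eqP: a0; apply; apply: expsum_isolated => e e0.
apply: contrapT => h'; apply: h; exists (Num.min (e / 2) r).
have m0 : 0 < Num.min (e / 2) r by rewrite lt_min divr_gt0.
split=> //; first by rewrite ge_min lexx orbT.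
move=> x hx; apply/eqP => fx; apply: h'; exists x; rewrite hx; split=> //.
by rewrite gt_min; apply/orP; left; lra.
Qed.

End Exponential_sums.

(** * The scaled characteristic pencil *)

(** The components along P and Q of the hypothesis say that E x = 0 and that
    A0 x has no component outside the range of E. *)
Lemma factored_kernel (F : fieldType) n (E A0 L W P Q : 'M[F]_n) (x : 'cV[F]_n) :
  L \in unitmx -> W \in unitmx -> E = L *m P *m W ->
  P *m P = P -> P *m Q = 0 -> P + Q = 1%:M ->
  P *m (W *m x) = Q *m (invmx L *m (A0 *m x)) ->
  E *m x = 0 /\ exists y, A0 *m x = E *m y.
Proof.
move=> Lu Wu -> PP PQ PQ1 Ax.
have Px : P *m (W *m x) = 0 by rewrite -PP -mulmxA Ax mulmxA PQ mul0mx.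
split; first by rewrite -!mulmxA Px mulmx0.
have LA : P *m (invmx L *m (A0 *m x)) = invmx L *m (A0 *m x).
  by rewrite -[RHS]mul1mx -PQ1 mulmxDl -Ax Px addr0.
exists (invmx W *m (invmx L *m (A0 *m x))).
by rewrite -!mulmxA (mulKVmx Wu) LA mulKVmx.
Qed.

Section Pencil.
Variables (R : realType) (n m : nat) (E : 'M[R[i]]_n) (A : 'I_m.+1 -> 'M[R[i]]_n).
Implicit Types (z : 'I_m -> R[i]).

(** A(z), the combination of the delayed matrices in which z_j stands for the
    exponential of the j-th delay. *)
Definition delay_matrix z : 'M[R[i]]_n := A ord0 + \sum_(j < m) z j *: A (lift ord0 j).

Let L := col_ebase E.
Let W := row_ebase E.
Let P : 'M[R[i]]_n := pid_mx (\rank E).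
Let Q : 'M[R[i]]_n := copid_mx (\rank E).

(** The scaling by sg = 1 / s of the differential equations in the coordinates
    where E is diag(I, 0). *)
Definition balance (sg : R[i]) : 'M[R[i]]_n := sg *: P + Q.

(** With u = sg s this is s E - A(z), up to the changes of basis given by a
    full rank factorization of E and the scaling by [balance] (see [pencilE]).
    It stays meaningful for sg = 0, the limit of infinite frequency. *)
Definition pencil (u sg : R[i]) z : 'M[R[i]]_n :=
  u *: P - balance sg *m invmx L *m delay_matrix z *m invmx W.

Let Lu : L \in unitmx. Proof. exact: col_ebase_unit. Qed.
Let Wu : W \in unitmx. Proof. exact: row_ebase_unit. Qed.
Let ELW : E = L *m P *m W. Proof. by rewrite mulmx_ebase. Qed.
Let PP : P *m P = P. Proof. by rewrite pid_mx_id // rank_leq_row. Qed.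
Let QP : Q *m P = 0. Proof. exact: mul_copid_mx_pid (rank_leq_row E). Qed.
Let PQ : P *m Q = 0. Proof. exact: mul_pid_mx_copid (rank_leq_row E). Qed.
Let PQ1 : P + Q = 1%:M. Proof. by rewrite /Q /copid_mx addrC subrK. Qed.
Let QQ : Q *m Q = Q. Proof.
by have : (P + Q) *m Q = Q by [rewrite PQ1 mul1mx]; rewrite mulmxDl PQ add0r.
Qed.

Lemma pencilE (s sg : R[i]) z :
  pencil (sg * s) sg z = balance sg *m invmx L *m (s *: E - delay_matrix z) *m invmx W.
Proof.
rewrite mulmxBr mulmxBl; congr (_ - _).
rewrite -scalemxAr -scalemxAl ELW !mulmxA mulmxKV// mulmxK//.
by rewrite /balance mulmxDl QP addr0 -scalemxAl PP scalerA mulrC.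
Qed.

Lemma balanceK (sg : R[i]) : sg != 0 -> balance sg^-1 *m balance sg = 1%:M.
Proof.
move=> s0; rewrite /balance mulmxDl [_ *: P *m _]mulmxDr [Q *m (_ *: P + _)]mulmxDr -!scalemxAl -!scalemxAr PP QP PQ QQ.
by rewrite !scaler0 addr0 add0r scalerA mulVf// scale1r.
Qed.

Lemma pencil_singular (s sg : R[i]) z : sg != 0 ->
  \det (pencil (sg * s) sg z) = 0 -> \det (s *: E - delay_matrix z) = 0.
Proof.
move=> s0 /eqP; rewrite pencilE !det_mulmx !det_inv !mulf_eq0 !invr_eq0.
have dn0 (M : 'M[R[i]]_n) : M \in unitmx -> (\det M == 0) = false.
  by rewrite unitmxE unitfE => /negbTE.
have bu : balance sg \in unitmx by have /mulmx1_unit[] := balanceK s0.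
by rewrite (dn0 _ Lu) (dn0 _ Wu) (dn0 _ bu) orbF => /eqP.
Qed.

(** For sg = 0 the pencil keeps E x in its first rows, and, up to sign, the
    class of A(z) x modulo the range of E in its last rows. *)
Lemma pencil_solution z p (x y b : 'M[R[i]]_(n, p)) : E *m x = 0 -> delay_matrix z *m x + b = E *m y ->
  pencil 1 0 z *m (W *m x) = balance 0 *m invmx L *m b.
Proof.
move=> Ex Ay; rewrite mulmxBl !mulmxA scale1r mulmxKV//.
have -> : P *m W *m x = 0.
  by rewrite -[P](mulKmx Lu) -!mulmxA [X in _ *m X]mulmxA [X in _ *m X]mulmxA -ELW Ex mulmx0.
have -> : b = E *m y - delay_matrix z *m x by rewrite -Ay addrAC subrr add0r.
rewrite mulmxBr sub0r !mulmxA ELW !mulmxA mulmxKV//.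
by rewrite /balance scale0r add0r QP !mul0mx sub0r.
Qed.

Lemma pencil_nonsingular_solution z q p (C : 'M[R[i]]_(q, n))
    (x y b : 'M[R[i]]_(n, p)) :
  \det (pencil 1 0 z) != 0 ->
  E *m x = 0 -> delay_matrix z *m x + b = E *m y ->
  C *m x = (\det (pencil 1 0 z))^-1 *:
    (C *m invmx W *m \adj (pencil 1 0 z) *m (balance 0 *m invmx L) *m b).
Proof.
move=> d0 Ex Ay; have h := pencil_solution Ex Ay.
rewrite -mulmxA -h !mulmxA -[_ *m \adj _ *m _]mulmxA mul_adj_mx.
rewrite mul_mx_scalar -!scalemxAl scalerA mulVf// scale1r.
by rewrite mulmxKV.
Qed.

Lemma delay_matrix0 : delay_matrix (fun _ => 0) = A ord0.
Proof. by rewrite /delay_matrix big1 ?addr0// => j _; rewrite scale0r. Qed.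

Lemma ker_basis_exists p q r (M : 'M[R[i]]_(p, q)) :
  \rank (kermx M^T) = r -> exists V : 'M[R[i]]_(q, r), ker_basis M V.
Proof.
move=> <-; exists (row_base (kermx M^T))^T; rewrite /ker_basis trmxK; split.
  exact: row_base_free.
by apply/eqmxP; exact: eq_row_base.
Qed.

Lemma ker_basis_mul p q r (M : 'M[R[i]]_(p, q)) (V : 'M[R[i]]_(q, r)) :
  ker_basis M V -> M *m V = 0.
Proof.
move=> [_ /andP[h _]]; move/sub_kermxP: h => h.
by apply: trmx_inj; rewrite trmx_mul h trmx0.
Qed.

Lemma ker_basis_sub p q r (M : 'M[R[i]]_(p, q)) (V : 'M[R[i]]_(q, r)) s
    (x : 'M[R[i]]_(q, s)) :
  ker_basis M V -> M *m x = 0 -> exists y, x = V *m y.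
Proof.
move=> [_ /andP[_ h]] Mx.
have : (x^T <= V^T)%MS.
  apply: submx_trans h; apply/sub_kermxP.
  by rewrite -trmx_mul Mx trmx0.
case/submxP => y hy; exists y^T.
by apply: trmx_inj; rewrite trmx_mul trmxK.
Qed.

Lemma ctr_mul p q r (M : 'M[R[i]]_(p, q)) (N : 'M[R[i]]_(q, r)) :
  ((M *m N)^t*)%sesqui = (N^t* *m M^t*)%sesqui.
Proof. by rewrite trmx_mul map_mxM. Qed.

Lemma ctrK p q (M : 'M[R[i]]_(p, q)) : ((M^t*)%sesqui^t*)%sesqui = M.
Proof. by apply/matrixP => i j; rewrite !mxE conjCK. Qed.

(** A null vector of the pencil at z = 0 is an x in ker E with A_0 x in the
    range of E, which is a null vector of the matrix in the index condition. *)
Lemma index1_det : semi_explicit_index1 E A -> \det (pencil 1 0 (fun _ => 0)) != 0.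
Proof.
move=> hidx; rewrite -unitfE -unitmxE -unitmx_tr -row_free_unit.
rewrite -kermx_eq0; apply/rowV0P => v /sub_kermxP hv.
pose x' := v^T; pose x := invmx W *m x'.
have kx : pencil 1 0 (fun _ => 0) *m x' = 0.
  by apply: trmx_inj; rewrite trmx_mul trmxK hv trmx0.
have [Ex [y0 imE]] : E *m x = 0 /\ exists y, A ord0 *m x = E *m y.
  apply: (factored_kernel Lu Wu ELW PP PQ PQ1); rewrite /x mulKVmx//.
  move: kx; rewrite mulmxBl scale1r /balance scale0r add0r delay_matrix0 !mulmxA.
  by move/eqP; rewrite subr_eq0 => /eqP.
have rkE : \rank (kermx E^T) = (n - \rank E)%N by rewrite mxrank_ker mxrank_tr.
have rkE' : \rank (kermx (E^t*)%sesqui^T) = (n - \rank E)%N.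
  by rewrite mxrank_ker mxrank_tr mxrank_map mxrank_tr.
have [Vh hV] := ker_basis_exists rkE.
have [U0 hU0] := ker_basis_exists rkE'.
have hU : ker_basis (E^t*)%sesqui ((U0^t*)%sesqui^t*)%sesqui by rewrite ctrK.
have UE : (U0^t*)%sesqui *m E = 0.
  by rewrite -[LHS]ctrK ctr_mul ctrK (ker_basis_mul hU0) trmx0 map_mx0.
have [y xy] := ker_basis_sub hV Ex.
have := hidx _ Vh (U0^t*)%sesqui hV hU => hu.
have yz : y = 0.
  rewrite -(mulKmx hu y) -!mulmxA -xy imE !mulmxA.
  by rewrite -[_ *m (U0^t*)%sesqui *m E]mulmxA UE mulmx0 !mul0mx.
apply: trmx_inj; rewrite -/x' -(mulKVmx Wu x') -/x xy yz !mulmx0.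
by rewrite trmx0.
Qed.

End Pencil.

(** * Roots of the pencil near infinity *)

Section Pencil_analysis.
Variables (R : realType) (n m : nat) (E : 'M[R[i]]_n) (A : 'I_m.+1 -> 'M[R[i]]_n).
Implicit Types (z : 'I_m -> R[i]).

(** Up to a nonzero factor, this is the determinant of the compression of A(z)
    to ker E and to the left kernel of E. *)
Definition limit_det z : R[i] := \det (pencil E A 1 0 z).

Lemma ulim_pencil (T Z : Type) (F : set_system T) (D : set Z) {FF : Filter F}
    (u sg : T -> Z -> R[i]) (u0 sg0 : Z -> R[i])
    (z : 'I_m -> T -> Z -> R[i]) (z0 : 'I_m -> Z -> R[i]) :
  ulim F D u u0 -> ulim F D sg sg0 -> (forall j, ulim F D (z j) (z0 j)) ->
  ulim_mx F D (fun t x => pencil E A (u t x) (sg t x) (fun j => z j t x))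
              (fun x => pencil E A (u0 x) (sg0 x) (fun j => z0 j x)).
Proof.
move=> hu hsg hz; apply: ulim_addmx.
  by apply: ulim_scalemx => //; exact: ulim_mx_cst.
apply: ulim_oppmx; apply: ulim_mulmx; last exact: ulim_mx_cst.
apply: ulim_mulmx.
  apply: ulim_mulmx; last exact: ulim_mx_cst.
  apply: ulim_addmx; last exact: ulim_mx_cst.
  by apply: ulim_scalemx => //; exact: ulim_mx_cst.
apply: ulim_addmx; first exact: ulim_mx_cst.
by apply: ulim_summx => j; apply: ulim_scalemx => //; exact: ulim_mx_cst.
Qed.

Lemma pencil_affine (sg : R[i]) : exists (M0 : 'M[R[i]]_n) (M : 'I_m -> 'M[R[i]]_n),
  forall u z, pencil E A u sg z =
    u *: pid_mx (\rank E) + (M0 + \sum_(j < m) z j *: M j).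
Proof.
pose N := balance E sg *m invmx (col_ebase E).
pose K X := - (N *m X *m invmx (row_ebase E)).
exists (K (A ord0)), (fun j => K (A (lift ord0 j))) => u z.
rewrite /pencil -/N; congr (_ + _); rewrite /delay_matrix mulmxDr mulmxDl opprD; congr (_ + _).
rewrite mulmx_sumr mulmx_suml -sumrN; apply: eq_bigr => j _.
by rewrite /K scalerN -scalemxAr -scalemxAl.
Qed.

(** Letting Re x tend to +oo along the curve switches all delays off, whence
    the constant coefficient. *)
Lemma limit_det_expsum z (th : 'I_m -> R) : (forall j, 0 < th j) ->
  is_expsum (fun x => limit_det (fun j => z j * cexp (- ((th j)%:C * x))))
            (limit_det (fun _ => 0)).
Proof.
move=> th0; apply: closed_det; [exact: is_expsum_cst|exact: is_expsumD|exact: is_expsumM|].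
have [M0 [M hM]] := pencil_affine 0.
move=> a b.
rewrite [X in is_expsum _ X](_ : _ = (pid_mx (\rank E) : 'M[R[i]]_n) a b + M0 a b +
    \sum_(j < m) 0 * M j a b); last first.
  rewrite hM scale1r addrA !mxE summxE; congr (_ + _).
  by apply: eq_bigr => j _; rewrite mxE.
rewrite [X in is_expsum X _](_ : _ = (fun x => (pid_mx (\rank E) : 'M[R[i]]_n) a b + M0 a b +
    \sum_(j < m) z j * cexp (- ((th j)%:C * x)) * M j a b)); last first.
  apply/funext => x; rewrite hM scale1r addrA !mxE summxE; congr (_ + _).
  by apply: eq_bigr => j _; rewrite mxE.
apply: is_expsumD; first exact: is_expsum_cst.
apply: closed_sum; [exact: is_expsum_cst|exact: is_expsumD|move=> j].
apply: is_expsumM; last exact: is_expsum_cst.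
by have := is_expsum_mono (z j) (ltW (th0 j)); rewrite gt_eqF.
Qed.

Lemma limit_det_approx (r : R) (sg : R[i]) z (th : 'I_m -> R) : 0 <= r ->
  poly_approx r (fun x => \det (pencil E A (1 + sg * x) sg
     (fun j => z j * cexp (- ((th j)%:C * x))))).
Proof.
move=> r0; apply: approx_det => a b.
have [M0 [M hM]] := pencil_affine sg.
rewrite (_ : (fun x => _) = (fun x => (1 + sg * x) * (pid_mx (\rank E) : 'M[R[i]]_n) a b
    + (M0 a b + \sum_(j < m) z j * cexp (- (th j)%:C * x) * M j a b))); last first.
  apply/funext => x; rewrite hM !mxE summxE; congr (_ + (_ + _)).
  by apply: eq_bigr => j _; rewrite mxE mulNr.
apply: approxD.
  apply: approxM; last exact: approx_cst.
  apply: approxD; first exact: approx_cst.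
  by apply: approxM; [exact: approx_cst|exact: approx_id].
apply: approxD; first exact: approx_cst.
apply: (@closed_sum R _ (fun f _ => poly_approx r f) _ _ _ _ _ (fun _ => 0)).
- exact: approx_cst.
- by move=> f g _ _; exact: approxD.
move=> j; apply: approxM; last exact: approx_cst.
by apply: approxM; [exact: approx_cst|exact: approx_cexp].
Qed.

Lemma limit_det_ccont (sg : R[i]) z (th : 'I_m -> R) :
  ccont (fun x => \det (pencil E A (1 + sg * x) sg
     (fun j => z j * cexp (- ((th j)%:C * x))))).
Proof.
move=> k v g hg; apply: ulim_det; apply: ulim_pencil.
- apply: ulimD; first exact: ulim_cst1.
  by apply: ulimM => //; exact: ulim_cst1.
- exact: ulim_cst1.
- move=> j; apply: ulimM; first exact: ulim_cst1.
  apply: ulim_cexp; apply: ulimN; apply: ulimM => //; exact: ulim_cst1.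
Qed.

(** Triples (sg, theta, z): inverse frequency, delays, exponential factors. *)
Definition near_param (th : 'I_m -> R) (z0 : 'I_m -> R[i]) :
    set_system (R[i] * ('I_m -> R) * ('I_m -> R[i])) :=
  [set S | exists2 e : R, 0 < e & forall p, nc p.1.1 < e ->
     (forall j, `|p.1.2 j - th j| < e) -> (forall j, nc (p.2 j - z0 j) < e) -> S p].

Lemma near_param_filter th z0 : Filter (near_param th z0).
Proof.
split.
- by exists 1.
- move=> S S' [e e0 h] [e' e0' h']; exists (Num.min e e'); first by rewrite lt_min e0.
  move=> p h1 h2 h3; split.
    apply: h => [|j|j].
    + by move: h1; rewrite lt_min => /andP[].
    + by have := h2 j; rewrite lt_min => /andP[].
    + by have := h3 j; rewrite lt_min => /andP[].
  apply: h' => [|j|j].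
  + by move: h1; rewrite lt_min => /andP[].
  + by have := h2 j; rewrite lt_min => /andP[].
  + by have := h3 j; rewrite lt_min => /andP[].
- by move=> S S' SS' [e e0 h]; exists e => // p h1 h2 h3; apply: SS'; apply: h.
Qed.

(** The zero at x = 0 of the exponential sum obtained for sg = 0 is isolated,
    as the constant coefficient of that sum is nonzero; so it persists for
    small sg. With sg = 1 / s, the factor 1 + sg x is (s + x) / s, so the
    conclusion is a characteristic root at s + x. *)
Lemma hurwitz (th : 'I_m -> R) z0 (r : R) :
  (forall j, 0 < th j) -> limit_det (fun _ => 0) != 0 -> limit_det z0 = 0 -> 0 < r ->
  exists2 e : R, 0 < e & forall (sg : R[i]) (th' : 'I_m -> R) z,
    nc sg < e -> (forall j, `|th' j - th j| < e) -> (forall j, nc (z j - z0 j) < e) ->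
    exists2 x, nc x <= r & \det (pencil E A (1 + sg * x) sg
       (fun j => z j * cexp (- ((th' j)%:C * x)))) = 0.
Proof.
move=> th0 f0 fz0 r0.
pose g (x : R[i]) := limit_det (fun j => z0 j * cexp (- ((th j)%:C * x))).
have [r' [r'0 r'r gr]] := is_expsum_circle (limit_det_expsum z0 th0) f0 r0.
have gE x : g x = \det (pencil E A (1 + 0 * x) 0
     (fun j => z0 j * cexp (- ((th j)%:C * x)))) by rewrite mul0r addr0.
have gc : ccont g.
  by have := limit_det_ccont 0 z0 th; congr ccont; apply/funext => x; rewrite gE.
have [x0 hx0 x0min] := circle_min gc (ltW r'0).
pose c := nc (g x0); have c0 : 0 < c by rewrite nc_gt0 gr.
have c2 : 0 < c / 2 by rewrite divr_gt0.
have FF := near_param_filter th z0.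
(* Perturbing the parameters away from sg = 0 moves the determinant
   uniformly little on the disc. *)
have U : ulim (near_param th z0) [set x : R[i] | nc x <= r']
   (fun p x => \det (pencil E A (1 + p.1.1 * x) p.1.1
       (fun j => p.2 j * cexp (- ((p.1.2 j)%:C * x))))) g.
  rewrite (_ : g = fun x => \det (pencil E A (1 + 0 * x) 0
     (fun j => z0 j * cexp (- ((th j)%:C * x))))); last by apply/funext => x; rewrite gE.
  have ux : ulim (near_param th z0) [set x : R[i] | nc x <= r'] (fun _ => id) id.
    by apply: ulim_cst; exists r'.
  have us : ulim (near_param th z0) [set x : R[i] | nc x <= r'] (fun p _ => p.1.1) (fun=> 0).
    split; first by exists 0 => x _; rewrite nc0.
    by move=> e e0; exists e => // p h _ _ x _; rewrite subr0.
  apply: ulim_det; apply: ulim_pencil => //.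
    by apply: ulimD; [exact: ulim_cst1|exact: ulimM].
  move=> j; apply: ulimM.
    split; first by exists (nc (z0 j)).
    by move=> e e0; exists e => // p _ _ h x _.
  apply: ulim_cexp; apply: ulimN; apply: ulimM => //.
  split; first by exists (nc (th j)%:C).
  by move=> e e0; exists e => // p _ h _ x _; rewrite -rmorphB nc_real.
have [_ /(_ _ c2) [e e0 he]] := U.
exists e => // sg th' z h1 h2 h3.
pose h x := \det (pencil E A (1 + sg * x) sg (fun j => z j * cexp (- ((th' j)%:C * x)))).
have {}he x : nc x <= r' -> nc (h x - g x) < c / 2 by exact: (he (sg, th', z) h1 h2 h3).
have r'0' := ltW r'0.
have g0 : g 0 = 0.
  rewrite -[RHS]fz0 /g; congr limit_det; apply/funext => j.
  by rewrite mulr0 oppr0 cexp0 mulr1.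
have hc : ccont h := limit_det_ccont sg z th'.
have ha : poly_approx r' h := limit_det_approx sg z th' r'0'.
have [x hx hx0'] := approx_zero_near r'0' hc ha x0min g0 he.
by exists x => //; apply: le_trans hx r'r.
Qed.

Definition is_poly (g : R[i] -> R[i]) : Prop := exists P : {poly R[i]}, forall w, g w = P.[w].

Lemma is_poly_cst c : is_poly (fun _ => c).
Proof. by exists c%:P => w; rewrite hornerC. Qed.

Lemma is_polyD f g : is_poly f -> is_poly g -> is_poly (fun w => f w + g w).
Proof. by move=> [P hP] [Q hQ]; exists (P + Q) => w; rewrite hornerD hP hQ. Qed.

Lemma is_polyM f g : is_poly f -> is_poly g -> is_poly (fun w => f w * g w).
Proof. by move=> [P hP] [Q hQ]; exists (P * Q) => w; rewrite hornerM hP hQ. Qed.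

Lemma is_poly_id : is_poly id.
Proof. by exists 'X => w; rewrite hornerX. Qed.

Lemma is_poly_sum (I : Type) (r : seq I) (f : I -> R[i] -> R[i]) :
  (forall i, is_poly (f i)) -> is_poly (fun w => \sum_(i <- r) f i w).
Proof.
move=> h; apply: (@closed_sum R _ (fun f _ => is_poly f) _ _ _ _ _ (fun _ => 0)) => //.
- exact: is_poly_cst.
- by move=> ? ? _ _; exact: is_polyD.
Qed.

Lemma is_poly_det k (M : R[i] -> 'M[R[i]]_k) :
  (forall i j, is_poly (fun w => M w i j)) -> is_poly (fun w => \det (M w)).
Proof.
move=> h; apply: (@closed_det R _ (fun f _ => is_poly f) _ _ _ _ _ 0) => //.
- exact: is_poly_cst.
- by move=> ? ? _ _; exact: is_polyD.
- by move=> ? ? _ _; exact: is_polyM.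
Qed.

Lemma is_poly_mulmx k l p (M : R[i] -> 'M[R[i]]_(k, l)) (N : R[i] -> 'M[R[i]]_(l, p)) :
  (forall i j, is_poly (fun w => M w i j)) -> (forall i j, is_poly (fun w => N w i j)) ->
  forall i j, is_poly (fun w => (M w *m N w) i j).
Proof.
move=> hM hN i j.
rewrite (_ : (fun w => _) = (fun w => \sum_k M w i k * N w k j)); last first.
  by apply/funext => w; rewrite mxE.
by apply: is_poly_sum => a; exact: is_polyM.
Qed.

Lemma is_poly_adj k (M : R[i] -> 'M[R[i]]_k) :
  (forall i j, is_poly (fun w => M w i j)) -> forall i j, is_poly (fun w => (\adj (M w)) i j).
Proof.
move=> hM i j.
rewrite (_ : (fun w => _) = (fun w => cofactor (M w) j i)); last first.
  by apply/funext => w; rewrite mxE.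
apply: is_polyM; first exact: is_poly_cst.
apply: is_poly_det => a b.
have := hM (lift j a) (lift i b); congr is_poly.
by apply/funext => w; rewrite !mxE.
Qed.

Lemma is_poly_pencil u (sg : R[i]) z (k : 'I_m) (a b : 'I_n) :
  is_poly (fun w => pencil E A u sg (set_coord z k w) a b).
Proof.
have [M0 [M hM]] := pencil_affine sg.
rewrite (_ : (fun x => _) = (fun w => u * (pid_mx (\rank E) : 'M[R[i]]_n) a b
    + (M0 a b + \sum_(j < m) set_coord z k w j * M j a b))); last first.
  apply/funext => x; rewrite hM !mxE summxE; congr (_ + (_ + _)).
  by apply: eq_bigr => j _; rewrite mxE.
apply: is_polyD; first exact: is_poly_cst.
apply: is_polyD; first exact: is_poly_cst.
apply: is_poly_sum => j; apply: is_polyM; last exact: is_poly_cst.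
by rewrite /set_coord; case: eqP => _; [exact: is_poly_id|exact: is_poly_cst].
Qed.

Lemma limit_det_separately_poly : separately_poly limit_det.
Proof. by move=> z j; apply: is_poly_det => a b; exact: is_poly_pencil. Qed.

(** Numerator, by Cramer, of the transfer function in the scaled coordinates. *)
Definition transfer_numerator p q (B : 'M[R[i]]_(n, p)) (C : 'M[R[i]]_(q, n)) (u sg : R[i]) z :=
  C *m invmx (row_ebase E) *m \adj (pencil E A u sg z) *m
    (balance E sg *m invmx (col_ebase E)) *m B.

Lemma transfer_numerator_separately_poly p q (B : 'M[R[i]]_(n, p)) (C : 'M[R[i]]_(q, n)) a b :
  separately_poly (fun z => transfer_numerator B C 1 0 z a b).
Proof.
have cst k l (M : 'M[R[i]]_(k, l)) i j : is_poly (fun _ => M i j) by exact: is_poly_cst.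
move=> z k; apply: is_poly_mulmx => // i j; apply: is_poly_mulmx => // {}i {}j.
apply: is_poly_mulmx => // {}i {}j.
by apply: is_poly_adj => {}i {}j; exact: is_poly_pencil.
Qed.

Lemma ulim_limit_det (T Z : Type) (F : set_system T) (D : set Z) {FF : Filter F}
    (z : 'I_m -> T -> Z -> R[i]) (z0 : 'I_m -> Z -> R[i]) :
  (forall j, ulim F D (z j) (z0 j)) ->
  ulim F D (fun t x => limit_det (fun j => z j t x)) (fun x => limit_det (fun j => z0 j x)).
Proof.
by move=> h; apply: ulim_det; apply: ulim_pencil => //; exact: ulim_cst1.
Qed.

End Pencil_analysis.

(** * From the tori to the closed polydisc *)

Section Polydisc.
Variables (R : realType) (m : nat) (f : ('I_m -> R[i]) -> R[i]).

Definition unit_polydisc : set ('I_m -> R[i]) := [set y | forall j, nc (y j) <= 1].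

(** The flow that contracts the torus |z_j| = exp (- s tau_j) to the one with
    parameter s + t. *)
Definition shrink (tau : 'I_m -> R) (t : R) (y : 'I_m -> R[i]) : 'I_m -> R[i] :=
  fun j => (expR (- (t * tau j)))%:C * y j.

Lemma shrinkD tau s t y : shrink tau s (shrink tau t y) = shrink tau (s + t) y.
Proof.
apply/funext => j; rewrite /shrink mulrA -rmorphM /= -expRD; congr (_%:C * _).
by congr expR; ring.
Qed.

Lemma shrink_unit tau t y : (forall j, 0 < tau j) -> 0 <= t ->
  unit_polydisc y -> unit_polydisc (shrink tau t y).
Proof.
move=> tau0 t0 hy j; rewrite /shrink ncM nc_real ger0_norm ?expR_ge0//.
apply: mulr_ile1; rewrite ?expR_ge0 ?nc_ge0//.
by rewrite expR_le1 oppr_le0 mulr_ge0// ltW.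
Qed.

(** Continuity together with uniform continuity on bounded sets. *)
Definition ucontinuous : Prop :=
  forall (T Z : Type) (F : set_system T) (D : set Z), Filter F ->
  forall (z : 'I_m -> T -> Z -> R[i]) (z0 : 'I_m -> Z -> R[i]),
  (forall j, ulim F D (z j) (z0 j)) ->
  ulim F D (fun t x => f (fun j => z j t x)) (fun x => f (fun j => z0 j x)).

Hypothesis fsep : separately_poly f.
Hypothesis fcont : ucontinuous.

(** Let t0 be the largest t such that f has a zero in the polydisc of radii
    exp (- t tau_j). On slightly smaller polydiscs f has no zero, so the
    minimum modulus principle bounds |f| from below there by its minimum on
    tori, uniformly. This contradicts continuity at a zero in a polydisc with
    t close to t0. *)
Lemma nonvanishing (tau : 'I_m -> R) : (forall j, 0 < tau j) -> f (fun _ => 0) != 0 ->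
  (forall (t : R) (phi : 'I_m -> R), 0 <= t ->
     f (fun j => cexp ((- (t * tau j)) +i* phi j)) != 0) ->
  forall z, unit_polydisc z -> f z != 0.
Proof.
move=> tau0 f0 ft z hz; apply/eqP => fz.
have yb j : exists M : R, forall x : 'I_m -> R[i], unit_polydisc x -> nc (x j) <= M.
  by exists 1.
(* For large t the polydisc is close to 0, where f does not vanish. *)
have [T0 hT0] : exists T0 : R, forall t y, T0 < t -> unit_polydisc y ->
    f (shrink tau t y) != 0.
  have U : ulim +oo%R unit_polydisc (fun t y => f (shrink tau t y)) (fun=> f (fun=> 0)).
    apply: fcont => j; rewrite (_ : (fun=> 0) = (fun x : 'I_m -> R[i] => 0 * x j)); last first.
      by apply/funext => x; rewrite mul0r.
    apply: ulimM; last exact: (ulim_cst (yb j)).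
    split; first by exists 0 => x _; rewrite nc0.
    move=> e e0; near=> t => x _; rewrite subr0 nc_real ger0_norm ?expR_ge0//.
    rewrite -[X in _ < X](lnK (x := e)) ?posrE// ltr_expR ltrNl -ltr_pdivrMr//.
    by near: t; apply: nbhs_pinfty_gt; rewrite num_real.
  have f00 : 0 < nc (f (fun=> 0)) by rewrite nc_gt0.
  have [_ /(_ _ f00) [M [_ hM]]] := U.
  exists M => t y Mt hy; have := hM t Mt y hy; apply: contraTneq => ->.
  by rewrite sub0r ncN ltxx.
(* The polydisc of radii exp (- t tau_j) is the image of the unit polydisc
   under shrink. *)
pose S := [set t : R | 0 <= t /\ exists2 y, unit_polydisc y & f (shrink tau t y) = 0].
have S0 : S 0.
  split=> //; exists z => //; rewrite -[RHS]fz; congr f; apply/funext => j.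
  by rewrite /shrink mul0r oppr0 expR0 mul1r.
have ubS : ubound S T0.
  move=> t [_ [y hy fy]]; rewrite leNgt; apply/negP => /(hT0 t y)/(_ hy).
  by rewrite fy eqxx.
have supS : has_sup S by split; [exists 0|exists T0].
(* The tori with 0 <= t <= T0 + 1 are parametrized by a compact box;
   coordinate 0 is t and the others are the angles. *)
pose w (v : 'rV[R]_m.+1) : 'I_m -> R[i] :=
  fun j => cexp ((- (v 0 ord0 * tau j)) +i* v 0 (lift ord0 j)).
pose a (i : 'I_m.+1) : R := if i == ord0 then 0 else - pi.
pose b (i : 'I_m.+1) : R := if i == ord0 then T0 + 1 else pi.
have T00 : 0 <= T0 by exact: ubS.
have ab i : a i <= b i.
  rewrite /a /b; case: eqP => _; first by rewrite addr_ge0.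
  by rewrite -subr_ge0 opprK addr_ge0 ?pi_ge0.
have [v|v0 [hv0 v0min]] := @box_min R m.+1 a b (fun v => f (w v)) ab.
  apply: fcont => j; apply: ulim_cexp.
  rewrite [X in ulim _ _ X _](_ : _ = (fun (u : 'rV[R]_m.+1) (_ : unit) =>
    - ((u 0 ord0)%:C * (tau j)%:C) + (0 +i* 1) * (u 0 (lift ord0 j))%:C)); last first.
    apply/funext => u; apply/funext => _; apply: complex_eqP;
    by rewrite ?cReD ?cImD ?cReN ?cImN ?cReMr ?cImMr /=; ring.
  rewrite [X in ulim _ _ _ X](_ : _ = (fun _ : unit =>
    - ((v 0 ord0)%:C * (tau j)%:C) + (0 +i* 1) * (v 0 (lift ord0 j))%:C)); last first.
    apply/funext => _; apply: complex_eqP;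
    by rewrite ?cReD ?cImD ?cReN ?cImN ?cReMr ?cImMr /=; ring.
  apply: ulimD.
    by apply: ulimN; apply: ulimM; [exact: ulim_coord|exact: ulim_cst1].
  by apply: ulimM; [exact: ulim_cst1|exact: ulim_coord].
pose c := nc (f (w v0)).
have c0 : 0 < c.
  rewrite nc_gt0 /w (ft (v0 0 ord0) (fun j => v0 0 (lift ord0 j)))//.
  by have := hv0 ord0; rewrite /a eqxx => /andP[].
have [d d0 hd] : exists2 d : R, 0 < d & forall eta x, 0 <= eta -> eta < d -> unit_polydisc x ->
    nc (f (shrink tau eta x) - f x) < c.
  have U : ulim (nbhs (0 : R)) unit_polydisc (fun t y => f (shrink tau t y)) f.
    rewrite [X in ulim _ _ _ X](_ : _ = (fun y => f (fun j => 1 * y j))); last first.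
      by apply/funext => y; congr f; apply/funext => j; rewrite mul1r.
    apply: fcont => j; apply: ulimM; last exact: (ulim_cst (FF := nbhs_filter (0 : R)) (yb j)).
    split; first by exists 1 => x _; rewrite nc1.
    move=> e e0.
    have cont : {for (0 : R), continuous (fun t : R => expR (- (t * tau j)))}.
      have d1 : is_derive (0 : R) 1 (fun t : R => - tau j * t) (- tau j).
        by have := is_deriveZ_var (- tau j) (is_derive_id (0 : R) 1); rewrite mulr1.
      have := is_derive_continuous
        (@is_derive1_comp _ expR (fun t => - tau j * t) 0 _ _ (is_derive_expR _) d1).
      congr ({for _, continuous _}); apply/funext => t.
      by apply/funext => u /=; congr expR; ring.
    have /cvgrPdist_lt/(_ e e0) := cont.
    apply: (@filterS _ (nbhs (0 : R)) (nbhs_filter (0 : R))) => t.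
    rewrite mul0r oppr0 expR0 => h x _.
    by rewrite -(rmorph1 (real_complex R)) -rmorphB nc_real distrC.
  have [_ /(_ _ c0)] := U; move/nbhs_ballP => [d /= d0 hd].
  exists d => // eta x e0 ed hx; apply: hd => //.
  by rewrite /ball /= sub0r normrN ger0_norm.
(* Shrinking a zero with parameter t > sup S - eta by eta leaves S, but
   changes f by less than c. *)
pose eta := Num.min (d / 2) 1.
have eta0 : 0 < eta by rewrite lt_min divr_gt0// ltr01.
have etad : eta < d by rewrite gt_min ltr_pdivrMr// ltr_pMr// ltr1n.
have eta1 : eta <= 1 by rewrite ge_min lexx orbT.
have [t [t0 [y hy fy]] tS] := sup_adherent eta0 supS.
have tT : t <= T0 by apply: ubS; split=> //; exists y.
have hu := shrink_unit tau0 t0 hy.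
have := hd eta _ (ltW eta0) etad hu; rewrite fy subr0 shrinkD ltNge => /negP; apply.
have te0 : 0 <= eta + t by rewrite addr_ge0// ltW.
apply: (@polydisc_min_modulus R m f (fun j => expR (- ((eta + t) * tau j)))).
- exact: fsep.
- by move=> j; rewrite expR_ge0.
- move=> u hu'; apply/eqP => fu.
  suff : S (eta + t).
    by move=> /(sup_upper_bound supS); rewrite leNgt -ltrBDl tS.
  split=> //; exists (shrink tau (- (eta + t)) u).
    move=> j; rewrite /shrink ncM nc_real ger0_norm ?expR_ge0// mulNr opprK mulrC.
    rewrite -ler_pdivlMr ?expR_gt0// div1r -expRN; exact: hu'.
  rewrite shrinkD subrr -[RHS]fu; congr f; apply/funext => j.
  by rewrite /shrink mul0r oppr0 expR0 mul1r.
- move=> u hu'.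
  have /choice[phi hphi] : forall j, exists phi : R, - pi <= phi <= pi /\
      u j = (nc (u j))%:C * cexp (0 +i* phi).
    by move=> j; have [phi h1 h2] := polar (u j); exists phi.
  have -> : u = w (\row_i (if unlift ord0 i is Some j then phi j else eta + t)).
    apply/funext => j; rewrite /w !mxE liftK unlift_none.
    have [_ {1}->] := hphi j; rewrite hu'; apply: complex_eqP;
    by rewrite 1?mulrC ?cReMr ?cImMr ?Re_cexp ?Im_cexp /= expR0 mul1r mulrC.
  apply: v0min => i; rewrite mxE /a /b; case: unliftP => [j ->|->].
    by have [h _] := hphi j.
  by rewrite eqxx te0 /= addrC lerD.
- move=> j; rewrite /shrink ncM nc_real ger0_norm ?expR_ge0//.
  by rewrite ler_piMr ?expR_ge0.
Unshelve. all: by end_near. Qed.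

End Polydisc.

(** * Prescribed phases and almost periods *)

Section Phases.
Variable R : realType.

Lemma cis_int (k : int) : cexp (0 +i* (2 * pi * k%:~R)) = 1 :> R[i].
Proof.
have nat_case (j : nat) : cexp (0 +i* (2 * pi * j%:R)) = 1 :> R[i].
  elim: j => [|j IH]; first by rewrite mulr0 cexp0.
  rewrite (_ : _ +i* _ = (0 +i* (2 * pi * j%:R)) + (0 +i* (2 * pi)) :> R[i]); last first.
    by apply: complex_eqP; rewrite ?cReD ?cImD /= -?natr1; ring.
  rewrite cexpD IH mul1r; apply: complex_eqP.
    by rewrite Re_cexp /= expR0 mul1r mulrC mulr_natr cos2pi.
  by rewrite Im_cexp /= expR0 mul1r mulrC mulr_natr sin2pi.
case: k => j; first exact: nat_case.
have h := nat_case j.+1.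
apply: (mulfI (cexp_neq0 (0 +i* (2 * pi * j.+1%:R)))).
rewrite -cexpD mulr1 h -[RHS]cexp0; congr cexp.
by apply: complex_eqP; rewrite ?cReD ?cImD /= ?addr0// NegzE rmorphN /= mulrN -mulr_natr subrr.
Qed.

Lemma cisB1 (y : R) : `|y| <= 1 -> nc (cexp (0 +i* y) - 1) <= 2 * expR 1 * `|y|.
Proof.
move=> y1; have ny : nc (0 +i* y) = `|y| by rewrite ncE /= expr0n add0r sqrtr_sqr.
have := @nc_cexpB R 0 (0 +i* y); rewrite ny => /(_ y1).
by rewrite add0r cexp0 nc0 expR0 mul1r.
Qed.

(** The candidates theta form an arithmetic progression of step 2 pi / w. *)
Lemma phase_choice (w tau phi : R) : 0 < w ->
  exists theta : R, `|theta - tau| <= 2 * pi / w /\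
    cexp (0 +i* (- (w * theta))) = cexp (0 +i* phi).
Proof.
move=> w0; pose k := Num.floor ((w * tau + phi) / (2 * pi)).
have p0 : 0 < 2 * pi :> R by rewrite mulr_gt0 ?pi_gt0.
exists ((2 * pi * k%:~R - phi) / w); split; last first.
  rewrite mulrC mulfVK ?gt_eqF//.
  have -> : 0 +i* (- (2 * pi * k%:~R - phi)) =
      (0 +i* (2 * pi * (- k)%:~R)) + (0 +i* phi) :> R[i].
    by apply: complex_eqP; rewrite ?cReD ?cImD /= ?addr0// rmorphN; ring.
  by rewrite cexpD cis_int mul1r.
have /andP[k1 k2] : k%:~R <= (w * tau + phi) / (2 * pi) < (k + 1)%:~R.
  by rewrite floor_le_tmp floorD1_gt.
rewrite ler_pdivlMr// in k1; rewrite rmorphD /= ltr_pdivrMr// in k2.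
have -> : (2 * pi * k%:~R - phi) / w - tau = (2 * pi * k%:~R - phi - w * tau) / w.
  by field; rewrite gt_eqF.
rewrite normrM normfV (gtr0_norm w0) ler_pM2r ?invr_gt0//.
by rewrite ler_norml; apply/andP; split; move: k1 k2; clear; lra.
Qed.

(** Dirichlet: by the pigeonhole principle two multiples of a large step have
    phases in the same cell of the torus, and their difference is an almost
    period. *)
Lemma almost_period (m : nat) (th : 'I_m -> R) (e W : R) : 0 < e ->
  exists T : R, W <= T /\ forall j, nc (cexp (0 +i* (T * th j)) - 1) < e.
Proof.
move=> e0; pose W' := Num.max W 1.
have W1 : 1 <= W' by rewrite le_max lexx orbT.
have WW : W <= W' by rewrite le_max lexx.
have p0 : 0 < 2 * pi :> R by rewrite mulr_gt0 ?pi_gt0.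
pose eta := Num.min 1 (e / (2 * expR 1)) / 2.
have K0 : 0 < 2 * expR 1 :> R by rewrite mulr_gt0 ?expR_gt0.
have eta0 : 0 < eta by rewrite divr_gt0// lt_min ltr01 divr_gt0.
have [Q hQ] : exists Q : nat, 2 * pi < eta * Q.+1%:R.
  exists (Num.truncn (2 * pi / eta)).
  by rewrite [eta * _]mulrC -ltr_pdivrMr// truncnS_gt.
(* Phases, in turns, of the a-th multiple of the step W'; the digit of a is
   the index, modulo full turns, of the cell of width 1 / (Q + 1) that
   contains it. *)
pose u (a : nat) (j : 'I_m) : R := a%:R * W' * th j / (2 * pi).
pose N (a : nat) j := Num.floor (Q.+1%:R * u a j).
pose dig (a : 'I_(Q.+1 ^ m).+1) : {ffun 'I_m -> 'I_Q.+1} :=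
  [ffun j => inord `|(N a j %% Q.+1)%Z|%N].
have : ~ injective dig.
  move=> /leq_card; rewrite card_ord card_ffun !card_ord.
  by rewrite ltnn.
move=> /injectiveP/injectivePn[a [b ab dab]].
wlog lab : a b ab dab / (a < b)%N.
  move=> H; have [l|l|/val_inj E] := ltngtP a b; first exact: (H a b).
    by apply: (H b a) => //; rewrite eq_sym.
  by rewrite E eqxx in ab.
pose T := (b - a)%:R * W'; exists T; split.
  apply: le_trans WW _; rewrite /T ler_peMl//; first exact: le_trans W1.
  by rewrite ler1n subn_gt0.
move=> j.
have modlt c : (`|(N c j %% Q.+1)%Z| < Q.+1)%N.
  by rewrite -ltz_nat gez0_abs ?modz_ge0// ltz_pmod.
have dm : (N a j %% Q.+1)%Z = (N b j %% Q.+1)%Z.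
  have := congr1 (fun f : {ffun 'I_m -> 'I_Q.+1} => val (f j)) dab.
  rewrite /= !ffunE !inordK// => /(congr1 Posz).
  by rewrite !gez0_abs ?modz_ge0.
(* Equal digits: the phases differ by k turns up to 1 / (Q + 1). *)
have [k hk] : exists k : int, N b j - N a j = k * Q.+1%:Z.
  exists ((N b j %/ Q.+1)%Z - (N a j %/ Q.+1)%Z).
  by rewrite {1}(divz_eq (N b j) Q.+1) {1}(divz_eq (N a j) Q.+1) dm; ring.
have fl c : (N c j)%:~R <= Q.+1%:R * u c j < (N c j)%:~R + 1.
  by rewrite floor_le_tmp -[X in _ + X](mulr1z 1) -rmorphD floorD1_gt.
have [/andP[a1 a2] /andP[b1 b2]] := (fl a, fl b).
have Q0 : 0 < Q.+1%:R :> R by rewrite ltr0n.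
pose y := T * th j - 2 * pi * k%:~R.
have uT : T * th j = 2 * pi * (u b j - u a j).
  rewrite /u /T natrB; last exact: ltnW.
  by rewrite -mulrBl [RHS]mulrC divfK ?gt_eqF//; ring.
have yb : `|y| <= 2 * pi / Q.+1%:R.
  have -> : y = 2 * pi * (Q.+1%:R * u b j - Q.+1%:R * u a j - k%:~R * Q.+1%:R) / Q.+1%:R.
    by rewrite /y uT; field; rewrite gt_eqF.
  have hk' : (N b j)%:~R - (N a j)%:~R = k%:~R * Q.+1%:R :> R.
    by rewrite -rmorphB hk rmorphM.
  rewrite -hk' normrM normfV (gtr0_norm Q0) ler_pM2r ?invr_gt0//.
  rewrite normrM (gtr0_norm p0) ler_piMr ?(ltW p0)//.
  by rewrite ler_norml; apply/andP; split; move: a1 a2 b1 b2; clear; lra.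
have ye : `|y| < eta.
  by apply: le_lt_trans yb _; rewrite ltr_pdivrMr.
have eta1 : eta <= 1 / 2 by rewrite ler_pM2r ?invr_gt0// ge_min lexx.
have eta2 : eta <= e / (2 * expR 1) / 2.
  by rewrite ler_pM2r ?invr_gt0// ge_min lexx orbT.
have -> : 0 +i* (T * th j) = (0 +i* (2 * pi * k%:~R)) + (0 +i* y) :> R[i].
  by apply: complex_eqP; rewrite ?cReD ?cImD /= ?addr0// /y; ring.
rewrite cexpD cis_int mul1r; apply: le_lt_trans (cisB1 _) _.
  by move: ye eta1; clear; lra.
rewrite mulrC -ltr_pdivlMr//; apply: lt_le_trans ye _; apply: le_trans eta2 _.
by rewrite ler_piMr ?divr_ge0 ?ltW// invf_lt1// ltr1n.
Qed.

End Phases.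

(** * Exponential stability and characteristic roots *)

Section Stability.
Variables (R : realType) (n m : nat) (E : 'M[R[i]]_n) (A : 'I_m.+1 -> 'M[R[i]]_n).

Definition delay_factors (theta : 'rV[R]_m) (s : R[i]) : 'I_m -> R[i] :=
  fun j => cexp (- (s * (theta 0 j)%:C)).

Lemma delay_lift (theta : 'rV[R]_m) (j : 'I_m) : delay theta (lift ord0 j) = theta 0 j.
Proof. by rewrite /delay liftK. Qed.

Lemma delay_ord0 (theta : 'rV[R]_m) : delay theta ord0 = 0.
Proof. by rewrite /delay unlift_none. Qed.

Lemma sum_delaysE (theta : 'rV[R]_m) (s : R[i]) :
  \sum_k cexp (- (s * (delay theta k)%:C)) *: A k = delay_matrix A (delay_factors theta s).
Proof.
rewrite big_ord_recl delay_ord0 mulr0 oppr0 cexp0 scale1r; congr (_ + _).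
by apply: eq_bigr => j _; rewrite delay_lift.
Qed.

Lemma frob_scale p q (c : R[i]) (M : 'M[R[i]]_(p, q)) : frob (c *: M) = nc c * frob M.
Proof.
rewrite /frob -[nc c]ger0_norm ?nc_ge0// -sqrtr_sqr -sqrtrM ?sqr_ge0//.
congr Num.sqrt; rewrite mulr_sumr; apply: eq_bigr => i _.
by rewrite mulr_sumr; apply: eq_bigr => j _; rewrite mxE ncM exprMn.
Qed.

Lemma frob_ge p q (M : 'M[R[i]]_(p, q)) i j : nc (M i j) <= frob M.
Proof.
rewrite -[nc _]ger0_norm ?nc_ge0// -sqrtr_sqr ler_wsqrtr//.
rewrite (bigD1 i)//= (bigD1 j)//= -addrA lerDl addr_ge0//.
  by apply: sumr_ge0 => k _; rewrite sqr_ge0.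
by apply: sumr_ge0 => k _; apply: sumr_ge0 => l _; rewrite sqr_ge0.
Qed.

Lemma is_cderiveMr F F' (c : R[i]) : is_cderive F F' ->
  is_cderive (fun t => F t * c) (fun t => F' t * c).
Proof.
move=> h t; have [a b] := h t; case: c => c1 c2.
have Z (f : R -> R) (k d : R) : is_derive t 1 f d -> is_derive t 1 (fun u => f u * k) (d * k).
  move=> hf; rewrite mulrC; have := is_deriveZ_var k hf.
  by congr (is_derive _ _ _ _); apply/funext => u; rewrite mulrC.
split; cbv beta.
- rewrite cReM /=; have := is_deriveB (Z _ c1 _ a) (Z _ c2 _ b).
  by congr (is_derive _ _ _ _); apply/funext => u; rewrite cReM.
- rewrite cImM /=; have := is_deriveD (Z _ c2 _ a) (Z _ c1 _ b).
  by congr (is_derive _ _ _ _); apply/funext => u; rewrite cImM.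
Qed.

Lemma exponential_solution (theta : 'rV[R]_m) (s : R[i]) (v : 'cV[R[i]]_n) :
  (s *: E - delay_matrix A (delay_factors theta s)) *m v = 0 ->
  is_solution E A theta (fun t => cexp (s * t%:C) *: v).
Proof.
move=> hv.
have d (c : R[i]) : is_cderive (fun t => cexp (s * t%:C) * c)
    (fun t => s * cexp (s * t%:C) * c).
  exact: is_cderiveMr (is_cderive_cexp s).
split.
  move=> i; split; apply: continuous_subspaceT => t.
    have := is_derive_continuous (d (v i 0) t).1.
    by congr ({for _, continuous _}); apply/funext => x; apply/funext => u; rewrite mxE.
  have := is_derive_continuous (d (v i 0) t).2.
  by congr ({for _, continuous _}); apply/funext => x; apply/funext => u; rewrite mxE.
move=> t t0 i rhs.
have -> : rhs = s * cexp (s * t%:C) * (E *m v) i 0.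
  have sE : s *: (E *m v) = delay_matrix A (delay_factors theta s) *m v.
    by apply/eqP; rewrite -subr_eq0 scalemxAl -mulmxBl hv.
  have -> : s * cexp (s * t%:C) * (E *m v) i 0 = (cexp (s * t%:C) *: (s *: (E *m v))) i 0.
    by rewrite !mxE; ring.
  rewrite sE -sum_delaysE mulmx_suml scaler_sumr /rhs.
  congr ((_ : 'cV_n) i 0); apply: eq_bigr => k _.
  rewrite -scalemxAr -scalemxAl scalerA -cexpD; congr (cexp _ *: _).
  by rewrite rmorphB /=; ring.
have [a b] := d ((E *m v) i 0) t; split.
- by move: a; congr (is_derive _ _ _ _); apply/funext => u; rewrite -scalemxAr [in RHS]mxE.
- by move: b; congr (is_derive _ _ _ _); apply/funext => u; rewrite -scalemxAr [in RHS]mxE.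
Qed.

Lemma det0_vector (M : 'M[R[i]]_n) : \det M = 0 -> exists2 v : 'cV_n, v != 0 & M *m v = 0.
Proof.
rewrite -det_tr => /eqP/det0P[v v0 hv]; exists v^T; first by rewrite trmx_eq0.
by apply: trmx_inj; rewrite trmx_mul trmxK hv trmx0.
Qed.

(** A null vector v gives the solution exp (s t) v, which decays at rate gamma
    only if Re s <= - gamma. *)
Lemma stable_det (theta : 'rV[R]_m) : exponentially_stable E A theta ->
  exists2 gamma : R, 0 < gamma & forall s : R[i], - gamma < complex.Re s ->
    \det (s *: E - delay_matrix A (delay_factors theta s)) != 0.
Proof.
move=> [K [gamma [g0 hK]]]; exists gamma => // s hs; apply/eqP => /det0_vector[v v0 hv].
pose S := sup [set frob (cexp (s * x%:C) *: v) | x in `[- max_delay theta, 0]].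
have [i vi] : exists i, v i 0 != 0.
  apply/existsP; move: v0; apply: contraNT; rewrite negb_exists => /forallP h.
  by apply/eqP/matrixP => i j; rewrite ord1 mxE; apply/eqP; rewrite -[_ == _]negbK h.
have fv : 0 < frob v by apply: lt_le_trans (frob_ge v i 0); rewrite nc_gt0.
have hb t : 0 <= t -> expR ((complex.Re s + gamma) * t) * frob v <= K * S.
  move=> t0; have := hK _ (exponential_solution hv) t t0.
  rewrite frob_scale nc_cexp cReMr -/S => h.
  rewrite mulrDl expRD -mulrA mulrCA -[leRHS]mul1r -[X in _ <= X * _](expRxMexpNx_1 (gamma * t)).
  by rewrite -mulrA ler_pM2l ?expR_gt0//; move: h; rewrite mulNr mulrCA mulrA.
pose a := complex.Re s + gamma.
have a0 : 0 < a by rewrite -ltrBlDr sub0r.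
(* At this time exp (a t) >= 1 + a t contradicts the decay estimate. *)
pose t := (`|K * S| + 1) / (a * frob v).
have t0 : 0 <= t by rewrite divr_ge0 ?addr_ge0// mulr_ge0// ltW.
have := hb t t0; rewrite -/a leNgt => /negP; apply.
apply: le_lt_trans (ler_norm _) _; apply: lt_le_trans (_ : (1 + a * t) * frob v <= _).
  have -> : (1 + a * t) * frob v = frob v + (`|K * S| + 1).
    by rewrite /t; field; rewrite !gt_eqF.
  by rewrite addrCA ltrDl addr_gt0.
by rewrite ler_pM2r// expR_ge1Dx.
Qed.

(** The conclusion of [hurwitz] in terms of the delay system. *)
Lemma hurwitz_delay (th : 'I_m -> R) z0 (r : R) :
  (forall j, 0 < th j) -> limit_det E A (fun _ => 0) != 0 -> limit_det E A z0 = 0 -> 0 < r ->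
  exists2 e : R, 0 < e & forall (s : R[i]) (theta : 'rV[R]_m),
    s != 0 -> nc s^-1 < e -> (forall j, `|theta 0 j - th j| < e) ->
    (forall j, nc (delay_factors theta s j - z0 j) < e) ->
    exists2 x, nc x <= r &
      \det ((s + x) *: E - delay_matrix A (delay_factors theta (s + x))) = 0.
Proof.
move=> th0 f0 fz0 r0; have [e e0 he] := hurwitz th0 f0 fz0 r0.
exists e => // s theta s0 h1 h2 h3.
have [x xr hx] := he s^-1 (fun j => theta 0 j) _ h1 h2 h3; exists x => //.
have si : s^-1 != 0 by rewrite invr_eq0.
have uE : s^-1 * (s + x) = 1 + s^-1 * x by rewrite mulrDr mulVf.
have zE : delay_factors theta (s + x) =
    fun j => delay_factors theta s j * cexp (- ((theta 0 j)%:C * x)).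
  by apply/funext => j; rewrite /delay_factors -cexpD; congr cexp; ring.
by apply: (pencil_singular si); rewrite uE zE; exact: hx.
Qed.

Lemma delay_factors_re_im (theta : 'rV[R]_m) (a b : R) j :
  delay_factors theta (a +i* b) j =
  cexp (- (a * theta 0 j))%:C * cexp (0 +i* (- (b * theta 0 j))).
Proof.
rewrite -cexpD; congr cexp; apply: complex_eqP.
  by rewrite cReN cReMr cReD /= addr0.
by rewrite cImN cImMr cImD /= add0r.
Qed.

(** A zero on the torus with parameter t would produce characteristic roots
    with real part close to t. For t > 0 the delays may depend on the
    frequency, since any root in the right half-plane contradicts stability.
    For t = 0 the delays have to be fixed first, as the decay rate depends on
    them; the required frequencies are then almost periods of these delays. *)
Lemma torus_nonvanishing (tau : 'I_m -> R) (d : R) :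
  (forall j, 0 < tau j) -> 0 < d ->
  (forall theta : 'rV[R]_m, (forall j, `|theta 0 j - tau j| < d) ->
     (forall j, 0 < theta 0 j) /\ exponentially_stable E A theta) ->
  limit_det E A (fun _ => 0) != 0 ->
  forall (t : R) (phi : 'I_m -> R), 0 <= t ->
    limit_det E A (fun j => cexp ((- (t * tau j)) +i* phi j)) != 0.
Proof.
move=> tau0 d0 hst f0 t phi t0; apply/eqP => fz.
pose z0 j : R[i] := cexp ((- (t * tau j)) +i* phi j).
have z0E j : z0 j = cexp (- (t * tau j))%:C * cexp (0 +i* phi j).
  by rewrite -cexpD; congr cexp; apply: complex_eqP; rewrite ?cReD ?cImD /= ?addr0 ?add0r.
have phase (w : R) : 0 < w -> exists theta : 'rV[R]_m, forall j,
    `|theta 0 j - tau j| <= 2 * pi / w /\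
    cexp (0 +i* (- (w * theta 0 j))) = cexp (0 +i* phi j).
  move=> w0; have /choice[th hth] : forall j, exists th : R, `|th - tau j| <= 2 * pi / w /\
     cexp (0 +i* (- (w * th))) = cexp (0 +i* phi j).
    by move=> j; exact: phase_choice.
  by exists (\row_j th j) => j; rewrite mxE.
have p0 : 0 < 2 * pi :> R by rewrite mulr_gt0 ?pi_gt0.
(* At frequency w the delays must move by at most 2 pi / w to have
   prescribed phases. *)
have close (w e : R) : 0 < e -> 2 * pi / e < w -> 2 * pi / w < e.
  move=> e0 h; have w0 : 0 < w := lt_trans (divr_gt0 p0 e0) h.
  by rewrite ltr_pdivrMr// [e * w]mulrC -ltr_pdivrMr.
have [t_eq|t_neq] := eqVneq t 0.
  (* The delays theta are fixed at frequency w0; adding an almost period T of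
     theta makes the frequency large. *)
  pose w0 := 2 * pi / d + 1.
  have w00 : 0 < w0 by rewrite addr_gt0// divr_gt0.
  have [theta hth] := phase w0 w00.
  have hbox j : `|theta 0 j - tau j| < d.
    have [h _] := hth j; apply: le_lt_trans h _; apply: close => //.
    by rewrite ltrDl.
  have [th0 st] := hst theta hbox.
  have [gamma g0 hg] := stable_det st.
  have g2 : 0 < gamma / 2 by rewrite divr_gt0.
  have [e e0 he] := hurwitz_delay th0 f0 fz g2.
  have [T [TW hT]] := almost_period (fun j => - theta 0 j) (1 / e + 1) e0.
  pose b := w0 + T.
  have b0 : 1 / e < b.
    apply: lt_le_trans (_ : 1 / e + 1 <= _); first by rewrite ltrDl.
    by apply: le_trans TW _; rewrite lerDr ltW.
  have be : 0 < b by apply: lt_trans b0; rewrite divr_gt0.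
  pose s : R[i] := 0 +i* b.
  have ns : nc s = b by rewrite ncE /= expr0n add0r sqrtr_sqr gtr0_norm.
  have s0 : s != 0 by rewrite -nc_gt0 ns.
  have hs : nc s^-1 < e.
    by rewrite ncV ns invf_plt ?posrE// -div1r.
  have hth' j : `|theta 0 j - theta 0 j| < e by rewrite subrr normr0.
  have hz j : nc (delay_factors theta s j - z0 j) < e.
    rewrite delay_factors_re_im z0E t_eq !mul0r oppr0 cexp0 !mul1r.
    have -> : 0 +i* (- (b * theta 0 j)) =
        (0 +i* (- (w0 * theta 0 j))) + (0 +i* (T * - theta 0 j)) :> R[i].
      by apply: complex_eqP; rewrite ?cReD ?cImD /= ?addr0// /b; ring.
    rewrite cexpD (hth j).2.
    rewrite (_ : _ - _ = cexp (0 +i* phi j) * (cexp (0 +i* (T * - theta 0 j)) - 1)).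
      by rewrite ncM nc_cis mul1r.
    by ring.
  have [x xr hx] := he s theta s0 hs hth' hz.
  have := hg (s + x); rewrite hx eqxx; case/(_ _)/negP => //.
  rewrite cReD /= add0r; have := ncRe x; rewrite ler_norml => /andP[h _].
  apply: lt_le_trans h; rewrite ltrN2; apply: le_lt_trans xr _.
  by rewrite ltr_pdivrMr// ltr_pMr// ltr1n.
have t_gt : 0 < t by rewrite lt_neqAle eq_sym t_neq.
have [e e0 he] := hurwitz_delay tau0 f0 fz t_gt.
(* The last bound keeps the moduli at theta close to those at tau. *)
pose e1 := Num.min e (Num.min d (Num.min 1 (e / (2 * expR 1)) / t)).
have K0 : 0 < 2 * expR 1 :> R by rewrite mulr_gt0 ?expR_gt0.
have e10 : 0 < e1 by rewrite !lt_min e0 d0 divr_gt0// lt_min ltr01 divr_gt0.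
have e1e : e1 <= e by rewrite ge_min lexx.
have e1d : e1 <= d by rewrite !ge_min lexx !orbT.
have e1t : e1 <= Num.min 1 (e / (2 * expR 1)) / t by rewrite !ge_min lexx !orbT.
pose w0 := 2 * pi / e1 + 1 / e + 1.
have w01 : 2 * pi / e1 < w0 by rewrite /w0 -addrA ltrDl addr_gt0// divr_gt0.
have w02 : 1 / e < w0 by rewrite /w0 addrAC ltrDr addr_gt0// divr_gt0.
have w00 : 0 < w0 by apply: lt_trans w02; rewrite divr_gt0.
have [theta hth] := phase w0 w00.
have hclose j : `|theta 0 j - tau j| < e1.
  by have [h _] := hth j; apply: le_lt_trans h _; exact: close.
have [th0 st] := hst theta (fun j => lt_le_trans (hclose j) e1d).
have [gamma g0 hg] := stable_det st.
pose s : R[i] := t +i* w0.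
have ns : w0 <= nc s by have := ncIm s; rewrite /= gtr0_norm.
have s0 : s != 0 by rewrite -nc_gt0; apply: lt_le_trans ns.
have hs : nc s^-1 < e.
  rewrite ncV invf_plt ?posrE//; last by apply: lt_le_trans ns.
  by rewrite -div1r; apply: lt_le_trans ns.
have hz j : nc (delay_factors theta s j - z0 j) < e.
  rewrite delay_factors_re_im z0E (hth j).2 -mulrBl ncM nc_cis mulr1.
  pose h : R[i] := (- (t * (theta 0 j - tau j)))%:C.
  have -> : (- (t * theta 0 j))%:C = (- (t * tau j))%:C + h :> R[i].
    by rewrite -rmorphD /=; congr (_%:C); ring.
  have nh : nc h < Num.min 1 (e / (2 * expR 1)).
    rewrite nc_real normrN normrM (gtr0_norm t_gt) mulrC -ltr_pdivlMr//.
    exact: lt_le_trans (hclose j) e1t.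
  move: nh; rewrite lt_min => /andP[nh1 nh2].
  rewrite cexpD -{2}[cexp (- (t * tau j))%:C]mulr1 -mulrBr ncM nc_cexp /=.
  apply: le_lt_trans (_ : nc (cexp h - 1) < e).
    by rewrite ler_piMl ?nc_ge0// expR_le1 oppr_le0 mulr_ge0// ltW.
  have := nc_cexpB 0 (ltW nh1); rewrite add0r cexp0 nc0 expR0 mul1r => /le_lt_trans; apply.
  by rewrite mulrC -ltr_pdivlMr.
have [x xr hx] := he s theta s0 hs (fun j => lt_le_trans (hclose j) e1e) hz.
have := hg (s + x); rewrite hx eqxx; case/(_ _)/negP => //.
rewrite cReD /=; have := ncRe x; rewrite ler_norml => /andP[h _].
apply: lt_le_trans (_ : 0 <= _); first by rewrite oppr_lt0.
by rewrite -lerBlDl sub0r (le_trans _ h)// lerN2.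
Qed.

End Stability.

(** * Finite energy of the transfer function *)

Section Infinite_energy.
Variable R : realType.

(** The integral is a supremum over simple functions below h, and c times the
    indicator of S is one of them. *)
Lemma integral_ge_cst d (T : measurableType d) (mu : {measure set T -> \bar R})
    (h : T -> R) (c : R) (S : set T) : (forall x, 0 <= h x) -> 0 <= c ->
  measurable S -> (forall x, S x -> c <= h x) ->
  (c%:E * mu S <= \int[mu]_x (h x)%:E)%E.
Proof.
move=> h0 c0 mS hc; rewrite ge0_integralTE; last by move=> x; rewrite lee_fin.
apply: ereal_sup_ubound; exists (scale_nnsfun (indic_nnsfun R mS) c0).
  move=> x; rewrite lee_fin; change (c * \1_S x <= h x); rewrite indicE.
  case: (boolP (x \in S)) => xS; rewrite ?mulr1 ?mulr0//.
  by apply: hc; rewrite inE in xS.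
have := sintegralrM mu c (indic_nnsfun R mS); rewrite /= => ->.
by rewrite sintegral_indic.
Qed.

Local Notation mu := (@lebesgue_measure R).

Lemma recurrent_integral (h : R -> R) (c eta : R) : (forall x, 0 <= h x) ->
  0 < c -> 0 < eta ->
  (forall W : R, exists2 T : R, W <= T & forall x : R, T <= x <= T + eta -> c <= h x) ->
  (\int[mu]_x (h x)%:E = +oo)%E.
Proof.
move=> h0 c0 e0 hT.
(* Accumulate N disjoint intervals of length eta on which h >= c, each to
   the right of the previous ones. *)
have hN (N : nat) : exists (S : set R) (M : R), [/\ measurable S,
    forall x, S x -> x < M, mu S = (N%:R * eta)%:E & forall x, S x -> c <= h x].
  elim: N => [|N [S [M [mS SM muS Sc]]]].
    by exists set0, 0; split=> //; rewrite measure0 mul0r.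
  have [T MT Tc] := hT M.
  exists (S `|` `[T, T + eta]), (T + eta + 1); split.
  - exact: measurableU.
  - move=> x [/SM xM|/=]; first by apply: lt_le_trans xM _; move: MT e0; clear; lra.
    by rewrite in_itv /= => /andP[_ xT]; apply: le_lt_trans xT _; rewrite ltrDl.
  - have mI : mu `[T, T + eta]%classic = eta%:E.
      by rewrite lebesgue_measure_itv /= lte_fin ltrDl e0 -EFinB addrAC subrr add0r.
    transitivity (mu S + mu `[T, (T + eta)%R]%classic)%E.
      apply: measureU => //.
      apply/seteqP; split => // x [/SM xM]; rewrite /= in_itv /= => /andP[Tx _].
      by have := lt_le_trans xM (le_trans MT Tx); rewrite ltxx.
    by rewrite mI muS -EFinD -natr1; congr (_%:E); ring.
  - by move=> x [/Sc//|]; rewrite /= in_itv /= => hx; exact: Tc.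
apply: eq_infty => t.
pose N := (Num.truncn (`|t| / (c * eta))).+1.
have [S [M [mS _ muS Sc]]] := hN N.
have hI : (c%:E * mu S <= \int[mu]_x (h x)%:E)%E :=
  @integral_ge_cst _ _ mu h c S h0 (ltW c0) mS Sc.
rewrite muS in hI; apply: le_trans hI.
rewrite -EFinM lee_fin; apply: le_trans (ler_norm _) _.
rewrite mulrCA -ler_pdivrMr ?mulr_gt0//.
exact/ltW/truncnS_gt.
Qed.

End Infinite_energy.

Section H2_norm.
Variables (R : realType) (n p q m : nat) (E : 'M[R[i]]_n) (A : 'I_m.+1 -> 'M[R[i]]_n).
Variables (B : 'M[R[i]]_(n, p)) (C : 'M[R[i]]_(q, n)).

(** If the suprema over all balls were infinite, so would be their limit. *)
Lemma strong_H2_norm_fin (tau : 'rV[R]_m) : (strong_H2_norm E A B C tau < +oo)%E ->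
  exists2 d : R, 0 < d & forall theta, delay_ball tau d theta ->
    (H2_norm E A B C theta < +oo)%E.
Proof.
move=> h; apply: contrapT => hn.
pose F (d : R) := ereal_sup [set H2_norm E A B C theta | theta in delay_ball tau d].
have Foo d : 0 < d -> F d = +oo%E.
  move=> d0; apply: contrapT => Fd; apply: hn; exists d => // theta th.
  apply: le_lt_trans (_ : (F d < +oo)%E).
    by apply: ereal_sup_ubound; exists theta.
  by rewrite ltey; apply/eqP.
move: h; rewrite /strong_H2_norm -/F.
have -> : lim (F @ 0^'+) = +oo%E; last by rewrite ltxx.
apply/cvg_lim => //; apply: cvg_near_cst.
by near=> d; apply: Foo; near: d; exact: nbhs_right_gt.
Unshelve. all: by end_near. Qed.

Lemma H2_norm_fin (theta : 'rV[R]_m) : (H2_norm E A B C theta < +oo)%E ->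
  exponentially_stable E A theta /\
  (\int[lebesgue_measure]_w (frob (transfer E A B C theta (1 +i* w)) ^+ 2)%:E != +oo)%E.
Proof.
rewrite /H2_norm; case: asboolP => // st h; split=> //.
apply/eqP => hoo; move: h; apply/negP; rewrite -leNgt.
apply: ereal_sup_ubound; exists 1; first by rewrite /= in_itv /= andbT.
rewrite hoo gt0_muley//.
by rewrite lte_fin invr_gt0 mulr_gt0 ?pi_gt0.
Qed.

(** Cramer's rule, with the scaling by 1 / s absorbed in the pencil. *)
Lemma transfer_cramer (theta : 'rV[R]_m) (s : R[i]) : s != 0 ->
  \det (s *: E - delay_matrix A (delay_factors theta s)) != 0 ->
  \det (pencil E A 1 s^-1 (delay_factors theta s)) *: transfer E A B C theta s =
  transfer_numerator E A B C 1 s^-1 (delay_factors theta s).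
Proof.
move=> s0 d0; rewrite /transfer sum_delaysE.
set z := delay_factors theta s; set M := s *: E - delay_matrix A z.
have Mu : M \in unitmx by rewrite unitmxE unitfE.
set K := pencil E A 1 s^-1 z.
have KE : K = balance E s^-1 *m invmx (col_ebase E) *m M *m invmx (row_ebase E).
  by rewrite -pencilE mulVf.
have Wu : row_ebase E \in unitmx := row_ebase_unit E.
set D := balance E s^-1 *m invmx (col_ebase E) in KE *.
have h1 : \adj K *m D *m M = \det K *: row_ebase E.
  have := mul_adj_mx K; rewrite {2}KE !mulmxA => /(congr1 (fun X => X *m row_ebase E)).
  by rewrite mulmxKV// mul_scalar_mx.
have h2 : \adj K *m D = \det K *: (row_ebase E *m invmx M).
  by rewrite scalemxAl -h1 mulmxK.
rewrite /transfer_numerator -/K -/D -[_ *m \adj K *m D]mulmxA h2.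
by rewrite -scalemxAr !mulmxA mulmxKV// -!scalemxAl.
Qed.

Lemma ulim_transfer_numerator (T Z : Type) (F : set_system T) (D : set Z) {FF : Filter F}
    (sg : T -> Z -> R[i]) (sg0 : Z -> R[i])
    (z : 'I_m -> T -> Z -> R[i]) (z0 : 'I_m -> Z -> R[i]) :
  ulim F D sg sg0 -> (forall j, ulim F D (z j) (z0 j)) ->
  ulim_mx F D (fun t x => transfer_numerator E A B C 1 (sg t x) (fun j => z j t x))
              (fun x => transfer_numerator E A B C 1 (sg0 x) (fun j => z0 j x)).
Proof.
move=> hsg hz; apply: ulim_mulmx; last exact: ulim_mx_cst.
apply: ulim_mulmx.
  apply: ulim_mulmx; first exact: ulim_mx_cst.
  by apply: ulim_adj; apply: ulim_pencil => //; exact: ulim_cst1.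
apply: ulim_mulmx; last exact: ulim_mx_cst.
apply: ulim_addmx; last exact: ulim_mx_cst.
by apply: ulim_scalemx => //; exact: ulim_mx_cst.
Qed.

(** At the almost periods of the delays the exponential factors return to
    their values at s = 1, while 1 / s tends to 0. So the transfer function
    returns close to its limit, with nonzero numerator and bounded
    denominator, on intervals of fixed length, and its energy on the line Re s
    = 1 is infinite. *)
Lemma transfer_numerator_zero (theta : 'rV[R]_m) : (forall j, 0 < theta 0 j) ->
  (H2_norm E A B C theta < +oo)%E ->
  transfer_numerator E A B C 1 0 (delay_factors theta 1) = 0.
Proof.
move=> th0 /H2_norm_fin[st hoo]; apply/matrixP => a b; rewrite [in RHS]mxE.
apply/eqP/negPn/negP => nz; move/eqP: hoo; apply.
set z1 := delay_factors theta 1 in nz.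
have [gamma g0 hg] := stable_det st.
(* An arbitrary base point for the delays; the limits are those sg -> 0 and
   z -> z1. *)
pose th (j : 'I_m) : R := 0.
have FF := near_param_filter th z1.
have us : ulim (near_param th z1) [set: unit] (fun p _ => p.1.1) (fun=> 0).
  split; first by exists 0 => x _; rewrite nc0.
  by move=> e e0; exists e => // p' h _ _ x _; rewrite subr0.
have uz j : ulim (near_param th z1) [set: unit] (fun p _ => p.2 j) (fun=> z1 j).
  split; first by exists (nc (z1 j)).
  by move=> e e0; exists e => // p' _ _ h x _.
have un := ulim_transfer_numerator us uz a b.
have ud : ulim (near_param th z1) [set: unit]
   (fun p _ => \det (pencil E A 1 p.1.1 p.2)) (fun=> \det (pencil E A 1 0 z1)).
  by apply: ulim_det; apply: ulim_pencil => //; exact: ulim_cst1.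
pose c := nc (transfer_numerator E A B C 1 0 z1 a b) / 2.
have c0 : 0 < c by rewrite divr_gt0// nc_gt0.
pose M := nc (\det (pencil E A 1 0 z1)) + 1.
have M0 : 0 < M by rewrite ltr_wpDl// nc_ge0.
have [_ /(_ _ c0) [e1 e10 he1]] := un.
have [_ /(_ _ ltr01) [e2 e20 he2]] := ud.
pose e := Num.min e1 e2.
have e0 : 0 < e by rewrite lt_min e10.
(* Close to the limit, the numerator keeps at least half of its modulus and
   the denominator is at most M. *)
have key (s : R[i]) : complex.Re s = 1 -> nc s^-1 < e ->
    (forall j, nc (delay_factors theta s j - z1 j) < e) ->
    c / M <= frob (transfer E A B C theta s).
  move=> s1 hs hz.
  have s0 : s != 0 by apply/eqP => s0; move: s1; rewrite s0 /= => /eqP; rewrite eq_sym oner_eq0.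
  have hd : \det (s *: E - delay_matrix A (delay_factors theta s)) != 0.
    by apply: hg; rewrite s1 (lt_trans _ ltr01)// oppr_lt0.
  have tn := transfer_cramer s0 hd.
  set z := delay_factors theta s in hz tn *.
  have thth (e' : R) : 0 < e' -> forall j, `|th j - th j| < e' by move=> ? j; rewrite subrr normr0.
  have lt1 x : x < e -> x < e1 by rewrite lt_min => /andP[].
  have lt2 x : x < e -> x < e2 by rewrite lt_min => /andP[].
  have h1 := he1 (s^-1, th, z) (lt1 _ hs) (thth _ e10) (fun j => lt1 _ (hz j)) tt I.
  have h2 := he2 (s^-1, th, z) (lt2 _ hs) (thth _ e20) (fun j => lt2 _ (hz j)) tt I.
  rewrite /= in h1 h2.
  apply: le_trans (frob_ge _ a b).
  have := congr1 (fun X : 'M[R[i]]_(q, p) => nc (X a b)) tn; rewrite mxE ncM => tn'.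
  rewrite ler_pdivrMr//.
  have n1 : c <= nc (transfer_numerator E A B C 1 s^-1 z a b).
    have := ncB (transfer_numerator E A B C 1 s^-1 z a b) (transfer_numerator E A B C 1 s^-1 z a b - transfer_numerator E A B C 1 0 z1 a b).
    have cc : nc (transfer_numerator E A B C 1 0 z1 a b) = c + c by exact: splitr.
    rewrite subKr => h; rewrite -(lerD2r c).
    rewrite -cc.
    by apply: le_trans h _; rewrite lerD2l ltW.
  apply: le_trans n1 _; rewrite -tn' mulrC ler_wpM2l ?nc_ge0//.
  have := ncD (\det (pencil E A 1 s^-1 z) - \det (pencil E A 1 0 z1)) (\det (pencil E A 1 0 z1)).
  rewrite subrK => h; apply: le_trans h _; rewrite /M addrC lerD2l; exact: ltW.
(* On an interval of length eta the factors rotate by little for every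
   delay. *)
pose big : R := \sum_j `|theta 0 j| + 1.
have big0 : 0 < big by rewrite ltr_wpDl// sumr_ge0.
have bigj j : `|theta 0 j| <= big.
  rewrite /big (bigD1 j)//= -addrA lerDl addr_ge0// sumr_ge0//.
have K0 : 0 < 2 * expR 1 :> R by rewrite mulr_gt0 ?expR_gt0.
pose eta := Num.min 1 (e / 2 / (2 * expR 1)) / big.
have eta0 : 0 < eta by rewrite divr_gt0// lt_min ltr01 !divr_gt0.
apply: (@recurrent_integral R _ ((c / M) ^+ 2) eta) => //.
- by move=> w; exact: sqr_ge0.
- by rewrite exprn_gt0// divr_gt0.
move=> W.
have e2' : 0 < e / 2 by rewrite divr_gt0.
have [T [WT hT]] := almost_period (fun j => - theta 0 j) (Num.max W (1 / e + 1)) e2'.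
exists T; first by apply: le_trans WT; rewrite le_max lexx.
have Te : 1 / e < T.
  by apply: lt_le_trans WT; rewrite lt_max ltrDl ltr01 orbT.
have T0 : 0 < T by apply: lt_trans Te; rewrite divr_gt0.
move=> w /andP[Tw wT].
have w0 : 0 < w := lt_le_trans T0 Tw.
apply: lerXn2r; [exact: ltW (divr_gt0 c0 M0)|exact: sqrtr_ge0|].
apply: key => //.
  have nw : w <= nc (1 +i* w) by have := ncIm (1 +i* w); rewrite /= gtr0_norm.
  rewrite ncV invf_plt ?posrE//; last exact: lt_le_trans nw.
  by rewrite -div1r; apply: lt_le_trans nw; apply: lt_le_trans Tw.
move=> j.
have -> : z1 j = cexp (- (1 * theta 0 j))%:C.
  by rewrite /z1 /delay_factors mul1r mul1r rmorphN.
rewrite delay_factors_re_im.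
pose h := (w - T) * - theta 0 j.
have -> : 0 +i* (- (w * theta 0 j)) = (0 +i* (T * - theta 0 j)) + (0 +i* h) :> R[i].
  by apply: complex_eqP; rewrite ?cReD ?cImD /= ?addr0// /h; ring.
rewrite -{2}[cexp (- _)%:C]mulr1 -mulrBr ncM nc_cexp /=.
apply: le_lt_trans (_ : nc (cexp ((0 +i* (T * - theta 0 j)) + (0 +i* h)) - 1) < e).
  by rewrite ler_piMl ?nc_ge0// expR_le1 oppr_le0 mul1r ltW.
rewrite cexpD.
have -> : cexp (0 +i* (T * - theta 0 j)) * cexp (0 +i* h) - 1 =
  (cexp (0 +i* (T * - theta 0 j)) - 1) * cexp (0 +i* h) + (cexp (0 +i* h) - 1) by ring.
apply: le_lt_trans (ncD _ _) _; rewrite ncM nc_cis mulr1 [e]splitr.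
apply: ltr_leD; first exact: hT.
have hb : `|h| <= Num.min 1 (e / 2 / (2 * expR 1)).
  rewrite /h normrM normrN ger0_norm ?subr_ge0//.
  apply: le_trans (_ : eta * big <= _); last by rewrite /eta mulfVK// gt_eqF.
  by apply: ler_pM => //; rewrite ?subr_ge0// lerBlDl.
move: hb; rewrite le_min => /andP[hb1 hb2].
apply: le_trans (cisB1 hb1) _.
by rewrite mulrC -ler_pdivlMr.
Qed.

End H2_norm.

(** * The two facts on the closed polydisc *)

Section Closed_polydisc.
Variables (R : realType) (n p q m : nat) (E : 'M[R[i]]_n) (A : 'I_m.+1 -> 'M[R[i]]_n).
Variables (B : 'M[R[i]]_(n, p)) (C : 'M[R[i]]_(q, n)).

Lemma box_in_ball (tau : 'rV[R]_m) (d : R) : (forall j, 0 < tau 0 j) -> 0 < d ->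
  exists2 e : R, 0 < e & forall theta : 'rV[R]_m,
    (forall j, `|theta 0 j - tau 0 j| < e) ->
    (forall j, 0 < theta 0 j) /\ delay_ball tau d theta.
Proof.
move=> tau0 d0.
(* The inverse of s is a positive lower bound of all delays. *)
pose s : R := \sum_j (tau 0 j)^-1 + 1.
have s0 : 0 < s by rewrite ltr_wpDl// sumr_ge0// => j _; rewrite invr_ge0 ltW.
have stau j : s^-1 <= tau 0 j.
  rewrite -[leRHS]invrK lef_pV2 ?posrE ?invr_gt0// /s (bigD1 j)//= -addrA lerDl addr_ge0//.
  by apply: sumr_ge0 => k _; rewrite invr_ge0 ltW.
pose e := Num.min s^-1 (d / m.+1%:R).
have m0 : 0 < m.+1%:R :> R by rewrite ltr0n.
have e0 : 0 < e by rewrite lt_min invr_gt0 s0 divr_gt0.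
exists e => // theta h.
have pos j : 0 < theta 0 j.
  have := h j; rewrite lt_min => /andP[h1 _].
  have := lt_le_trans h1 (stau j); rewrite ltr_norml => /andP[h2 _].
  by rewrite -(ltrD2r (- tau 0 j)) sub0r.
split=> //; split; first by move=> j; exact: ltW.
rewrite -[d]gtr0_norm// -sqrtr_sqr ltr_sqrt ?exprn_gt0//.
apply: le_lt_trans (_ : \sum_(j < m) (d / m.+1%:R) ^+ 2 < _).
  apply: ler_sum => j _; rewrite -real_normK ?num_real//.
  have := h j; rewrite lt_min => /andP[_ h2].
  by apply: lerXn2r; [rewrite nnegrE|exact: ltW (divr_gt0 d0 m0)|exact: ltW].
rewrite sumr_const card_ord expr_div_n -mulrnAr gtr_pMr ?exprn_gt0//.
rewrite -mulr_natl ltr_pdivrMr ?exprn_gt0// mul1r expr2 -natrM ltr_nat.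
by rewrite (leq_trans (ltnSn m))// leq_pmulr.
Qed.

Lemma exp_interval_infinite (tau e : R) (P : {poly R[i]}) : 0 < e ->
  (forall t : R, `|t - tau| < e -> P.[cexp (- (1 * t%:C))] = 0) -> P = 0.
Proof.
move=> e0 hP; apply/eqP; apply: contraT => P0.
(* Points of the interval with distinct exponentials; the first size P of
   them are more than the roots P can have. *)
pose pt (k : nat) : R := tau + e / 2 / k.+1%:R.
pose rs := [seq cexp (- (1 * (pt k)%:C)) | k <- iota 0 (size P)].
have : (size rs < size P)%N.
  apply: max_poly_roots => //.
    apply/allP => _ /mapP[k _ ->]; apply/rootP; apply: hP.
    have k0 : 0 < k.+1%:R :> R by rewrite ltr0n.
    rewrite /pt addrC addKr gtr0_norm ?divr_gt0//.
    apply: le_lt_trans (_ : e / 2 < _); last by rewrite ltr_pdivrMr// ltr_pMr// ltr1n.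
    by rewrite ler_pdivrMr// ler_peMr ?ler1n// ltW// divr_gt0.
  rewrite map_inj_uniq ?iota_uniq// => k l /(congr1 (fun z => nc z)).
  rewrite !nc_cexp !mul1r /= => /expR_inj/oppr_inj/addrI.
  have e2 : e / 2 != 0 by rewrite gt_eqF// divr_gt0.
  move/(mulfI e2)/invr_inj/eqP.
  by rewrite eqr_nat eqSS => /eqP.
by rewrite size_map size_iota ltnn.
Qed.

Variable tau : 'rV[R]_m.
Hypothesis tau0 : forall j, 0 < tau 0 j.
Hypothesis hindex : semi_explicit_index1 E A.
Hypothesis hH2 : (strong_H2_norm E A B C tau < +oo)%E.

(** Since the norm is infinite for systems that are not exponentially stable,
    its finiteness gives stability for all delays in a box around tau. *)
Lemma limit_det_nonzero z : unit_polydisc z -> limit_det E A z != 0.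
Proof.
have [d d0 hd] := strong_H2_norm_fin hH2.
have [e e0 he] := box_in_ball tau0 d0.
have f0 := index1_det hindex.
have cont : ucontinuous (limit_det E A) by move=> T Z F D FF z1 z2; exact: ulim_limit_det.
have st (theta : 'rV[R]_m) : (forall j, `|theta 0 j - tau 0 j| < e) ->
    (forall j, 0 < theta 0 j) /\ exponentially_stable E A theta.
  by move=> /he[h1 h2]; split=> //; have [] := H2_norm_fin (hd theta h2).
exact: (nonvanishing (limit_det_separately_poly E A) cont tau0 f0
  (torus_nonvanishing tau0 e0 st f0)).
Qed.

(** Delays in a box give a product of infinite sets of exponential factors. *)
Lemma transfer_numerator_eq0 z : transfer_numerator E A B C 1 0 z = 0.
Proof.
have [d d0 hd] := strong_H2_norm_fin hH2.
have [e e0 he] := box_in_ball tau0 d0.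
apply/matrixP => a b; rewrite [RHS]mxE.
apply: (@vanish_on_product R m (fun z => transfer_numerator E A B C 1 0 z a b)
  (fun j => [set w | exists2 t : R, `|t - tau 0 j| < e & w = cexp (- (1 * t%:C))])).
- exact: transfer_numerator_separately_poly.
- move=> j P hP; apply: (@exp_interval_infinite (tau 0 j) e) => // t ht.
  by apply: hP; exists t.
move=> w hw.
have /choice[th hth] : forall j, exists t : R, `|t - tau 0 j| < e /\ w j = cexp (- (1 * t%:C)).
  by move=> j; have [t h1 h2] := hw j; exists t.
have -> : w = delay_factors (\row_j th j) 1.
  by apply/funext => j; rewrite /delay_factors mxE (hth j).2.
have [h1 h2] : (forall j, 0 < (\row_j th j) 0 j) /\ delay_ball tau d (\row_j th j).
  by apply: he => j; rewrite mxE; exact: (hth j).1.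
by rewrite (transfer_numerator_zero h1 (hd _ h2)) mxE.
Qed.

Lemma algebraic_part_injective z (x y : 'cV[R[i]]_n) : unit_polydisc z ->
  E *m x = 0 -> delay_matrix A z *m x = E *m y -> x = 0.
Proof.
move=> hz Ex Ay; have Ay' : delay_matrix A z *m x + 0 = E *m y by rewrite addr0.
have := pencil_nonsingular_solution 1%:M (limit_det_nonzero hz) Ex Ay'.
by rewrite mul1mx mulmx0 scaler0.
Qed.

Lemma algebraic_part_output z (x y : 'cV[R[i]]_n) (v : 'cV[R[i]]_p) : unit_polydisc z ->
  E *m x = 0 -> delay_matrix A z *m x + B *m v = E *m y -> C *m x = 0.
Proof.
move=> hz Ex Ay; rewrite (pencil_nonsingular_solution C (limit_det_nonzero hz) Ex Ay).
have := transfer_numerator_eq0 z; rewrite /transfer_numerator => h.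
by rewrite mulmxA h mul0mx scaler0.
Qed.

End Closed_polydisc.

(** * Orthogonal polynomials *)

Section Inner_product.
Variables (R : realType) (mu : {finite_measure set (measurableTypeR R) -> \bar R}) (h : R).
Implicit Types (P Q f g : {poly R[i]}).

(** Real and imaginary parts of Q on the real line are real polynomials, hence
    continuous and integrable on the interval. *)
Definition Re_poly Q : {poly R} := \poly_(i < size Q) complex.Re Q`_i.
Definition Im_poly Q : {poly R} := \poly_(i < size Q) complex.Im Q`_i.

Lemma Re_polyE Q (t : R) : complex.Re Q.[t%:C] = (Re_poly Q).[t].
Proof.
rewrite horner_poly horner_coef cRe_sum; apply: eq_bigr => i _.
by rewrite -rmorphXn cReMr.
Qed.

Lemma Im_polyE Q (t : R) : complex.Im Q.[t%:C] = (Im_poly Q).[t].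
Proof.
rewrite horner_poly horner_coef cIm_sum; apply: eq_bigr => i _.
by rewrite -rmorphXn cImMr.
Qed.

Lemma horner_integrable (r : {poly R}) :
  mu.-integrable `[- h, 0]%classic (EFin \o (fun t : measurableTypeR R => r.[t])).
Proof.
apply: measurable_bounded_integrable.
- exact: measurable_itv.
- by rewrite ltey_eq fin_num_measure//; exact: measurable_itv.
- apply: measurable_funTS; apply: continuous_measurable_fun.
  exact: continuous_horner.
- have cr : {within `[- h, 0]%classic, continuous (horner r)}.
    by apply: continuous_subspaceT => t; exact: continuous_horner.
  have /compact_bounded[M [_ Mr]] := continuous_compact cr (@segment_compact _ _ _).
  by exists M; split; rewrite ?num_real // => ? ? ? ?; exact: Mr.
Qed.

(** The sesquilinear form as a linear functional of the product of f with the
    conjugate polynomial of g, which turns linearity in f into linearity of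
    the integral. *)
Definition cintegral Q : R[i] :=
  (\int[mu]_(t in `[- h, 0]) complex.Re Q.[t%:C]) +i*
  (\int[mu]_(t in `[- h, 0]) complex.Im Q.[t%:C]).

Lemma cintegralD P Q : cintegral (P + Q) = cintegral P + cintegral Q.
Proof.
have iP := horner_integrable (Re_poly P); have iQ := horner_integrable (Re_poly Q).
have jP := horner_integrable (Im_poly P); have jQ := horner_integrable (Im_poly Q).
have mD : measurable (`[- h, 0]%classic : set (measurableTypeR R)) by exact: measurable_itv.
apply: complex_eqP; rewrite ?cReD ?cImD /=.
- under eq_Rintegral do rewrite hornerD cReD !Re_polyE.
  rewrite (RintegralD mD iP iQ).
  by congr (_ + _); apply: eq_Rintegral => t _; rewrite Re_polyE.
- under eq_Rintegral do rewrite hornerD cImD !Im_polyE.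
  rewrite (RintegralD mD jP jQ).
  by congr (_ + _); apply: eq_Rintegral => t _; rewrite Im_polyE.
Qed.

Lemma cintegralZ (c : R[i]) P : cintegral (c *: P) = c * cintegral P.
Proof.
have iP := horner_integrable (Re_poly P); have jP := horner_integrable (Im_poly P).
have mD : measurable (`[- h, 0]%classic : set (measurableTypeR R)) by exact: measurable_itv.
have iZ (k : R) (r : {poly R}) : mu.-integrable `[- h, 0]%classic
    (EFin \o (fun t : measurableTypeR R => k * r.[t])).
  have := horner_integrable (k *: r).
  by congr (integrable _ _ (EFin \o _)); apply/funext => t; rewrite hornerZ.
apply: complex_eqP; rewrite ?cReM ?cImM /=.
- under eq_Rintegral do rewrite hornerZ cReM Re_polyE Im_polyE.
  rewrite (RintegralB mD (iZ _ _) (iZ _ _)) (RintegralZl _ mD iP) (RintegralZl _ mD jP).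
  by congr (_ * _ - _ * _); apply: eq_Rintegral => t _; rewrite ?Re_polyE ?Im_polyE.
- under eq_Rintegral do rewrite hornerZ cImM Re_polyE Im_polyE.
  rewrite (RintegralD mD (iZ _ _) (iZ _ _)) (RintegralZl _ mD iP) (RintegralZl _ mD jP).
  by congr (_ * _ + _ * _); apply: eq_Rintegral => t _; rewrite ?Re_polyE ?Im_polyE.
Qed.

Definition conj_poly g : {poly R[i]} := map_poly (@Num.conj R[i]) g.

Lemma conj_real (t : R) : Num.conj (t%:C : R[i]) = t%:C.
Proof. by apply/eqP; rewrite eq_complex /= oppr0 !eqxx. Qed.

Lemma conj_polyE g (t : R) : Num.conj g.[t%:C] = (conj_poly g).[t%:C].
Proof.
by rewrite /conj_poly -{2}conj_real horner_map.
Qed.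

Lemma innerE f g : inner mu h f g = cintegral (f * conj_poly g).
Proof.
rewrite /inner /cintegral; congr (_ +i* _); apply: eq_Rintegral => t _;
by rewrite conj_polyE hornerM.
Qed.

Lemma innerDl f1 f2 g : inner mu h (f1 + f2) g = inner mu h f1 g + inner mu h f2 g.
Proof. by rewrite !innerE mulrDl cintegralD. Qed.

Lemma innerZl c f g : inner mu h (c *: f) g = c * inner mu h f g.
Proof. by rewrite !innerE -scalerAl cintegralZ. Qed.

(** A positive value at a point of the support inside the interval would give
    positive mass times a positive bound. Endpoints are excluded because a
    neighborhood of an endpoint may carry its mass outside the interval. *)
Lemma zero_on_support (r : {poly R}) (x : R) :
  (forall t, - h <= t <= 0 -> 0 <= r.[t]) ->
  \int[mu]_(t in `[- h, 0]) r.[t] = 0 ->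
  msupport mu x -> - h < x < 0 -> r.[x] = 0.
Proof.
move=> r0 ir xs /andP[hx x0]; apply/eqP/negPn/negP => rx.
have rx0 : 0 < r.[x] by rewrite lt_neqAle eq_sym rx r0// !ltW.
have r2 : 0 < r.[x] / 2 by rewrite divr_gt0.
have /cvgrPdist_lt/(_ _ r2) : {for x, continuous (horner r)} by exact: continuous_horner.
move=> /nbhs_ballP[d /= d0 hd].
(* Small enough for the interval of radius e around x to stay inside [- h,
   0]. *)
pose e := Num.min d (Num.min (x + h) (- x)).
have e0 : 0 < e by rewrite !lt_min d0 -ltrBlDr sub0r hx oppr_gt0.
have ed : e <= d by rewrite ge_min lexx.
have ex1 : e <= x + h by rewrite !ge_min lexx !orbT.
have ex2 : e <= - x by rewrite !ge_min lexx !orbT.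
have muI := xs e e0.
set I := `](x - e), (x + e)[%classic in muI.
have ID t : I t -> - h <= t <= 0.
  rewrite /I /= in_itv /= => /andP[t1 t2]; apply/andP; split.
    by apply: ltW; apply: le_lt_trans t1; rewrite lerBrDr addrC lerBlDr.
  by apply: ltW; apply: lt_le_trans t2 _; rewrite -lerBrDl sub0r.
have Ir t : I t -> r.[x] / 2 <= r.[t].
  rewrite /I /= in_itv /= => /andP[t1 t2].
  have : ball x d t.
    rewrite /ball /= distrC ltr_norml; apply/andP; split.
      by rewrite ltrBrDr addrC; apply: le_lt_trans t1; rewrite lerD2l lerN2.
    by rewrite ltrBlDl; apply: lt_le_trans t2 _; rewrite lerD2l.
  move=> /hd /= H; have := ler_norm (r.[x] - r.[t]); move: H; clear; lra.
pose g (t : R) : R := if t \in `[- h, 0]%classic then r.[t] else 0.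
have g0 t : 0 <= g t.
  by rewrite /g; case: ifPn => //; rewrite inE /= in_itv /= => /r0.
have mI : measurable (I : set (measurableTypeR R)) by exact: measurable_itv.
have gI t : I t -> r.[x] / 2 <= g t.
  move=> It; rewrite /g ifT; first exact: Ir.
  by rewrite inE /= in_itv /=; exact: ID.
have iE : (\int[mu]_(t in `[(- h)%R, 0%R]) (r.[t])%:E = \int[mu]_t (g t)%:E)%E.
  rewrite integral_mkcond; apply: eq_integral => t _.
  by rewrite /g /patch; case: ifP.
have ig0 : (\int[mu]_t (g t)%:E = 0)%E.
  rewrite -iE -[LHS]fineK; first by move: ir; rewrite /Rintegral => ->.
  by apply: integrable_fin_num; [exact: measurable_itv|exact: horner_integrable].
have := @integral_ge_cst R _ (measurableTypeR R) mu g (r.[x] / 2) I g0 (ltW r2) mI gI.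
by rewrite ig0 leNgt mule_gt0// lte_fin.
Qed.

Hypothesis hmu_sub : msupport mu `<=` `[- h, 0].
Hypothesis hmu_inf : infinite_set (msupport mu).

Lemma support_nonroot P : P != 0 ->
  exists x : R, [/\ msupport mu x, - h < x < 0 & P.[x%:C] != 0].
Proof.
move=> P0; apply: contrapT => hn; apply: hmu_inf.
have [s Ps] := closed_field_poly_normal P.
apply: (@sub_finite_set _ _ [set` [:: - h, 0 & [seq complex.Re z | z <- s]]]); last first.
  exact: finite_seq.
move=> x xs /=; rewrite !inE; apply/negPn/negP; rewrite !negb_or => /and3P[xh x0 xr].
apply: hn; exists x; split=> //.
  have := hmu_sub xs; rewrite /= in_itv /= => /andP[h1 h2].
  by rewrite lt_neqAle eq_sym xh h1 lt_neqAle x0 h2.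
apply: contra xr => /eqP Px; apply/mapP; exists x%:C => //.
by rewrite -root_prod_XsubC -(rootZ _ _ (_ : lead_coef P != 0)) ?lead_coef_eq0// -Ps; apply/rootP.
Qed.

Variables (N : nat) (phi : 'I_N.+1 -> {poly R[i]}).
Hypothesis hphi : orthogonal_sequence mu h phi.
Local Notation phiN := (phi ord_max).

(** Divide f by phi_k for k decreasing from the degree of f. *)
Lemma orth_lower f : (size f <= N)%N -> inner mu h f phiN = 0.
Proof.
have [sz ort] := hphi.
suff : forall k, (k <= N)%N -> forall f, (size f <= k)%N -> inner mu h f phiN = 0.
  by move=> H; exact: H.
elim=> [|k IH] kN {}f sf.
  move: sf; rewrite leqn0 size_poly_eq0 => /eqP ->.
  by rewrite -(scale0r (0 : {poly R[i]})) innerZl mul0r.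
have kN' : (k < N.+1)%N by exact: ltnW.
pose k' : 'I_N.+1 := Ordinal kN'.
have pk : (phi k')`_k != 0.
  have := lead_coef_eq0 (phi k'); rewrite /lead_coef sz /= => ->.
  by rewrite -size_poly_eq0 sz.
pose c := f`_k / (phi k')`_k.
have -> : f = (f - c *: phi k') + c *: phi k' by rewrite subrK.
rewrite innerDl innerZl ort ?mulr0 ?addr0; last first.
  by rewrite -val_eqE /= ltn_eqF.
apply: IH; first exact: ltnW.
apply/leq_sizeP => j; rewrite leq_eqVlt => /orP[/eqP <-|kj].
  by rewrite coefB coefZ /c divfK// subrr.
rewrite coefB coefZ !nth_default ?mulr0 ?subrr//; first by rewrite sz.
exact: leq_trans sf _.
Qed.

Lemma phiN_neq0 : phiN != 0.
Proof. by rewrite -size_poly_eq0 (hphi.1 ord_max). Qed.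

Lemma sqr_modulus (z : R[i]) : z * Num.conj z = (nc z ^+ 2)%:C.
Proof. by rewrite -sqr_normc normCE rmorphXn. Qed.

(** Otherwise |phi_N|^2 would vanish on the support, which contains a nonroot. *)
Lemma norm_phiN_neq0 : inner mu h phiN phiN != 0.
Proof.
apply/eqP => i0.
have [x [xs xin xP]] := support_nonroot phiN_neq0.
have e t : (Re_poly (phiN * conj_poly phiN)).[t] = nc phiN.[t%:C] ^+ 2.
  by rewrite -Re_polyE hornerM -conj_polyE sqr_modulus.
have : (Re_poly (phiN * conj_poly phiN)).[x] = 0.
  apply: zero_on_support => //; first by move=> t _; rewrite e sqr_ge0.
  have := congr1 (@complex.Re R) i0; rewrite innerE /= => i1; rewrite -[RHS]i1.
  by apply: eq_Rintegral => t _; rewrite Re_polyE.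
by move/eqP; rewrite e sqrf_eq0 nc_eq0 (negbTE xP).
Qed.

(** The coefficient of the projection on phi_N is the ratio of the
    coefficients of degree N, since phi_N is orthogonal to lower degrees. *)
Lemma size_trunc f : (size f <= N.+1)%N ->
  (size (f - (inner mu h f phiN / inner mu h phiN phiN) *: phiN)%R <= N)%N.
Proof.
move=> sf; pose a := f`_N / phiN`_N.
have sz := hphi.1 ord_max.
have pN : phiN`_N != 0.
  by have := lead_coef_eq0 phiN; rewrite /lead_coef sz /= => ->; exact: phiN_neq0.
have sa : (size (f - a *: phiN)%R <= N)%N.
  apply/leq_sizeP => j; rewrite leq_eqVlt => /orP[/eqP <-|Nj].
    by rewrite coefB coefZ /a divfK// subrr.
  rewrite coefB coefZ !nth_default ?mulr0 ?subrr//; first by rewrite sz.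
  exact: leq_trans sf _.
suff -> : inner mu h f phiN / inner mu h phiN phiN = a by [].
rewrite -{1}(subrK (a *: phiN) f) innerDl innerZl (orth_lower sa) add0r.
by rewrite mulfK// norm_phiN_neq0.
Qed.

(** A root at 0 gives phi_N = t psi with psi of lower degree. Then t |psi|^2,
    which is nonpositive on the interval, has integral zero, so psi vanishes
    at all interior points of the support. *)
Lemma phiN_at0 : (0 < N)%N -> phiN.[0] != 0.
Proof.
move=> N0; apply/eqP => /rootP/factor_theorem[psi]; rewrite subr0 => pE.
have psi0 : psi != 0.
  by apply/eqP => p0; have := phiN_neq0; rewrite pE p0 mul0r eqxx.
have spsi : (size psi <= N)%N.
  have := hphi.1 ord_max; rewrite pE size_mulX// => -[->].
  by rewrite leqnn.
have i0 := orth_lower spsi.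
have [x [xs xin xP]] := support_nonroot psi0.
have e t : (Re_poly (psi * conj_poly phiN)).[t] = t * nc psi.[t%:C] ^+ 2.
  rewrite -Re_polyE hornerM -conj_polyE pE hornerM hornerX rmorphM -[X in _ * (_ * X)]/(Num.conj t%:C) conj_real mulrA sqr_modulus.
  by rewrite cReMr mulrC.
have : (- Re_poly (psi * conj_poly phiN)).[x] = 0.
  apply: zero_on_support => //.
    by move=> t /andP[_ t0]; rewrite hornerN e oppr_ge0 mulr_le0_ge0// sqr_ge0.
  have := congr1 (@complex.Re R) i0; rewrite innerE /= => i1.
  under eq_Rintegral do rewrite hornerN -mulN1r.
  rewrite RintegralZl; [|exact: measurable_itv|exact: horner_integrable].
  rewrite (_ : Rintegral _ _ _ = 0) ?mulr0// -[RHS]i1.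
  by apply: eq_Rintegral => t _; rewrite Re_polyE.
move/eqP; rewrite hornerN e oppr_eq0 mulf_eq0 sqrf_eq0 nc_eq0 (negbTE xP) orbF.
by case/andP: xin => _; rewrite lt_neqAle => /andP[/negbTE ->].
Qed.

End Inner_product.

(** * The discretization in coordinates *)

Section Discretization.
Variables (R : realType) (n N : nat).
Variables (mu : {finite_measure set (measurableTypeR R) -> \bar R}) (h : R).
Variable phiN : {poly R[i]}.
Variables (X : (n * N.+1).-tuple (polyvec R n N.+1)) (Y : (n * N).-tuple (polyvec R n N)).
Hypothesis hY : basis_of fullv Y.
Hypothesis hX : basis_of fullv X.

Definition polyvec_of (x : 'cV[R[i]]_(n * N.+1)) : polyvec R n N.+1 :=
  \sum_j x j 0 *: tnth X j.

Lemma polyvec_ofE x i : (polyvec_of x i : {poly R[i]}) =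
  \sum_j x j 0 *: (tnth X j i : {poly R[i]}).
Proof.
rewrite /polyvec_of sum_ffunE raddf_sum; apply: eq_bigr => j _.
by rewrite ffunE.
Qed.

Lemma eval_mxE theta x : eval_mx X theta *m x = point_eval theta (polyvec_of x).
Proof.
apply/colP => i; rewrite !mxE polyvec_ofE horner_sum; apply: eq_bigr => j _.
by rewrite !mxE hornerZ mulrC.
Qed.

Lemma polyvec_of_inj x : polyvec_of x = 0 -> x = 0.
Proof.
move=> x0; apply/colP => i; rewrite mxE.
have fX := basis_free hX.
have := coord_sum_free (fun j => x j 0) i fX; rewrite -/(polyvec_of x).
have -> : \sum_(j < n * N.+1) x j 0 *: X`_j = polyvec_of x.
  by apply: eq_bigr => j _; rewrite (tnth_nth 0).
by rewrite x0 linear0 => ->.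
Qed.

(** By linearity the product is the vector of coordinates of the image, and
    the coordinates in Y determine the image. *)
Lemma op_mxE (f : polyvec R n N.+1 -> polyvec R n N) x : linear f ->
  op_mx X Y f *m x = 0 -> f (polyvec_of x) = 0.
Proof.
move=> lf h0.
pose F : {linear polyvec R n N.+1 -> polyvec R n N} :=
  HB.pack f (GRing.isLinear.Build _ _ _ _ f lf).
have Fx : f (polyvec_of x) = \sum_j x j 0 *: f (tnth X j).
  by rewrite -[f]/(F : _ -> _) /polyvec_of linear_sum; apply: eq_bigr => j _; rewrite linearZ.
rewrite (coord_basis hY (memvf (f (polyvec_of x)))) big1// => i _.
suff -> : coord Y i (f (polyvec_of x)) = 0 by rewrite scale0r.
rewrite Fx linear_sum /=.
have := congr1 (fun M : 'cV_(n * N) => M i 0) h0; rewrite !mxE => e0.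
rewrite -[RHS]e0; apply: eq_bigr => j _.
by rewrite linearZ mxE mulrC.
Qed.

Lemma trunc_linear : linear (@trunc R n N mu h phiN).
Proof.
move=> a u v; apply/ffunP => j; rewrite !ffunE.
apply/val_inj/polyP => k /=; rewrite coefD coefZ !coef_npolyp.
rewrite innerDl innerZl !(coefD, coefN, coefZ).
by case: ifP => _; [ring|rewrite mulr0 addr0].
Qed.

End Discretization.

(** The rows of U span the left kernel of M, whose annihilator is the range of
    M. *)
Lemma ker_basis_adjoint_image (R : realType) k l r (M : 'M[R[i]]_(k, l)) (U : 'M[R[i]]_(r, k))
    p (b : 'M[R[i]]_(k, p)) :
  ker_basis (M^t*)%sesqui (U^t*)%sesqui -> U *m b = 0 -> exists y, b = M *m y.
Proof.
move=> hU Ub; pose u := (cokermx M^T)^T.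
have uM : u *m M = 0 by apply: trmx_inj; rewrite trmx_mul trmxK mulmx_coker trmx0.
have h1 : (M^t*)%sesqui *m (u^t*)%sesqui = 0 by rewrite -ctr_mul uM trmx0 map_mx0.
have [w hw] := ker_basis_sub hU h1.
have uE : u = (w^t*)%sesqui *m U by rewrite -[LHS]ctrK hw ctr_mul ctrK.
have : (b^T <= M^T)%MS.
  rewrite submxE; apply/eqP; apply: trmx_inj.
  by rewrite trmx_mul trmxK -/u uE -mulmxA Ub mulmx0 trmx0.
case/submxP => y hy; exists y^T.
by apply: trmx_inj; rewrite trmx_mul trmxK.
Qed.

Lemma ker_basis_inj (R : realType) k l r (M : 'M[R[i]]_(k, l)) (V : 'M[R[i]]_(l, r))
    (y : 'cV[R[i]]_r) : ker_basis M V -> V *m y = 0 -> y = 0.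
Proof.
move=> [fV _] Vy; apply: trmx_inj; rewrite trmx0.
by apply: (row_free_inj fV); rewrite /= mul0mx -trmx_mul Vy trmx0.
Qed.

Lemma mulmx_cV_eq0 (R : realType) k l (M : 'M[R[i]]_(k, l)) :
  (forall w : 'cV_l, M *m w = 0) -> M = 0.
Proof.
move=> M0; apply/matrixP => i j.
by have /matrixP/(_ i 0) := M0 (delta_mx j 0); rewrite -colE !mxE.
Qed.

Theorem theorem3p3 (R : realType) (n p q m N r d : nat)
  (E : 'M[R[i]]_n) (A : 'I_m.+1 -> 'M[R[i]]_n)
  (B : 'M[R[i]]_(n, p)) (Cm : 'M[R[i]]_(q, n)) (tau : 'rV[R]_m)
  (htau : forall j k : 'I_m.+1, (j < k)%N -> delay tau j < delay tau k)
  (hindex : semi_explicit_index1 E A)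
  (hN : (1 <= N)%N)
  (mu : {finite_measure set (measurableTypeR R) -> \bar R})
  (hmu_sub : msupport mu `<=` `[- delay tau ord_max, 0])
  (hmu_inf : infinite_set (msupport mu))
  (phi : 'I_N.+1 -> {poly R[i]})
  (hphi : orthogonal_sequence mu (delay tau ord_max) phi)
  (X : (n * N.+1).-tuple (polyvec R n N.+1))
  (hX : basis_of fullv X)
  (Y : (n * N).-tuple (polyvec R n N))
  (hY : basis_of fullv Y)
  (V : 'M[R[i]]_(n * N.+1, r)) (U : 'M[R[i]]_(r, n + n * N))
  (Vp : 'M[R[i]]_(n * N.+1, d)) (Up : 'M[R[i]]_(d, n + n * N))
  (hUV : elimination_matrices (tau_E X Y E tau mu (phi ord_max)) V U Vp Up)
  (hH2 : (strong_H2_norm E A B Cm tau < +oo)%E)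
  (hphiN : forall k : 'I_m.+1, k != ord0 ->
     `|(phi ord_max).[(- delay tau k)%:C]| <= `|(phi ord_max).[0]|) :
  algebraic_block (tau_A X Y A tau) V U \in unitmx /\
  no_feedthrough (eliminate (tau_E X Y E tau mu (phi ord_max))
    (tau_A X Y A tau) (tau_B N B) (tau_C X Cm) V U Vp Up).
Proof.
have tau0 j : 0 < tau 0 j.
  by rewrite -delay_lift -[ltLHS](delay_ord0 tau); apply: htau.
set h := delay tau ord_max in hmu_sub hphi hUV *.
set phiN := phi ord_max in hUV hphiN *.
have phi0 : phiN.[0] != 0 := phiN_at0 hmu_sub hmu_inf hphi hN.
have [[kV _] [kU _] _ _] := hUV.
(* The point of the closed polydisc at which the delayed terms of the
   discretization are evaluated. *)
pose z (j : 'I_m) : R[i] := phiN.[(- tau 0 j)%:C] / phiN.[0].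
have hz : unit_polydisc z.
  move=> j; rewrite ncM ncV ler_pdivrMr ?nc_gt0// mul1r.
  have := hphiN (lift ord0 j) (neq_lift ord0 j); rewrite delay_lift.
  by rewrite !normCE lecR.
(* Truncation kills exactly the multiples phi_N v of phi_N, and then phi_N
   (0) <> 0 turns the first rows into E v = 0. *)
have kerE (x : 'cV_(n * N.+1)) : tau_E X Y E tau mu phiN *m x = 0 ->
    exists v : 'cV[R[i]]_n, [/\ E *m v = 0,
      forall theta, eval_mx X theta *m x = phiN.[theta%:C] *: v &
      v = 0 -> x = 0].
  rewrite /tau_E mul_col_mx -[X in _ = X]col_mx0 => /eq_col_mx[h1 h2].
  have := op_mxE hY (trunc_linear mu h phiN) h2.
  set xi := polyvec_of X x => tr0.
  pose v : 'cV[R[i]]_n := \col_i (inner mu h (xi i : {poly R[i]}) phiN / inner mu h phiN phiN).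
  have xiE i : (xi i : {poly R[i]}) = v i 0 *: phiN.
    have := congr1 (fun f : polyvec R n N => (f i : {poly R[i]})) tr0.
    rewrite /trunc !ffunE /= npolypK ?mxE; last first.
      by apply: (size_trunc hmu_sub hmu_inf hphi); exact: size_npoly.
    by move/eqP; rewrite subr_eq0 => /eqP.
  have ev theta : eval_mx X theta *m x = phiN.[theta%:C] *: v.
    rewrite eval_mxE; apply/colP => i.
    by rewrite [LHS]mxE -/xi xiE hornerZ [RHS]mxE mulrC.
  exists v; split=> //.
    move: h1; rewrite -mulmxA ev -scalemxAr => /eqP.
    by rewrite scaler_eq0 (negbTE phi0) => /eqP.
  move=> v0; apply: (polyvec_of_inj hX); apply/ffunP => i; apply: val_inj.
  by rewrite /= xiE v0 mxE scale0r ffunE.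
have Aeval (x : 'cV_(n * N.+1)) (v : 'cV[R[i]]_n) :
    (forall theta, eval_mx X theta *m x = phiN.[theta%:C] *: v) ->
    (\sum_k A k *m eval_mx X (- delay tau k)) *m x = delay_matrix A z *m (phiN.[0] *: v).
  move=> ev; rewrite big_ord_recl mulmxDl mulmxDl; congr (_ + _).
    by rewrite -mulmxA ev delay_ord0 oppr0.
  rewrite !mulmx_suml; apply: eq_bigr => j _.
  rewrite -mulmxA ev delay_lift -!scalemxAr -scalemxAl scalerA.
  by rewrite /z mulrC divfK.
(* The equations of a null vector of the algebraic block hold modulo the
   range of the leading matrix; their first rows hold modulo the range of
   E. *)
have inj (y : 'cV[R[i]]_r) : algebraic_block (tau_A X Y A tau) V U *m y = 0 -> y = 0.
  move=> hy; apply: (ker_basis_inj kV).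
  have Ex : tau_E X Y E tau mu phiN *m (V *m y) = 0.
    by rewrite mulmxA (ker_basis_mul kV) mul0mx.
  have [v [Ev ev vx]] := kerE _ Ex; apply: vx.
  have Uh : U *m (tau_A X Y A tau *m (V *m y)) = 0 by rewrite !mulmxA.
  have [y' hy'] := ker_basis_adjoint_image kU Uh.
  move: hy'; rewrite /tau_A /tau_E !mul_col_mx => /eq_col_mx[h1 _].
  rewrite (Aeval _ _ ev) -mulmxA in h1.
  have Ev' : E *m (phiN.[0] *: v) = 0 by rewrite -scalemxAr Ev scaler0.
  have := algebraic_part_injective tau0 hindex hH2 hz Ev' h1.
  by move/eqP; rewrite scaler_eq0 (negbTE phi0) => /eqP.
have A22u : algebraic_block (tau_A X Y A tau) V U \in unitmx.
  rewrite unitmxE unitfE; apply/eqP => /det0_vector[y y0 hy].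
  by rewrite (inj y hy) eqxx in y0.
split=> //.
rewrite /no_feedthrough /= -/(algebraic_block (tau_A X Y A tau) V U).
apply/eqP; rewrite oppr_eq0; apply/eqP.
set A22 := algebraic_block _ _ _ in A22u *.
apply: mulmx_cV_eq0 => w.
(* A column of the feedthrough matrix is the output at y, where y solves
   the algebraic equations with input w. *)
pose y := - (invmx A22 *m (U *m tau_B N B) *m w).
have A22y : A22 *m y + U *m tau_B N B *m w = 0.
  by rewrite mulmxN !mulmxA mulmxV// mul1mx addrC subrr.
suff : tau_C X Cm *m V *m y = 0.
  by rewrite mulmxN !mulmxA => /eqP; rewrite oppr_eq0 => /eqP.
have Ex : tau_E X Y E tau mu phiN *m (V *m y) = 0.
  by rewrite mulmxA (ker_basis_mul kV) mul0mx.
have [v [Ev ev vx]] := kerE _ Ex.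
have Uh : U *m (tau_A X Y A tau *m (V *m y) + tau_B N B *m w) = 0.
  by rewrite mulmxDr !mulmxA.
have [y' hy'] := ker_basis_adjoint_image kU Uh.
move: hy'; rewrite /tau_A /tau_E /tau_B !mul_col_mx add_col_mx => /eq_col_mx[h1 _].
rewrite (Aeval _ _ ev) -mulmxA in h1.
have Ev' : E *m (phiN.[0] *: v) = 0 by rewrite -scalemxAr Ev scaler0.
have := algebraic_part_output tau0 hindex hH2 hz Ev' h1.
by rewrite /tau_C -!mulmxA ev.
Qed.
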